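(* Let $r\ge1$ and $n\ge0$ be integers. There is a closed immersion $$\mathrm{Quot}_{\mathbb A^3}(\mathcal O^r,n)\hookrightarrow \mathrm{Quot}^n_r$$ cut out scheme-theoretically by the exact one-form $\mathrm d f_n$, where $\mathrm{Quot}^n_r$ is the non-commutative Quot scheme and $f_n\colon\mathrm{Quot}^n_r\to\mathbb A^1$ is the regular function induced by $(A,B,C,v_1,\dots,v_r)\mapsto\mathrm{Tr}\,A[B,C]$.
   Context: Work over $\mathbb C$. $\mathrm{Quot}_{\mathbb A^3}(\mathcal O^r,n)$ is the Quot scheme of length $n$ quotients of $\mathcal O_{\mathbb A^3}^{r}$. Let $V_n$ be an $n$-dimensional vector space and let $U_{n,r}\subset\mathrm{End}(V_n)^3\times V_n^r$ be the open subset of tuples $(A,B,C,v_1,\dots,v_r)$ such that $v_1,\dots,v_r$ generate $V_n$ as a left $\mathbb C\langle x,y,z\rangle$-module, where $x,y,z$ act by $A,B,C$. The group $\mathrm{GL}_n$ acts freely on $U_{n,r}$ by $g\cdot(A,B,C,v_1,\dots,v_r)=(gAg^{-1},gBg^{-1},gCg^{-1},gv_1,\dots,gv_r)$. The non-commutative Quot scheme is the GIT quotient $\mathrm{Quot}^n_r=U_{n,r}/\mathrm{GL}_n$ with respect to the character $\det$, a smooth quasi-projective variety of dimension $2n^2+rn$. The $\mathrm{GL}_n$-invariant function $(A,B,C,v_1,\dots,v_r)\mapsto\mathrm{Tr}\,A[B,C]$ on $U_{n,r}$ descends to $f_n\colon \mathrm{Quot}^n_r\to\mathbb A^1$. *)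

(* Defs.v *)
(* Schemes over a field k are handled through their functors of points on
   commutative k-algebras.  In MathComp these algebras are nonzero, which loses
   nothing: a scheme has exactly one point over the zero ring. *)
From HB Require Import structures.
From mathcomp Require Import all_boot all_order all_algebra.
From mathcomp Require Import mpoly boolp.

Set Implicit Arguments.
Unset Strict Implicit.
Unset Printing Implicit Defensive.
Import GRing.Theory.
Local Open Scope ring_scope.

Section Algebras.
Variable k : fieldType.
Implicit Types A B S T : comAlgType k.

Lemma lrmorphism_ext A B (f g : {lrmorphism A -> B}) : f =1 g -> f = g.
Proof.
case: f => f [[f1] [f2] [f3]]; case: g => g [[g1] [g2] [g3]] /= fg.
have {}fg : f = g by apply/funext.
subst g; congr (GRing.LRMorphism.Pack (GRing.LRMorphism.Class _ _ _));
  congr (_ _); exact: Prop_irrelevance.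
Qed.

Definition is_unit A (a : A) : Prop := exists b, a * b = 1.

Definition is_field A : Prop := forall a : A, a <> 0 -> is_unit a.

Definition unit_ideal A (I : A -> Prop) : Prop :=
  exists m (a b : 'I_m -> A), (forall i, I (a i)) /\ \sum_i b i * a i = 1.

Definition is_localization A B (g : A) (l : {lrmorphism A -> B}) : Prop :=
  [/\ is_unit (l g),
      forall y, exists a d, y * l g ^+ d = l a &
      forall a, l a = 0 -> exists d, g ^+ d * a = 0].

End Algebras.

Section Span.
Variables (A : nzRingType) (M : lmodType A).

Definition submodule (N : M -> Prop) : Prop :=
  N 0 /\ forall a x y, N x -> N y -> N (a *: x + y).

Definition span (G : M -> Prop) (x : M) : Prop :=
  exists m (a : 'I_m -> A) (y : 'I_m -> M),
    (forall i, G (y i)) /\ x = \sum_i a i *: y i.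

Lemma submoduleZ (N : M -> Prop) a x : submodule N -> N x -> N (a *: x).
Proof. by case=> N0 NS Nx; rewrite -[_ *: _]addr0; exact: NS. Qed.

Lemma submoduleD (N : M -> Prop) x y : submodule N -> N x -> N y -> N (x + y).
Proof. by case=> N0 NS Nx; rewrite -[x]scale1r; exact: NS. Qed.

Lemma submoduleB (N : M -> Prop) x y : submodule N -> N x -> N y -> N (x - y).
Proof.
by move=> Ns Nx Ny; rewrite -scaleN1r; apply: submoduleD => //; exact: submoduleZ.
Qed.

Lemma submodule_sum (N : M -> Prop) (I : Type) (s : seq I) (P : pred I) (F : I -> M) :
  submodule N -> (forall i, P i -> N (F i)) -> N (\sum_(i <- s | P i) F i).
Proof.
by move=> Ns NF; apply: (big_ind N) => //; [case: Ns | move=> *; exact: submoduleD].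
Qed.

Lemma span_submodule G : submodule (span G).
Proof.
split=> [|a x y [m [c [u [Gu ->]]]] [p [d [v [Gv ->]]]]].
  by exists 0%N, (fun=> 0), (fun=> 0); split=> [[]|]//; rewrite big_ord0.
exists (m + p)%N,
  (fun i => match split i with inl i => a * c i | inr j => d j end),
  (fun i => match split i with inl i => u i | inr j => v j end).
split=> [i|]; first by case: split.
rewrite big_split_ord /= scaler_sumr; congr (_ + _); apply: eq_bigr => i _.
  by rewrite (unsplitK (inl i)) scalerA.
by rewrite (unsplitK (inr i)).
Qed.

Lemma span_sub (G : M -> Prop) x : G x -> span G x.
Proof.
move=> Gx; exists 1%N, (fun=> 1), (fun=> x); split=> //.
by rewrite big_ord1 scale1r.
Qed.

Lemma span_min (G N : M -> Prop) x :
  submodule N -> (forall y, G y -> N y) -> span G x -> N x.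
Proof.
move=> Ns GN [m [a [y [Gy ->]]]]; apply: submodule_sum => // i _.
by apply: submoduleZ => //; exact: GN.
Qed.

End Span.

(* The trivial square-zero extension A (+) M. *)
Definition sqzero (k : fieldType) (A : comAlgType k) (M : lmodType A) : Type :=
  (A * M)%type.

Section SquareZero.
Variables (k : fieldType) (A : comAlgType k) (M : lmodType A).
Local Notation E := (sqzero M).

HB.instance Definition _ := GRing.Zmodule.copy E (A * M)%type.

Definition sqzero_one : E := (1, 0).
Definition sqzero_mul (x y : E) : E := (x.1 * y.1, x.1 *: y.2 + y.1 *: x.2).
Definition sqzero_scale (c : k) (x : E) : E := (c *: x.1, c%:A *: x.2).

Fact sqzero_mulA : associative sqzero_mul.
Proof.
move=> x y z; congr pair; first exact: mulrA.
by rewrite /= !scalerDr !scalerA addrA (mulrC z.1 x.1) (mulrC z.1 y.1).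
Qed.
Fact sqzero_mulC : commutative sqzero_mul.
Proof. by move=> x y; congr pair; [exact: mulrC | exact: addrC]. Qed.
Fact sqzero_mul1 : left_id sqzero_one sqzero_mul.
Proof.
case=> a m; congr pair; first exact: mul1r.
by rewrite /= scale1r scaler0 addr0.
Qed.
Fact sqzero_mulDl : left_distributive sqzero_mul +%R.
Proof.
move=> x y z; congr pair; first exact: mulrDl.
by rewrite /= scalerDl scalerDr addrACA.
Qed.
Fact sqzero_1neq0 : sqzero_one != 0.
Proof. by apply/eqP => -[/eqP]; rewrite oner_eq0. Qed.

HB.instance Definition _ := GRing.Zmodule_isComNzRing.Build E
  sqzero_mulA sqzero_mulC sqzero_mul1 sqzero_mulDl sqzero_1neq0.

Fact sqzero_scaleA a b x :
  sqzero_scale a (sqzero_scale b x) = sqzero_scale (a * b) x.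
Proof.
by congr pair; rewrite /= scalerA // -scalerAl mul1r scalerA.
Qed.
Fact sqzero_scale1 : left_id 1 sqzero_scale.
Proof. by case=> a m; congr pair; rewrite /= !scale1r. Qed.
Fact sqzero_scaleDr : right_distributive sqzero_scale +%R.
Proof. by move=> c x y; congr pair; rewrite /= scalerDr. Qed.
Fact sqzero_scaleDl x : {morph sqzero_scale^~ x : a b / a + b}.
Proof. by move=> a b; congr pair; rewrite /= !scalerDl. Qed.

HB.instance Definition _ := GRing.Zmodule_isLmodule.Build k E
  sqzero_scaleA sqzero_scale1 sqzero_scaleDr sqzero_scaleDl.

Fact sqzero_scaleAl (c : k) (x y : E) : c *: (x * y) = (c *: x) * y.
Proof.
congr pair; first exact: scalerAl.
by rewrite /= scalerDr !scalerA mulr_algl (mulrC y.1).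
Qed.
HB.instance Definition _ := GRing.Lmodule_isLalgebra.Build k E sqzero_scaleAl.
HB.instance Definition _ := GRing.Lalgebra_isComAlgebra.Build k E.

Definition sqzero_fst (x : E) : A := x.1.

Fact sqzero_fst_additive : zmod_morphism sqzero_fst.
Proof. by []. Qed.
Fact sqzero_fst_multiplicative : monoid_morphism sqzero_fst.
Proof. by []. Qed.
Fact sqzero_fst_scalable : scalable sqzero_fst.
Proof. by []. Qed.
HB.instance Definition _ :=
  GRing.isZmodMorphism.Build E A sqzero_fst sqzero_fst_additive.
HB.instance Definition _ :=
  GRing.isMonoidMorphism.Build E A sqzero_fst sqzero_fst_multiplicative.
HB.instance Definition _ :=
  GRing.isScalable.Build k E A *:%R sqzero_fst sqzero_fst_scalable.

End SquareZero.

Section SquareZeroMap.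
Variables (k : fieldType) (A B : comAlgType k) (M : lmodType A) (N : lmodType B).
Variables (phi : {lrmorphism A -> B}) (u : {linear M -> N | phi \; *:%R}).

Definition sqzero_map (x : sqzero M) : sqzero N := (phi x.1, u x.2).

Fact sqzero_map_additive : zmod_morphism sqzero_map.
Proof. by move=> x y; congr pair; rewrite /= raddfB. Qed.
Fact sqzero_map_multiplicative : monoid_morphism sqzero_map.
Proof.
split=> [|x y]; congr pair; rewrite /= ?rmorph1 ?raddf0 ?rmorphM //.
by rewrite raddfD; congr (_ + _); exact: linearZ_LR.
Qed.
Fact sqzero_map_scalable : scalable sqzero_map.
Proof. 
move=> c x; congr pair; first exact: linearZ.
by rewrite /= -(rmorph_alg phi); exact: linearZ_LR.
Qed.
HB.instance Definition _ :=
  GRing.isZmodMorphism.Build (sqzero M) (sqzero N) sqzero_map sqzero_map_additive.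
HB.instance Definition _ := GRing.isMonoidMorphism.Build (sqzero M) (sqzero N)
  sqzero_map sqzero_map_multiplicative.
HB.instance Definition _ := GRing.isScalable.Build k (sqzero M) (sqzero N) *:%R
  sqzero_map sqzero_map_scalable.

End SquareZeroMap.

Record functor (k : fieldType) := Functor {
  points :> comAlgType k -> Type;
  pmap : forall S T : comAlgType k, {lrmorphism S -> T} -> points S -> points T;
  pmap_id : forall (S : comAlgType k) (x : points S), pmap idfun x = x;
  pmap_comp : forall (S T V : comAlgType k) (f : {lrmorphism S -> T})
    (g : {lrmorphism T -> V}) (x : points S),
    pmap (g \o f) x = pmap g (pmap f x)
}.
Arguments pmap {k} f {S T} _ _ : rename.

Record morphism (k : fieldType) (X Y : functor k) := Morphism {
  mor :> forall S : comAlgType k, X S -> Y S;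
  mor_nat : forall (S T : comAlgType k) (f : {lrmorphism S -> T}) (x : X S),
    mor (pmap X f x) = pmap Y f (mor x)
}.

Section Functors.
Variable k : fieldType.
Implicit Types (S T : comAlgType k) (X Y Z : functor k).

Definition comp_mor X Y Z (g : morphism Y Z) (f : morphism X Y) : morphism X Z.
Proof. by exists (fun S x => g S (f S x)) => S T h x; rewrite !mor_nat. Defined.

Definition Spec (B : comAlgType k) : functor k.
Proof.
by exists (fun S => {lrmorphism B -> S})
  (fun S T (f : {lrmorphism S -> T}) (x : {lrmorphism B -> S}) =>
    f \o x : {lrmorphism B -> T}) => *; apply: lrmorphism_ext.
Defined.

Definition A1 : functor k.
Proof. by exists (fun S => S) (fun S T f => f). Defined.

Definition subset X := forall S, X S -> Prop.

Definition stable X (P : subset X) :=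
  forall S T (f : {lrmorphism S -> T}) (x : X S), P S x -> P T (pmap X f x).

Definition subfunctor X (P : subset X) (Pst : stable P) : functor k.
Proof.
exists (fun S => {x : X S | P S x})
  (fun S T f x => exist _ (pmap X f (sval x)) (Pst S T f _ (svalP x))).
- by move=> S [x Px]; apply: eq_exist; rewrite pmap_id.
- by move=> S T V f g [x Px]; apply: eq_exist; rewrite pmap_comp.
Defined.

Definition incl X (P : subset X) (Pst : stable P) :
  morphism (subfunctor Pst) X.
Proof. by exists (fun S x => sval x). Defined.

Definition mor_image X Y (f : morphism X Y) : subset Y :=
  fun S y => exists x, f S x = y.

(* The pull-back of P along any x : Spec S -> X is the open subscheme D(I). *)
Definition open_subset X (P : subset X) : Prop :=
  forall S (x : X S), exists I : S -> Prop,
    forall T (f : {lrmorphism S -> T}),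
      P T (pmap X f x) <-> unit_ideal (fun b => exists2 a, I a & b = f a).

(* The pull-back of P along any x : Spec S -> X is the closed subscheme V(I). *)
Definition closed_subset X (P : subset X) : Prop :=
  forall S (x : X S), exists I : S -> Prop,
    forall T (f : {lrmorphism S -> T}),
      P T (pmap X f x) <-> forall a, I a -> f a = 0.

Definition open_immersion X Y (f : morphism X Y) : Prop :=
  (forall S, injective (f S)) /\ open_subset (mor_image f).

Definition closed_immersion X Y (f : morphism X Y) : Prop :=
  (forall S, injective (f S)) /\ closed_subset (mor_image f).

Definition zariski_sheaf X : Prop :=
  forall S m (g : 'I_m -> S) (S_ : 'I_m -> comAlgType k)
    (l : forall i, {lrmorphism S -> S_ i}),
    unit_ideal (fun a => exists i, a = g i) ->
    (forall i, is_localization (g i) (l i)) ->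
  forall x : forall i, X (S_ i),
    (forall i j T (f : {lrmorphism S_ i -> T}) (h : {lrmorphism S_ j -> T}),
       f \o l i =1 h \o l j -> pmap X f (x i) = pmap X h (x j)) ->
  exists! y : X S, forall i, pmap X (l i) y = x i.

Definition nonvanishing X (f : morphism X A1) : subset X :=
  fun S x => is_unit (f S x).

Lemma nonvanishing_stable X (f : morphism X A1) : stable (nonvanishing f).
Proof.
move=> S T h x [b hb]; exists (h b).
by rewrite mor_nat /= -rmorphM hb rmorph1.
Qed.

(* A section of the cotangent sheaf of a scheme X.  For x : Spec S -> X and an
   S-module M, the points of X over S (+) M that restrict to x are the elements
   of Hom_S(x^* Omega_X, M).  By the Yoneda lemma, an element of x^* Omega_X is a
   natural family of maps from these sets to M. *)
Record one_form X := OneForm {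
  form :> forall S (M : lmodType S), X (sqzero M) -> M;
  form_nat : forall S T (M : lmodType S) (N : lmodType T)
    (f : {lrmorphism S -> T}) (u : {linear M -> N | f \; *:%R})
    (y : X (sqzero M)),
    form (pmap X (sqzero_map u) y) = u (form y)
}.

Definition exact_form X (f : morphism X A1) : one_form X.
Proof.
by exists (fun S M y => (f (sqzero M) y).2) => S T M N h u y; rewrite mor_nat.
Defined.

(* The points x of X over S such that x^* w = 0 in x^* Omega_X. *)
Definition zero_scheme X (w : one_form X) : subset X :=
  fun S x => forall (M : lmodType S) (y : X (sqzero M)),
    pmap X (@sqzero_fst k S M) y = x -> w S M y = 0.

End Functors.

Section NonCommutativeQuot.
Variables (k : fieldType) (n r : nat).
Implicit Types S T : comAlgType k.

(* End(V_n)^3 x V_n^r; the r vectors are the columns of [vecs]. *)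
Record tuple3 S := Tuple3 {
  matA : 'M[S]_n; matB : 'M[S]_n; matC : 'M[S]_n; vecs : 'M[S]_(n, r)
}.

Definition W : functor k.
Proof.
exists tuple3 (fun S T (f : {lrmorphism S -> T}) w =>
  Tuple3 (map_mx f (matA w)) (map_mx f (matB w)) (map_mx f (matC w))
         (map_mx f (vecs w))).
- by move=> S [A B C v]; rewrite /= !map_mx_id.
- by move=> S T V f g [A B C v]; congr Tuple3; exact: map_mx_comp.
Defined.

Definition generating : subset W := fun S w =>
  forall N : 'cV[S]_n -> Prop, submodule N ->
    (forall u, N u -> [/\ N (matA w *m u), N (matB w *m u) & N (matC w *m u)]) ->
    (forall i, N (col i (vecs w))) ->
  forall u, N u.

Lemma generating_stable : stable generating.
Proof.
move=> S T f w gen N Ns NABC Nv.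
have Nf : forall u, N (map_mx f u).
  apply: (gen (fun u => N (map_mx f u))); first split.
  - by rewrite map_mx0; exact: Ns.1.
  - by move=> a x y Nx Ny; rewrite map_mxD map_mxZ; exact: Ns.2.
  - by move=> u /NABC; rewrite /= -!map_mxM.
  - by move=> i; rewrite map_col; exact: Nv.
move=> u; have -> : u = \sum_i u i 0 *: map_mx f (delta_mx i 0).
  rewrite [LHS]matrix_sum_delta; apply: eq_bigr => i _.
  by rewrite big_ord1 map_delta_mx.
by apply: submodule_sum => // i _; exact: submoduleZ.
Qed.

Definition U : functor k := subfunctor generating_stable.

(* The action of g in GL_n(S), given together with its inverse h. *)
Definition act S (g h : 'M[S]_n) (w : W S) : W S :=
  Tuple3 (g *m matA w *m h) (g *m matB w *m h) (g *m matC w *m h)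
         (g *m vecs w).

Definition invariant (P : subset U) (Pst : stable P) (Y : functor k)
    (f : morphism (subfunctor Pst) Y) : Prop :=
  forall S (g h : 'M[S]_n) (w w' : subfunctor Pst S), g *m h = 1%:M ->
    sval (sval w') = act g h (sval (sval w)) -> f S w' = f S w.

(* Regular functions s on End(V_n)^3 x V_n^r with g^* s = det(g)^d s. *)
Definition semi_invariant (d : nat) (s : morphism W (A1 k)) : Prop :=
  forall S (g h : 'M[S]_n) (w : W S), g *m h = 1%:M ->
    s S (act g h w) = \det g ^+ d * s S w.

Definition U_ (s : morphism W (A1 k)) :=
  subfunctor (@nonvanishing_stable k U (comp_mor s (incl generating_stable))).

(* j identifies Spec B with an open subscheme of Q whose inverse image in U is
   U_s, and B with the ring of invariant functions on U_s. *)
Definition GIT_chart (Q : functor k) (pi : morphism U Q)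
    (s : morphism W (A1 k)) (B : comAlgType k) (j : morphism (Spec B) Q) : Prop :=
  [/\ open_immersion j,
      forall S (w : U S), mor_image j (pi S w) <-> is_unit (s S (sval w)) &
      forall h : morphism (U_ s) (A1 k), invariant h ->
        exists! b : B, forall S (w : U_ s S) (x : Spec B S),
          j S x = pi S (sval w) -> h S w = x b].

(* Q = Proj of the ring of semi-invariants: the scheme glued from the affine
   quotients of the sets U_s, for the semi-invariants s of weight det^d, d > 0.
   Points over fields detect that these affine opens cover Q. *)
Definition GIT_quotient (Q : functor k) (pi : morphism U Q) : Prop :=
  [/\ forall S (g h : 'M[S]_n) (w w' : U S), g *m h = 1%:M ->
        sval w' = act g h (sval w) -> pi S w' = pi S w,
      zariski_sheaf Q,
      forall d s, (0 < d)%N -> semi_invariant d s ->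
        (exists S (w : W S), s S w <> 0) ->
        exists B (j : morphism (Spec B) Q), GIT_chart pi s j &
      forall K (q : Q K), is_field K ->
        exists d s B (j : morphism (Spec B) Q),
          [/\ (0 < d)%N, semi_invariant d s, GIT_chart pi s j & mor_image j q]].

Definition potential S (w : W S) : S :=
  \tr (matA w *m (matB w *m matC w - matC w *m matB w)).

End NonCommutativeQuot.

Section Quot.
Variables (k : fieldType) (n r : nat).
Implicit Types S T : comAlgType k.

Definition free_mod S := 'rV[{mpoly S[3]}]_r.

Definition free_mod_map S T (f : {lrmorphism S -> T}) :
  free_mod S -> free_mod T := map_mx (map_mpoly f).

(* The localization at g of the S-module S[x,y,z]^r / N is free, with basis the
   images of the e j; the powers of g clear denominators. *)
Definition free_at S (N : free_mod S -> Prop) (g : S)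
    (e : 'I_n -> free_mod S) : Prop :=
  (forall p, exists d (c : 'I_n -> S),
     N ((g ^+ d)%:MP *: p - \sum_j (c j)%:MP *: e j)) /\
  (forall c : 'I_n -> S, N (\sum_j (c j)%:MP *: e j) ->
     exists d, forall j, g ^+ d * c j = 0).

Definition locally_free S (N : free_mod S -> Prop) : Prop :=
  unit_ideal (fun g => exists e, free_at N g e).

(* The submodules N of S[x,y,z]^r such that S[x,y,z]^r / N is locally free of
   rank n over S. *)
Definition quot_point S (N : free_mod S -> Prop) : Prop :=
  submodule N /\ locally_free N.

(* The kernel of T[x,y,z]^r -> T (x)_S (S[x,y,z]^r / N). *)
Definition base_change S T (f : {lrmorphism S -> T}) (N : free_mod S -> Prop) :
    free_mod T -> Prop :=
  span (fun q => exists2 p, N p & q = free_mod_map f p).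

Section BaseChange.
Variables (S T : comAlgType k) (f : {lrmorphism S -> T}).

Lemma free_mod_mapD : {morph free_mod_map f : p q / p + q}.
Proof. exact: map_mxD. Qed.

Lemma free_mod_mapB : {morph free_mod_map f : p q / p - q}.
Proof. exact: map_mxB. Qed.

Lemma free_mod_mapZ a p :
  free_mod_map f (a *: p) = map_mpoly f a *: free_mod_map f p.
Proof. exact: map_mxZ. Qed.

Lemma free_mod_map_comb (c : 'I_n -> S) e :
  free_mod_map f (\sum_j (c j)%:MP *: e j) =
  \sum_j (f (c j))%:MP *: free_mod_map f (e j).
Proof.
rewrite [LHS]raddf_sum; apply: eq_bigr => j _.
by apply: etrans (free_mod_mapZ _ _) _; rewrite map_mpolyC.
Qed.

Definition mono (A : comAlgType k) (b : 'I_r * 'X_{1..3}) : free_mod A :=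
  'X_[b.2] *: delta_mx 0 b.1.

Lemma mono_map b : free_mod_map f (mono S b) = mono T b.
Proof. by rewrite free_mod_mapZ map_mpolyX /free_mod_map map_delta_mx. Qed.

Definition bounded (A : comAlgType k) D (p : free_mod A) :=
  forall i, (msize (p ord0 i) <= D)%N.

Lemma boundedP (A : comAlgType k) (p : free_mod A) :
  exists D0, forall D, (D0 <= D)%N -> bounded D p.
Proof.
exists (\max_i msize (p ord0 i))%N => D le i; apply: leq_trans le.
exact: leq_bigmax.
Qed.

Lemma free_modE (A : comAlgType k) D (p : free_mod A) : bounded D p ->
  p = \sum_(b : 'I_r * 'X_{1..3 < D})
        ((p 0 b.1)@_b.2)%:MP *: mono A (b.1, bmnm b.2).
Proof.
move=> pD; rewrite {1}(row_sum_delta p).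
rewrite -(pair_bigA _ (fun i (m : 'X_{1..3 < D}) =>
  ((p 0 i)@_m)%:MP *: mono A (i, bmnm m))) /=.
apply: eq_bigr => i _; rewrite {1}(mpolywE (pD i)) scaler_suml.
by apply: eq_bigr => m _; rewrite /mono /= scalerA mul_mpolyC.
Qed.

Lemma ex_uniform (I : finType) (P : I -> nat -> Prop) :
  (forall i d d', (d <= d')%N -> P i d -> P i d') ->
  (forall i, exists d, P i d) -> exists d, forall i, P i d.
Proof.
move=> Pm /choice[d dP]; exists (\max_i d i)%N => i.
by apply: Pm (dP i); exact: leq_bigmax.
Qed.

Lemma free_at_base_change (N : free_mod S -> Prop) g e : submodule N ->
  free_at N g e ->
  free_at (base_change f N) (f g) (fun j => free_mod_map f (e j)).
Proof.
move=> Ns [gen indep]; pose NT := base_change f N.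
have NTs : submodule NT by exact: span_submodule.
have NTin p : N p -> NT (free_mod_map f p) by move=> Np; apply: span_sub; exists p.
have genm (A : comAlgType k) (N' : free_mod A -> Prop) e' (h : A) p d (c : 'I_n -> A) D :
    submodule N' -> (d <= D)%N -> N' ((h ^+ d)%:MP *: p - \sum_j (c j)%:MP *: e' j) ->
    N' ((h ^+ D)%:MP *: p - \sum_j (h ^+ (D - d) * c j)%:MP *: e' j).
  move=> Ns' dD /(submoduleZ (h ^+ (D - d))%:MP Ns').
  rewrite scalerBr scalerA -mpolyCM -exprD subnK // scaler_sumr.
  by under eq_bigr do rewrite scalerA -mpolyCM.
have /choice[dc dcP] : forall b, exists dc : nat * ('I_n -> S),
    N ((g ^+ dc.1)%:MP *: mono S b - \sum_j (dc.2 j)%:MP *: e j).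
  by move=> b; have [d [c dcP]] := gen (mono S b); exists (d, c).
pose K D := (\max_(b : 'I_r * 'X_{1..3 < D}) (dc (b.1, bmnm b.2)).1)%N.
pose co D (b : 'I_r * 'X_{1..3 < D}) j :=
  g ^+ (K D - (dc (b.1, bmnm b.2)).1) * (dc (b.1, bmnm b.2)).2 j.
have coP D (b : 'I_r * 'X_{1..3 < D}) :
    N ((g ^+ K D)%:MP *: mono S (b.1, bmnm b.2) - \sum_j (co D b j)%:MP *: e j).
  apply: genm (dcP _) => //.
  exact: (leq_bigmax (F := fun b : 'I_r * 'X_{1..3 < D} => (dc (b.1, bmnm b.2)).1)).
pose L D (p : free_mod S) j :=
  \sum_(b : 'I_r * 'X_{1..3 < D}) (p 0 b.1)@_b.2 * co D b j.
pose LT D (p : free_mod T) j :=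
  \sum_(b : 'I_r * 'X_{1..3 < D}) (p 0 b.1)@_b.2 * f (co D b j).
have LP D p : bounded D p -> N ((g ^+ K D)%:MP *: p - \sum_j (L D p j)%:MP *: e j).
  move=> pD; rewrite {1}(free_modE pD).
  have -> : \sum_j (L D p j)%:MP *: e j =
      \sum_(b : 'I_r * 'X_{1..3 < D}) ((p 0 b.1)@_b.2)%:MP *: \sum_j (co D b j)%:MP *: e j.
    under [RHS]eq_bigr do rewrite scaler_sumr.
    rewrite exchange_big /=; apply: eq_bigr => j _.
    rewrite /L raddf_sum scaler_suml; apply: eq_bigr => b _.
    by rewrite scalerA; congr (_ *: _); exact: mpolyCM.
  rewrite scaler_sumr -sumrB; apply: submodule_sum => // b _.
  rewrite scalerA mulrC -scalerA -scalerBr; exact: submoduleZ.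
have LTD D p q j : LT D (p + q) j = LT D p j + LT D q j.
  by rewrite -big_split; apply: eq_bigr => b _; rewrite mxE mcoeffD mulrDl.
have LTZ D a p j : LT D (a%:MP *: p) j = a * LT D p j.
  by rewrite mulr_sumr; apply: eq_bigr => b _; rewrite mxE mcoeffCM mulrA.
have LTf D p j : LT D (free_mod_map f p) j = f (L D p j).
  rewrite raddf_sum; apply: eq_bigr => b _.
  by rewrite mxE mcoeff_map_mpoly [RHS]rmorphM.
have LT_sum D (I : Type) (s : seq I) F j :
    LT D (\sum_(i <- s) F i) j = \sum_(i <- s) LT D (F i) j.
  apply: (big_morph (fun p => LT D p j) (fun p q => LTD D p q j)).
  by apply: big1 => b _; rewrite mxE mcoeff0 mul0r.
pose psi (q : free_mod T) := exists D0, forall D, (D0 <= D)%N ->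
  exists d, forall j, f g ^+ d * LT D q j = 0.
have psi0 : psi 0.
  exists 0%N => D _; exists 0%N => j.
  by rewrite /LT big1 ?mulr0 // => b _; rewrite mxE mcoeff0 mul0r.
have psiD p q : psi p -> psi q -> psi (p + q).
  move=> [D1 h1] [D2 h2]; exists (maxn D1 D2) => D; rewrite geq_max => /andP[le1 le2].
  have [d1 {}h1] := h1 _ le1; have [d2 {}h2] := h2 _ le2.
  exists (d1 + d2)%N => j; rewrite LTD mulrDr {1}addnC !exprD -!mulrA h1 h2.
  by rewrite !mulr0 addr0.
have psiZ a q : psi q -> psi (a%:MP *: q).
  move=> [D0 h]; exists D0 => D /h[d hd]; exists d => j.
  by rewrite LTZ mulrCA hd mulr0.
have psiN p : N p -> psi (free_mod_map f p).
  move=> Np; have [D0 bd] := boundedP p; exists D0 => D /bd/LP NL.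
  have /indep[d hd] : N (\sum_j (L D p j)%:MP *: e j).
    rewrite -[X in N X](subKr ((g ^+ K D)%:MP *: p)).
    by apply: submoduleB => //; exact: submoduleZ.
  by exists d => j; rewrite LTf -rmorphXn -rmorphM hd rmorph0.
have NTpsi q : NT q -> psi q.
  move=> NTq; rewrite -[q]scale1r; move: (1 : {mpoly T[3]}) => t; move: t.
  apply: (span_min (N := fun q => forall t, psi (t *: q))) NTq.
    split=> [t|a x y hx hy t]; first by rewrite scaler0.
    by rewrite scalerDr scalerA; exact: psiD.
  move=> _ [p Np ->] t; rewrite (mpolyE t) scaler_suml.
  apply: big_ind => // m _; rewrite -mul_mpolyC -scalerA; apply: psiZ.
  by rewrite -(map_mpolyX f) -free_mod_mapZ; apply: psiN; exact: submoduleZ.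
split=> [p|c NTc].
  have [D0 /(_ _ (leqnn _)) pD] := boundedP p.
  exists (K D0), (LT D0 p); rewrite {1}(free_modE pD).
  have -> : \sum_j (LT D0 p j)%:MP *: free_mod_map f (e j) =
      \sum_(b : 'I_r * 'X_{1..3 < D0})
        ((p 0 b.1)@_b.2)%:MP *: free_mod_map f (\sum_j (co D0 b j)%:MP *: e j).
    under [RHS]eq_bigr do rewrite free_mod_map_comb scaler_sumr.
    rewrite exchange_big /=; apply: eq_bigr => j _.
    rewrite /LT raddf_sum scaler_suml; apply: eq_bigr => b _.
    by rewrite scalerA; congr (_ *: _); exact: mpolyCM.
  rewrite scaler_sumr -sumrB; apply: submodule_sum => // b _.
  rewrite scalerA mulrC -scalerA -scalerBr; apply: submoduleZ => //.
  have fgK : f g ^+ K D0 = f (g ^+ K D0) by rewrite rmorphXn.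
  have := NTin _ (coP D0 b).
  by rewrite free_mod_mapB free_mod_mapZ map_mpolyC mono_map fgK.
have [D0 h] := NTpsi _ NTc.
have [D1 eD] : exists D1, forall j, forall D, (D1 <= D)%N -> bounded D (e j).
  apply: ex_uniform => [j d d' le h' D /(leq_trans le)|j]; first exact: h'.
  exact: boundedP.
pose D := maxn D0 D1; have [d hd] := h D (leq_maxl _ _).
have [d' hd'] : exists d', forall j, forall i,
    g ^+ d' * (g ^+ K D *+ (i == j) - L D (e j) i) = 0.
  apply: ex_uniform => [j d1 d2 le h' i|j].
    by rewrite -(subnK le) exprD -mulrA h' mulr0.
  apply: indep; have := LP _ _ (eD j D (leq_maxr _ _)).
  congr N; under [RHS]eq_bigr do rewrite mpolyCB scalerBl.
  rewrite sumrB; congr (_ - _).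
  rewrite (bigD1 j) //= eqxx big1 ?addr0 // => i /negPf ->.
  by rewrite mulr0n mpolyC0 scale0r.
exists (d' + d + K D)%N => i; have := congr1 ( *%R (f g ^+ d')) (hd i).
rewrite mulr0 LT_sum mulrA -exprD mulr_sumr => <-.
have -> : f g ^+ (d' + d + K D) * c i =
    \sum_j f g ^+ (d + d' + K D) *+ (i == j) * c j.
  rewrite (bigD1 i) //= eqxx big1 ?addr0 1?[(d' + d)%N]addnC // => j.
  by rewrite eq_sym => /negPf ->; rewrite mulr0n mul0r.
apply: eq_bigr => j _; rewrite LTZ LTf.
have hS : g ^+ (d' + K D) *+ (i == j) = g ^+ d' * L D (e j) i.
  by apply/eqP; rewrite -subr_eq0 -(hd' j i) mulrBr mulrnAr -exprD.
have fX m : f g ^+ m = f (g ^+ m) by rewrite rmorphXn.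
have fM x y : f x * f y = f (x * y) by rewrite rmorphM.
have hij : f g ^+ (d' + K D) *+ (i == j) = f g ^+ d' * f (L D (e j) i).
  by rewrite !fX fM -hS rmorphMn.
rewrite mulrCA [(d' + d)%N]addnC [f g ^+ (d + d')]exprD -[_ * _ * f _]mulrA -hij.
by rewrite mulrnAr -exprD addnA mulrC.
Qed.

Lemma quot_point_base_change N : quot_point N -> quot_point (base_change f N).
Proof.
move=> [Ns [m [a [b [ha hb]]]]]; split; first exact: span_submodule.
exists m, (f \o a), (f \o b); split=> [i|].
  have [e he] := ha i; exists (fun j => free_mod_map f (e j)).
  exact: free_at_base_change.
by rewrite -[RHS](rmorph1 f) -hb rmorph_sum; apply: eq_bigr => i _; rewrite rmorphM.
Qed.

End BaseChange.

Definition Quot : functor k.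
Proof.
exists (fun S => {N : free_mod S -> Prop | quot_point N})
  (fun S T f N => exist _ _ (quot_point_base_change f (svalP N))).
- move=> S [N [Ns lf]]; apply: eq_exist; apply/funext => q; apply/propext.
  have idE p : free_mod_map (idfun : {lrmorphism S -> S}) p = p.
    by apply/matrixP => i j; rewrite mxE; apply/mpolyP => m; rewrite mcoeff_map_mpoly.
  split=> [|Nq]; last by apply: span_sub; exists q.
  by apply: span_min => // _ [p Np ->]; rewrite idE.
- move=> S T V f g [N [Ns lf]]; apply: eq_exist; apply/funext => q; apply/propext.
  have compE p : free_mod_map (g \o f : {lrmorphism S -> V}) p =
      free_mod_map g (free_mod_map f p).
    by apply/matrixP => i j; rewrite !mxE; apply/mpolyP => m; rewrite !mcoeff_map_mpoly.
  split; apply: span_min; try exact: span_submodule.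
    move=> _ [p Np ->]; rewrite compE; apply: span_sub.
    by exists (free_mod_map f p) => //; apply: span_sub; exists p.
  move=> _ [p /= Np ->]; move: Np.
  apply: (@span_min _ _ _ (fun p => base_change (g \o f) N (free_mod_map g p)) p).
    split=> [|a x y hx hy].
      by rewrite /free_mod_map map_mx0; exact: (span_submodule _).1.
    rewrite free_mod_mapD free_mod_mapZ.
    apply: submoduleD => //; [exact: span_submodule | apply: submoduleZ => //].
    exact: span_submodule.
  by move=> _ [q' Nq ->]; apply: span_sub; exists q' => //; rewrite compE.
Defined.

End Quot.

(* Main.v *)
Require Import Defs.
From HB Require Import structures.
From mathcomp Require Import all_boot all_order all_algebra.
From mathcomp Require Import reals complex.
From mathcomp Require Import mpoly ssrcomplements boolp generic_quotient ring_quotient.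
From mathcomp Require classical_sets.
Import Defs.

(* Brackets are the determinants of frames, n x n matrices whose columns are of
   the form w(A,B,C) v_i for words w. Where a bracket s is invertible, a tuple has
   a unique representative in its orbit with frame 1, so that pi is a trivial
   GL_n-torsor over the chart of s. These charts cover the quotient: degenerating
   a tuple by a one-parameter subgroup shows that semi-invariants vanish on the
   tuples that do not generate, so a power of a semi-invariant is a combination of
   brackets, and Cayley's Omega process, as a Reynolds operator for GL_n, makes the
   coefficients semi-invariant. Hence points of the quotient lift locally to U, and
   the lifts are unique up to GL_n.

   A point of the Quot scheme is locally a generating tuple of commuting matrices,
   unique up to GL_n; glueing gives the immersion, whose image consists of the
   points with commuting local lifts, a closed condition. As
   d Tr A[B,C] = Tr(dA [B,C] + dB [C,A] + dC [A,B]) and the trace form is perfect,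
   this is the zero scheme of df. Since a point lifts only over a localization S_g,
   the tangent vectors detecting the entries of the brackets are taken over the
   square-zero extension of S by the S-module S_g; the deformed point is glued
   from deformations of the local lifts. *)

Set Implicit Arguments.
Unset Strict Implicit.
Unset Printing Implicit Defensive.
Import Order.TTheory GRing.Theory Num.Theory.
Local Open Scope ring_scope.

(** * Commutative algebras *)

(** The quotient is known only through its charts, and a chart ring [B] only through invariant
    functions on [U_ s]; that points of the quotient come from [U] is not part of the data.
    Equations in [B] are therefore tested on those points that do come from [U], which the
    uniqueness of the element representing an invariant function permits. Lifting field points is
    what the averaging argument is for; openness of the bracket charts then spreads a lift from a
    residue field to a neighbourhood. Characteristic zero enters twice: the degeneration needs
    infinitely many scalars, and the constant of the Omega process, a positive integer, has to
    survive in every residue field. Two features of the base shape the statements. All algebras are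
    nonzero, so the localization at a nilpotent element does not exist; local hypotheses on [g] are
    thus quantified over all algebras in which [g] becomes invertible. And the algebras are
    arbitrary, so exponents of denominators are made uniform over finite covers. *)

Section Algify.
Variables (k : fieldType) (A : comNzRingType) (phi : {rmorphism k -> A}).
(** The structure map is recorded in the type, so that the action of [k] lives on an alias and
    cannot clash with an algebra structure already on [A], such as that of polynomials over their
    coefficient ring. *)
Definition algify of {rmorphism k -> A} : Type := A.
Local Notation E := (algify phi).
HB.instance Definition _ := GRing.ComNzRing.copy E A.
Definition algify_scale (c : k) (x : E) : E := phi c * x.
Fact algify_scaleA a b x :
  algify_scale a (algify_scale b x) = algify_scale (a * b) x.
Proof. by rewrite /algify_scale rmorphM mulrA. Qed.
Fact algify_scale1 : left_id 1 algify_scale.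
Proof. by move=> x; rewrite /algify_scale rmorph1 mul1r. Qed.
Fact algify_scaleDr : right_distributive algify_scale +%R.
Proof. by move=> c x y; rewrite /algify_scale mulrDr. Qed.
Fact algify_scaleDl x : {morph algify_scale^~ x : a b / a + b}.
Proof. by move=> a b; rewrite /algify_scale rmorphD mulrDl. Qed.
HB.instance Definition _ := GRing.Zmodule_isLmodule.Build k E
  algify_scaleA algify_scale1 algify_scaleDr algify_scaleDl.
Fact algify_scaleAl (c : k) (x y : E) : c *: (x * y) = (c *: x) * y.
Proof. exact: mulrA. Qed.
HB.instance Definition _ := GRing.Lmodule_isLalgebra.Build k E algify_scaleAl.
HB.instance Definition _ := GRing.Lalgebra_isComAlgebra.Build k E.
Lemma algify_scaleE (c : k) (x : E) : c *: x = phi c * x. Proof. by []. Qed.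
End Algify.

Section Toolkit.
Variable k : fieldType.
Implicit Types S T : comAlgType k.

Lemma mk_lrmorphism S T (f : S -> T) : zmod_morphism f -> monoid_morphism f ->
  scalable f -> exists F : {lrmorphism S -> T}, F =1 f.
Proof.
move=> fB fM fZ.
pose b1 := GRing.isZmodMorphism.Build S T f fB.
pose b2 := GRing.isMonoidMorphism.Build S T f fM.
pose b3 := GRing.isScalable.Build k S T *:%R f fZ.
pose F : {lrmorphism S -> T} := HB.pack f b1 b2 b3.
by exists F.
Qed.

(* Stated with both sides in the same coercion, so that they chain with rewriting. *)
Section LRMorphism.
Variables (S T : comAlgType k) (f : {lrmorphism S -> T}).
Lemma lr0 : f 0 = 0. Proof. exact: rmorph0. Qed.
Lemma lr1 : f 1 = 1. Proof. exact: rmorph1. Qed.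
Lemma lrD x y : f (x + y) = f x + f y. Proof. exact: rmorphD. Qed.
Lemma lrB x y : f (x - y) = f x - f y. Proof. exact: rmorphB. Qed.
Lemma lrM x y : f (x * y) = f x * f y. Proof. exact: rmorphM. Qed.
Lemma lrX x d : f (x ^+ d) = f x ^+ d. Proof. exact: rmorphXn. Qed.
Lemma lr_sum (I : Type) (s : seq I) (P : pred I) (F : I -> S) :
  f (\sum_(i <- s | P i) F i) = \sum_(i <- s | P i) f (F i).
Proof. exact: rmorph_sum. Qed.
Lemma lrA (c : k) : f c%:A = c%:A.
Proof. by rewrite linearZ /= rmorph1. Qed.
End LRMorphism.

Lemma is_unit1 S : is_unit (1 : S). Proof. by exists 1; rewrite mulr1. Qed.
Lemma is_unitM S (a b : S) : is_unit a -> is_unit b -> is_unit (a * b).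
Proof. by move=> [x ax] [y b_y]; exists (x * y); rewrite mulrACA ax b_y mulr1. Qed.
Lemma is_unitX S (a : S) n : is_unit a -> is_unit (a ^+ n).
Proof. by move=> [x ax]; exists (x ^+ n); rewrite -exprMn ax expr1n. Qed.
Lemma is_unitMl S (a b : S) : is_unit (a * b) -> is_unit a.
Proof. by move=> [x ax]; exists (b * x); rewrite mulrA. Qed.
Lemma is_unitMr S (a b : S) : is_unit (a * b) -> is_unit b.
Proof. by rewrite mulrC; exact: is_unitMl. Qed.
Lemma is_unit_map S T (f : {lrmorphism S -> T}) (a : S) : is_unit a -> is_unit (f a).
Proof. by move=> [x ax]; exists (f x); rewrite -lrM ax lr1. Qed.
Lemma is_unit0 S : ~ is_unit (0 : S).
Proof. by move=> [x]; rewrite mul0r => /eqP; rewrite eq_sym oner_eq0. Qed.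
Lemma unitI S (a x y : S) : is_unit a -> a * x = a * y -> x = y.
Proof.
by move=> [b ab] e; rewrite -[x]mul1r -[y]mul1r -ab mulrAC e mulrAC.
Qed.
Lemma unitX0 S (a x : S) d : is_unit a -> a ^+ d * x = 0 -> x = 0.
Proof. by move=> ua e; apply: (@unitI _ (a ^+ d)); rewrite ?mulr0 //; exact: is_unitX. Qed.

(** A [comAlgType] has no inverse operation, so the inverse is chosen classically. The value 0 off
    the units is the convention of [fieldType], used in [field_ind]. *)
Definition uinv S (a : S) : S :=
  if pselect (is_unit a) is left ua then sval (cid ua) else 0.
Lemma mulr_uinv S (a : S) : is_unit a -> a * uinv a = 1.
Proof. by rewrite /uinv; case: pselect => // ua _; case: (cid ua). Qed.
Lemma uinv_eq S (a b : S) : a * b = 1 -> uinv a = b.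
Proof.
move=> ab; have ua : is_unit a by exists b.
by apply: (unitI ua); rewrite mulr_uinv.
Qed.
Lemma uinv_map S T (f : {lrmorphism S -> T}) (a : S) : is_unit a -> f (uinv a) = uinv (f a).
Proof.
by move=> ua; apply/esym/uinv_eq; rewrite -lrM mulr_uinv // lr1.
Qed.

Definition ideal S (J : S -> Prop) := @submodule S (S : comAlgType k)^o J.
Definition idealspan S (G : S -> Prop) : S -> Prop := @Defs.span S (S : comAlgType k)^o G.

Lemma idealspan_ideal S (G : S -> Prop) : ideal (idealspan G).
Proof. exact: span_submodule. Qed.
Lemma ideal0 S (J : S -> Prop) : ideal J -> J 0. Proof. by case. Qed.
Lemma idealD S (J : S -> Prop) x y : ideal J -> J x -> J y -> J (x + y).
Proof. exact: (@submoduleD S S^o). Qed.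
Lemma idealM S (J : S -> Prop) a x : ideal J -> J x -> J (a * x).
Proof. exact: (@submoduleZ S S^o). Qed.
Lemma idealMr S (J : S -> Prop) a x : ideal J -> J x -> J (x * a).
Proof. by rewrite mulrC; exact: idealM. Qed.
Lemma ideal_sum S (J : S -> Prop) (I : Type) (s : seq I) (P : pred I) (F : I -> S) :
  ideal J -> (forall i, P i -> J (F i)) -> J (\sum_(i <- s | P i) F i).
Proof. exact: (@submodule_sum S S^o). Qed.
Lemma idealspan_sub S (G : S -> Prop) x : G x -> idealspan G x.
Proof. exact: (@span_sub S S^o). Qed.
Lemma idealspan_min S (G J : S -> Prop) x :
  ideal J -> (forall y, G y -> J y) -> idealspan G x -> J x.
Proof. exact: (@span_min S S^o). Qed.
Lemma mkideal S (J : S -> Prop) : J 0 -> (forall x y, J x -> J y -> J (x + y)) ->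
  (forall a x, J x -> J (a * x)) -> ideal J.
Proof. by move=> J0 JD JM; split=> // a x y Jx Jy; apply: JD => //; exact: JM. Qed.

Lemma unit_idealP S (G : S -> Prop) : unit_ideal G <-> idealspan G 1.
Proof.
split=> [[m [a [b [Ga e]]]]|[m [b [a [Ga e]]]]].
  by exists m, b, a; split=> //; rewrite -e.
by exists m, a, b; split=> //; rewrite e.
Qed.

Lemma unit_ideal_min S (G J : S -> Prop) : ideal J -> (forall y, G y -> J y) ->
  unit_ideal G -> J 1.
Proof. by move=> iJ GJ /unit_idealP; exact: idealspan_min. Qed.

Lemma unit_ideal_map S T (f : {lrmorphism S -> T}) (G : S -> Prop) (H : T -> Prop) :
  (forall x, G x -> H (f x)) -> unit_ideal G -> unit_ideal H.
Proof.
move=> GH [m [a [b [Ga e]]]]; exists m, (f \o a), (f \o b); split=> [i|].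
  by apply: GH.
by rewrite -(lr1 f) -e lr_sum; apply: eq_bigr => i _; rewrite lrM.
Qed.

Lemma ker_ideal S T (f : {lrmorphism S -> T}) : ideal (fun x => f x = 0).
Proof.
apply: mkideal => [|x y /= fx fy|a x /= fx]; first exact: lr0.
  by rewrite lrD fx fy addr0.
by rewrite lrM fx mulr0.
Qed.

(** The radical of [J] is closed under sums: each term of the binomial expansion of $(x+y)^{d+e}$
    contains $x^d$ or $y^e$. Hence it contains 1 as soon as it contains generators of the unit
    ideal. *)
Lemma unit_ideal_pow S (G J : S -> Prop) : ideal J ->
  (forall g, G g -> exists e, J (g ^+ e)) -> unit_ideal G -> J 1.
Proof.
move=> iJ GJ /unit_idealP [m [b [a [Ga e1]]]].
suff rad x y : (exists e, J (x ^+ e)) -> (exists e, J (y ^+ e)) ->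
    exists e, J ((x + y) ^+ e).
  have [e] : exists e, J (1 ^+ e).
    rewrite e1; apply: (big_ind (fun x => exists e, J (x ^+ e))).
    - by exists 1%N; rewrite expr1; exact: ideal0.
    - by move=> x y; exact: rad.
    - move=> i _; have [e He] := GJ _ (Ga i); exists e.
      by rewrite /GRing.scale /= exprMn; exact: idealM.
  by rewrite expr1n.
move=> [d Jx] [e Jy]; exists (d + e)%N; rewrite exprDn.
apply: ideal_sum => // i _; rewrite -mulr_natl; apply: idealM => //.
case: (leqP e i) => le.
  by apply: idealM => //; rewrite -(subnK le) exprD; exact: idealM.
apply: idealMr => //; have ld : (d <= d + e - i)%N by rewrite -addnBA ?leq_addr // ltnW.
by rewrite -(subnK ld) exprD; exact: idealM.
Qed.

End Toolkit.

Local Open Scope quotient_scope.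

(** * Quotients by ideals and polynomial algebras *)

Section Quotient.
Variables (k : fieldType) (S : comAlgType k) (J : S -> Prop).

(** The two proofs are arguments so that the ideal structure can be attached to this head symbol and
    found by inference. *)
Definition ideal_mem of ideal J & ~ J 1 : S -> bool := fun x => `[< J x >].

Variables (iJ : ideal J) (J1 : ~ J 1).
Local Notation Jmem :=  (ideal_mem iJ J1).

Fact ideal_mem_closed : idealr_closed Jmem.
Proof.
have JmemE x : (x \in Jmem) = `[< J x >] by [].
split; rewrite ?JmemE; [by apply/asboolP; exact: ideal0 iJ | exact/asboolP |].
move=> a u v; rewrite !JmemE => /asboolP Ju /asboolP Jv; apply/asboolP.
by apply: idealD => //; exact: idealM.
Qed.
HB.instance Definition _ := isIdealr.Build S Jmem ideal_mem_closed.

Local Notation I := [the idealr S of Jmem].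
Definition quo_alg : k -> {ideal_quot I} := \pi_{ideal_quot I} \o in_alg S.
HB.instance Definition _ := GRing.RMorphism.on quo_alg.

Lemma quotient_algebra : exists (T : comAlgType k) (p : {lrmorphism S -> T}),
  (forall y, exists x, y = p x) /\ (forall x, p x = 0 <-> J x).
Proof.
pose T : comAlgType k := algify quo_alg.
pose q (x : S) : T := \pi_{ideal_quot I} x.
have [|||p pE] := @mk_lrmorphism k S T q.
- exact: (rmorphB (\pi_{ideal_quot I})).
- split; first exact: (rmorph1 (\pi_{ideal_quot I})).
  exact: (rmorphM (\pi_{ideal_quot I})).
- move=> c x; rewrite algify_scaleE.
  by rewrite -[c *: x]mulr_algl; exact: (rmorphM (\pi_{ideal_quot I})).
exists T, p; split=> [y|x]; first by exists (repr y); rewrite pE /q reprK.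
have -> : (p x = 0) = (x == 0 %[mod {ideal_quot I}]) :> Prop.
  by rewrite pE; apply/propext; split=> [e|/eqP e]; [apply/eqP; rewrite [LHS]e|rewrite [LHS]e]; rewrite /GRing.zero /= ?raddf0 //; exact: (rmorph0 (\pi_{ideal_quot I})).
by rewrite -Quotient.idealrBE subr0; split => [/asboolP|Jx]; [|exact/asboolP].
Qed.
End Quotient.

Section PolyAlgebra.
Variables (k : fieldType) (S : comAlgType k).
Definition poly_alg : k -> {poly S} := @polyC S \o in_alg S.
HB.instance Definition _ := GRing.RMorphism.on poly_alg.
Definition polyalg : comAlgType k := algify poly_alg.

Lemma polyalg_const : exists c : {lrmorphism S -> polyalg}, c =1 @polyC S.
Proof.
apply: mk_lrmorphism; first exact: (rmorphB (@polyC S)).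
  by split; [exact: (rmorph1 (@polyC S)) | exact: (rmorphM (@polyC S))].
move=> c x; rewrite algify_scaleE -mulr_algl.
exact: (rmorphM (@polyC S)).
Qed.

Lemma polyalg_eval (T : comAlgType k) (f : {lrmorphism S -> T}) (t : T) :
  exists e : {lrmorphism polyalg -> T}, e =1 (fun p => (map_poly f p).[t]).
Proof.
pose h := horner_eval t \o map_poly f.
apply: mk_lrmorphism.
- exact: (rmorphB h).
- by split; [exact: (rmorph1 h) | exact: (rmorphM h)].
- move=> c x; rewrite algify_scaleE.
  apply: (etrans (rmorphM h (poly_alg c) x)).
  rewrite -[c *: _]mulr_algl; congr (_ * _).
  by rewrite /h /poly_alg /= map_polyC /= /horner_eval hornerC lrA.
Qed.
End PolyAlgebra.

(** * Localization, and equations tested where an element is invertible *)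

Section Localization.
Variable k : fieldType.
Implicit Types S T : comAlgType k.

(* The localization at g of S/J is S[t]/Z, where Z consists of the polynomials p
   such that g^N p(1/g) lies in J for large N. *)
Lemma localization_mod S (J : S -> Prop) (g : S) : ideal J -> (forall e, ~ J (g ^+ e)) ->
  exists (T : comAlgType k) (l : {lrmorphism S -> T}),
  [/\ is_unit (l g), forall y, exists a d, y * l g ^+ d = l a &
      forall a, l a = 0 <-> exists d, J (g ^+ d * a)].
Proof.
move=> iJ Jg.
(* Truncation at degree [N] keeps this additive in [p] for every [N]; it equals $g^N p(1/g)$ once
   [N] bounds the degree. *)
pose ev N (p : {poly S}) := \sum_(i < N.+1) p`_i * g ^+ (N - i).
pose Z (p : polyalg S) := exists N0, forall N, (N0 <= N)%N -> J (ev N p).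
have evC N c : ev N c%:P = c * g ^+ N.
  rewrite /ev big_ord_recl /= subn0 coefC eqxx big1 ?addr0 // => i _.
  by rewrite coefC /= mul0r.
have evD N p q : ev N (p + q) = ev N p + ev N q.
  by rewrite -big_split; apply: eq_bigr => i _; rewrite coefD mulrDl.
have evZ N c p : ev N (c%:P * p) = c * ev N p.
  by rewrite mulr_sumr; apply: eq_bigr => i _; rewrite coefCM mulrA.
have evX N p : ev N.+1 (p * 'X) = ev N p.
  rewrite /ev big_ord_recl /= coefMX mul0r add0r; apply: eq_bigr => i _.
  by rewrite coefMX /= subSS.
have evext (p : {poly S}) N M : (size p <= N.+1)%N -> (N <= M)%N -> ev M p = ev N p * g ^+ (M - N).
  move=> pN NM; rewrite /ev -(subnKC NM) -addSn big_split_ord /= addKn.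
  rewrite [X in _ + X]big1 ?addr0 => [|i _].
    rewrite mulr_suml; apply: eq_bigr => i _; rewrite -mulrA -exprD.
    by rewrite addnBAC // -ltnS.
  by rewrite nth_default ?mul0r // (leq_trans pN) // leq_addr.
have iZ : ideal Z.
  apply: mkideal => [|x y [N0 hx] [N1 hy]|a x [N0 hx]].
  - exists 0%N => N _; rewrite /ev big1 => [|i _]; first exact: ideal0.
    by rewrite coef0 mul0r.
  - exists (maxn N0 N1) => N; rewrite geq_max => /andP[/hx {}hx /hy {}hy].
    by rewrite evD; exact: idealD.
  - elim/poly_ind: a => [|p c [N1 IH]].
      exists 0%N => N _; rewrite mul0r /ev big1 => [|i _]; first exact: ideal0.
      by rewrite coef0 mul0r.
    exists (maxn N1.+1 N0) => -[|N]; rewrite geq_max // ltnS => /andP[le0 le1].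
    rewrite mulrDl evD evZ mulrAC evX; apply: idealD => //; first exact: IH.
    by apply: idealM => //; exact: hx.
have Z1 : ~ Z 1.
  by move=> [N /(_ N (leqnn N))]; rewrite (evC N 1) mul1r; exact: Jg.
have [T [p [psurj pker]]] := quotient_algebra iZ Z1.
have [c cE] := polyalg_const S.
have pX : (p \o c) g * p 'X = 1.
  apply/eqP; rewrite -subr_eq0 /= -lrM -(lr1 p) -lrB; apply/eqP/pker.
  exists 1%N => -[//|N] _; rewrite cE.
  have -> : (g%:P * 'X - 1 : {poly S}) = g%:P * 'X + (-1)%:P by rewrite polyCN.
  rewrite evD evX !evC -exprS mulN1r subrr; exact: ideal0.
exists T, (p \o c); split=> [|y|a].
- by exists (p 'X).
- have [q ->] := psurj y; exists (ev (size q) q), (size q).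
  rewrite /= -lrX -lrM -lrX; apply/eqP; rewrite -subr_eq0 -lrB; apply/eqP/pker.
  exists (size q) => N le; rewrite !cE -polyCN mulrC evD evZ evC.
  rewrite (evext _ (size q)) // mulNr mulrCA.
  rewrite -exprD subnKC // subrr; exact: ideal0.
- rewrite /= cE; split=> [/pker [N /(_ N (leqnn N))]|[d Jd]].
    by rewrite evC mulrC; exists N.
  apply/pker; exists d => N le; rewrite evC -(subnK le) exprD mulrCA.
  by rewrite [a * _]mulrC; exact: idealM.
Qed.

Lemma zero_ideal S : ideal (fun x : S => x = 0).
Proof. by apply: mkideal => // [x y -> ->|a x ->]; rewrite ?addr0 ?mulr0. Qed.

Lemma localization_exists S (g : S) : (forall e, g ^+ e <> 0) ->
  exists (T : comAlgType k) (l : {lrmorphism S -> T}), is_localization g l.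
Proof.
move=> gn; have [T [l [h1 h2 h3]]] := localization_mod (zero_ideal S) gn.
by exists T, l; split=> // a /h3.
Qed.

(** The test algebra is $(S/(G))_g$. If it is zero, a power of [g] already lies in the ideal. This
    turns vanishing at points into membership up to powers of [g]. *)
Lemma mem_radical S (G : S -> Prop) (g a : S) :
  (forall T (f : {lrmorphism S -> T}), is_unit (f g) -> (forall x, G x -> f x = 0) ->
     f a = 0) ->
  exists e, idealspan G (g ^+ e * a).
Proof.
move=> h; have [e|gJ] := pselect (exists e, idealspan G (g ^+ e)).
  case: e => e Ge; exists e; apply: idealMr Ge; exact: idealspan_ideal.
have [|T [l [ul _ lker]]] := @localization_mod S (idealspan G) g (idealspan_ideal _).
  by move=> e Ge; apply: gJ; exists e.
apply/lker/h => // x Gx; apply/lker; exists 0%N.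
by rewrite mul1r; exact: idealspan_sub.
Qed.

Lemma eq0_at S (g a : S) :
  (forall T (f : {lrmorphism S -> T}), is_unit (f g) -> f a = 0) ->
  exists e, g ^+ e * a = 0.
Proof.
move=> h; have [T f ug _|e He] := @mem_radical S (fun _ => False) g a; first exact: h.
by exists e; apply: (idealspan_min (zero_ideal S)) He.
Qed.

(** Each [g] has a power annihilating [a - b], and the annihilator is an ideal. For nilpotent [g]
    the hypothesis is vacuous, so no case distinction is needed when the lemma is applied. *)
Lemma eq_local S (G : S -> Prop) (a b : S) : unit_ideal G ->
  (forall g, G g -> forall T (f : {lrmorphism S -> T}), is_unit (f g) -> f a = f b) ->
  a = b.
Proof.
move=> G1 h; apply/eqP; rewrite -subr_eq0 -[_ - _]mul1r; apply/eqP.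
apply: (@unit_ideal_pow _ _ G (fun x => x * (a - b) = 0)) => //.
  apply: mkideal => [|x y hx hy|c x hx]; first exact: mul0r.
    by rewrite mulrDl hx hy addr0.
  by rewrite -mulrA hx mulr0.
move=> g Gg; apply: eq0_at => T f ug.
by rewrite lrB (h _ Gg _ _ ug) subrr.
Qed.

(** [is_localization] describes [T] by fractions; the universal property follows by choosing a
    numerator and an exponent for every element, the value being independent of that choice
    ([FP]). *)
Lemma localization_factor S T (R : comAlgType k) (g : S) (l : {lrmorphism S -> T}) (f : {lrmorphism S -> R}) :
  is_localization g l -> is_unit (f g) ->
  exists F : {lrmorphism T -> R}, F \o l =1 f.
Proof.
move=> [ul lsurj lker] uf.
have /choice [n nP] : forall y, exists n : S * nat, y * l g ^+ n.2 = l n.1.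
  by move=> y; have [a [d e]] := lsurj y; exists (a, d).
pose F y := f (n y).1 * uinv (f g) ^+ (n y).2.
have FP y a d : y * l g ^+ d = l a -> F y = f a * uinv (f g) ^+ d.
  move=> e; have : l ((n y).1 * g ^+ d - a * g ^+ (n y).2) = 0.
    by rewrite lrB !lrM !lrX -nP -e mulrAC subrr.
  move=> /lker [c Hc].
  have {Hc} Hc : f (n y).1 * f g ^+ d = f a * f g ^+ (n y).2.
    apply/eqP; rewrite -subr_eq0; apply/eqP.
    by rewrite -!lrX -!lrM -lrB; apply: (unitX0 (d := c) uf); rewrite -lrX -lrM Hc lr0.
  have vu c' x : x * f g ^+ c' * uinv (f g) ^+ c' = x.
    by rewrite -mulrA -exprMn mulr_uinv // expr1n mulr1.
  by rewrite /F -(vu d (f (n y).1)) Hc mulrAC vu.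
have [|||F' FE] := @mk_lrmorphism _ T R F.
- move=> x y; have [a [d ea]] := lsurj x; have [b [c eb]] := lsurj y.
  rewrite (@FP (x - y) (a * g ^+ c - b * g ^+ d) (d + c)%N).
    rewrite (FP _ _ _ ea) (FP _ _ _ eb) lrB !lrM !lrX mulrBl.
    have U m : f g ^+ m * uinv (f g) ^+ m = 1 by rewrite -exprMn mulr_uinv // expr1n.
    rewrite exprD; congr (_ - _); first by rewrite mulrACA U mulr1.
    by rewrite [X in _ * X]mulrC mulrACA U mulr1.
  by rewrite lrB !lrM !lrX -ea -eb mulrBl exprD mulrA; congr (_ - _); rewrite mulrAC -mulrA.
- split=> [|x y].
    by rewrite (@FP 1 1 0%N) ?lr1 ?mulr1.
  have [a [d ea]] := lsurj x; have [b [c eb]] := lsurj y.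
  rewrite (FP _ _ _ ea) (FP _ _ _ eb) (@FP (x * y) (a * b) (d + c)%N).
    by rewrite lrM exprD mulrACA.
  by rewrite lrM -ea -eb exprD mulrACA.
- move=> c x; have [a [d ea]] := lsurj x.
  rewrite (FP _ _ _ ea) (@FP (c *: x) (c *: a) d).
    by rewrite linearZ /= scalerAl.
  by rewrite -scalerAl ea linearZ.
exists F' => x /=; rewrite FE (@FP _ x 0%N) ?mulr1 //.
Qed.

End Localization.

(** * Residue fields and Zariski sheaves *)

Section Residue.
Variable k : fieldType.
Implicit Types S T : comAlgType k.

Lemma residue_field S (G : S -> Prop) : ~ unit_ideal G ->
  exists (L : comAlgType k) (f : {lrmorphism S -> L}),
    is_field L /\ forall x, G x -> f x = 0.
Proof.
move=> /unit_idealP G1.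
pose good (I : S -> Prop) := [/\ ideal I, forall x, G x -> I x & ~ I 1].
(* The empty chain has the empty set as its union, so [P] must admit it. It is not maximal, being
   strictly contained in the ideal spanned by [G]. *)
pose P (I : S -> Prop) := (forall x, ~ I x) \/ good I.
have [F FP Ftot|A [PA Amax]] := @classical_sets.Zorn_bigcup S P.
  set B := classical_sets.bigcup _ _.
  have [|/existsNP [x /contrapT Bx]] := pselect (forall x, ~ B x); first by left.
  have gd I y : F I -> I y -> good I.
    by move=> FI Iy; have [/(_ y)|] := FP _ FI.
  right; split.
  - apply: mkideal => [|u v [I FI Iu] [I' FI' Iv]|c u [I FI Iu]].
    + case: Bx => I FI Ix; exists I => //.
      by have [iI _ _] := gd _ _ FI Ix; exact: ideal0.
    + have [iI _ _] := gd _ _ FI Iu; have [iI' _ _] := gd _ _ FI' Iv.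
      have [le|le] := Ftot _ _ FI FI'.
        by exists I' => //; apply: idealD => //; exact: le.
      by exists I => //; apply: idealD => //; exact: le.
    + by have [iI _ _] := gd _ _ FI Iu; exists I => //; exact: idealM.
  - move=> y Gy; case: Bx => I FI Ix; exists I => //.
    by have [_ GI _] := gd _ _ FI Ix; exact: GI.
  - by move=> [I FI I1]; have [_ _] := gd _ _ FI I1; apply.
have lt_good B : (forall x, A x -> B x) -> (exists2 x, B x & ~ A x) -> ~ good B.
  move=> AB [x Bx Ax] gB; apply: (Amax B); last by right.
  by split => // /(_ x Bx).
have {PA} [A0|[iA GA A1]] := PA.
  case: (lt_good (idealspan G)).
  - by move=> x /A0.
  - by exists 0 => [|/A0 //]; exact: ideal0 (idealspan_ideal _).
  - by split=> //; [exact: idealspan_ideal | exact: idealspan_sub].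
have [L [p [psurj pker]]] := quotient_algebra iA A1.
exists L, p; split=> [y y0|x Gx]; last exact/pker/GA.
have [x ex] := psurj y; subst y.
(* The ideal generated by [A] and [x]; by maximality it contains 1, which yields an inverse of [x]
   modulo [A]. *)
pose B a := exists c, A (a - c * x).
have AB a : A a -> B a by move=> Aa; exists 0; rewrite mul0r subr0.
have [] := pselect (B 1) => [[c /pker]|B1].
  rewrite lrB lrM lr1 => /eqP; rewrite subr_eq0 => /eqP e.
  by exists (p c); rewrite mulrC.
case: (lt_good B AB).
  exists x => [|/pker //]; exists 1; rewrite mul1r subrr; exact: ideal0.
split=> // [|a /GA/AB //].
apply: mkideal => [|a b [c ac] [d bd]|d a [c ac]].
- by apply: AB; exact: ideal0.
- by exists (c + d); rewrite mulrDl opprD addrACA; exact: idealD.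
- by exists (d * c); rewrite -mulrA -mulrBr; exact: idealM.
Qed.

(** Nilpotent generators, at which one cannot localize, are replaced by a generator that is not
    nilpotent. Suitable powers of the old generators lie in the new ideal, since the powers of the
    nilpotent ones can be taken to be 0. *)
Lemma unit_ideal_nonnil S (G : S -> Prop) : unit_ideal G ->
  exists m (a : 'I_m -> S), [/\ forall i, G (a i), forall i e, a i ^+ e <> 0 &
    unit_ideal (fun x => exists i, x = a i)].
Proof.
move=> [m [a [b [Ga e1]]]].
pose nil (x : S) := exists e, x ^+ e = 0.
have [i0 ni0] : exists i0, ~ nil (a i0).
  apply: contrapT => /forallNP h.
  suff /eqP : (1 : S) = 0 by rewrite oner_eq0.
  apply: (@unit_ideal_pow _ S (fun x => exists i, x = a i) _ (@zero_ideal _ S)).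
    by move=> _ [i ->]; have /contrapT := h i.
  by exists m, a, b; split=> // i; exists i.
pose a' i := if pselect (nil (a i)) then a i0 else a i.
have a'n i e : a' i ^+ e <> 0.
  by rewrite /a'; case: pselect => ni ae; [apply: ni0 | case: (ni)]; exists e.
exists m, a'; split=> //; first by move=> i; rewrite /a'; case: pselect => ?; exact: Ga.
apply/unit_idealP; apply: (@unit_ideal_pow _ _ (fun x => exists i, x = a i)).
- exact: idealspan_ideal.
- move=> _ [i ->]; case: (pselect (nil (a i))) => [[e ae]|ni].
    by exists e; rewrite ae; exact: ideal0 (idealspan_ideal _).
  exists 1%N; rewrite expr1; apply: idealspan_sub; exists i.
  by rewrite /a'; case: pselect.
- by exists m, a, b; split=> // i; exists i.
Qed.

End Residue.

(** * Separation and glueing for Zariski sheaves *)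

Section Sheaf.
Variables (k : fieldType) (X : functor k) (Xsh : zariski_sheaf X).
Implicit Types S T V : comAlgType k.

Lemma pmap_compE S T V (f : {lrmorphism S -> T}) (g : {lrmorphism T -> V})
    (h : {lrmorphism S -> V}) (x : X S) :
  g \o f =1 h -> pmap X g (pmap X f x) = pmap X h x.
Proof.
by move=> e; rewrite -pmap_comp; congr (pmap X _ x); exact: lrmorphism_ext.
Qed.

Lemma affine_cover S (G : S -> Prop) : unit_ideal G ->
  exists m (a : 'I_m -> S) (S_ : 'I_m -> comAlgType k)
    (l : forall i, {lrmorphism S -> S_ i}),
  [/\ forall i, G (a i), unit_ideal (fun x => exists i, x = a i) &
      forall i, is_localization (a i) (l i)].
Proof.
move=> /unit_ideal_nonnil [m [a [Ga an a1]]].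
have /choice [Tl TlP] : forall i, exists Tl : {T : comAlgType k & {lrmorphism S -> T}},
    is_localization (a i) (tagged Tl).
  move=> i; have [T [l loc]] := localization_exists (an i).
  by exists (Tagged (fun T : comAlgType k => {lrmorphism S -> T}) l).
by exists m, a, (fun i => tag (Tl i)), (fun i => tagged (Tl i)).
Qed.

Lemma sheaf_sep S (G : S -> Prop) (x y : X S) : unit_ideal G ->
  (forall g, G g -> forall T (f : {lrmorphism S -> T}), is_unit (f g) ->
     pmap X f x = pmap X f y) -> x = y.
Proof.
move=> /affine_cover [m [a [S_ [l [Ga a1 loc]]]]] h.
have [z [_ zu]] : exists! z, forall i, pmap X (l i) z = pmap X (l i) x.
  apply: Xsh a1 loc _ _ => i j T f g e.
  by rewrite (pmap_compE _ e) pmap_comp.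
rewrite -[x](zu x) //; apply: zu => i; apply/esym; apply: h (Ga i) _ _ _.
by case: (loc i).
Qed.

(** Glueing data are given as a relation between algebras over [S] and their points. If it is
    single-valued and stable under base change, the local choices agree on overlaps automatically,
    and the glued point is controlled over every [T], not just over the cover. *)
Lemma sheaf_glue S (Rel : forall T, {lrmorphism S -> T} -> X T -> Prop) :
  (forall T V (f : {lrmorphism S -> T}) (g : {lrmorphism T -> V}) x, Rel T f x ->
     Rel V (g \o f) (pmap X g x)) ->
  (forall T (f : {lrmorphism S -> T}) x y, Rel T f x -> Rel T f y -> x = y) ->
  unit_ideal (fun g => forall T (f : {lrmorphism S -> T}), is_unit (f g) ->
     exists x, Rel T f x) ->
  exists y : X S, forall T (f : {lrmorphism S -> T}) x, Rel T f x -> pmap X f y = x.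
Proof.
move=> st fn G1; have [m [a [S_ [l [Ga a1 loc]]]]] := affine_cover G1.
have [x xP] : exists x : forall i, X (S_ i), forall i, Rel _ (l i) (x i).
  have ex i : exists x, Rel _ (l i) x by apply: (Ga i); case: (loc i).
  by exists (fun i => sval (cid (ex i))) => i; case: (cid (ex i)).
have [y [yP _]] : exists! y : X S, forall i, pmap X (l i) y = x i.
  apply: Xsh a1 loc _ _ => i j T f g e.
  apply: (fn T (f \o l i)); first exact: st.
  have -> : (f \o l i : {lrmorphism S -> T}) = g \o l j by exact: lrmorphism_ext.
  exact: st.
exists y => T f z Rz.
apply: (@sheaf_sep T (fun b => exists i, b = f (a i))).
  by apply: (unit_ideal_map (f := f)) a1 => _ [i ->]; exists i.
move=> _ [i ->] V h uh.
have [F FE] := localization_factor (f := h \o f) (loc i) uh.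
rewrite -pmap_comp -(pmap_compE _ FE) yP; apply: (fn V (h \o f)); last exact: st.
rewrite -(lrmorphism_ext FE); exact: st.
Qed.

End Sheaf.

(** * Words and frames *)

Section Words.
Variables (k : fieldType) (n r : nat).
Implicit Types S T L : comAlgType k.
Local Notation W := (W k n r).
Local Notation U := (U k n r).
Local Notation word := (seq 'I_3 * 'I_r)%type.
Implicit Types (X : 'I_n -> word).

Definition mat S (w : W S) (c : 'I_3) : 'M[S]_n :=
  match val c with 0 => matA w | 1 => matB w | _ => matC w end.

Definition word_mx S (w : W S) (l : seq 'I_3) : 'M[S]_n :=
  foldr (fun c M => mat w c *m M) 1%:M l.

Definition word_vec S (w : W S) (x : word) : 'cV[S]_n :=
  word_mx w x.1 *m col x.2 (vecs w).

Definition frame X S (w : W S) : 'M[S]_n := \matrix_(i, j) word_vec w (X j) i 0.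

Lemma frameE X S (w : W S) i j : frame X w i j = word_vec w (X j) i 0.
Proof. by rewrite mxE. Qed.

Definition bracket X S (w : W S) : S := \det (frame X w).

Lemma mat_map S T (f : {lrmorphism S -> T}) (w : W S) c :
  mat (pmap W f w) c = map_mx f (mat w c).
Proof. by rewrite /mat; case: c => -[|[|c]]. Qed.

Lemma word_mx_map S T (f : {lrmorphism S -> T}) (w : W S) l :
  word_mx (pmap W f w) l = map_mx f (word_mx w l).
Proof.
elim: l => [|c l IH]; first by rewrite /= map_mx1.
by rewrite /= IH mat_map map_mxM.
Qed.

Lemma word_vec_map S T (f : {lrmorphism S -> T}) (w : W S) x :
  word_vec (pmap W f w) x = map_mx f (word_vec w x).
Proof. by rewrite /word_vec word_mx_map map_mxM map_col. Qed.

Lemma frame_map X S T (f : {lrmorphism S -> T}) (w : W S) :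
  frame X (pmap W f w) = map_mx f (frame X w).
Proof. by apply/matrixP => i j; rewrite [RHS]mxE !frameE word_vec_map mxE. Qed.

Lemma bracket_map X S T (f : {lrmorphism S -> T}) (w : W S) :
  bracket X (pmap W f w) = f (bracket X w).
Proof. by rewrite /bracket frame_map det_map_mx. Qed.

Lemma mat_act S (g h : 'M[S]_n) (w : W S) c : mat (act g h w) c = g *m mat w c *m h.
Proof. by rewrite /mat; case: c => -[|[|c]]. Qed.

Lemma word_mx_act S (g h : 'M[S]_n) (w : W S) l : g *m h = 1%:M ->
  word_mx (act g h w) l = g *m word_mx w l *m h.
Proof.
move=> gh; elim: l => [|c l IH]; first by rewrite /= mulmx1 gh.
by rewrite /= IH mat_act !mulmxA -[_ *m h *m g]mulmxA (mulmx1C gh) mulmx1.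
Qed.

Lemma word_vec_act S (g h : 'M[S]_n) (w : W S) x : g *m h = 1%:M ->
  word_vec (act g h w) x = g *m word_vec w x.
Proof.
move=> gh; rewrite /word_vec word_mx_act //= !colE !mulmxA.
by rewrite -[_ *m h *m g]mulmxA (mulmx1C gh) mulmx1.
Qed.

Lemma frame_act X S (g h : 'M[S]_n) (w : W S) : g *m h = 1%:M ->
  frame X (act g h w) = g *m frame X w.
Proof.
move=> gh; apply/matrixP => i j; rewrite frameE word_vec_act // mxE [RHS]mxE.
by apply: eq_bigr => l _; rewrite frameE.
Qed.

Lemma bracket_act X S (g h : 'M[S]_n) (w : W S) : g *m h = 1%:M ->
  bracket X (act g h w) = \det g * bracket X w.
Proof. by move=> gh; rewrite /bracket frame_act // det_mulmx. Qed.

Lemma actK S (g h : 'M[S]_n) (w : W S) : g *m h = 1%:M -> act h g (act g h w) = w.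
Proof.
move=> /mulmx1C hg; case: w => A B C v; rewrite /act /= !mulmxA hg !mul1mx.
by rewrite -!mulmxA hg !mulmx1.
Qed.

Lemma act_comp S (g h g' h' : 'M[S]_n) (w : W S) :
  act g' h' (act g h w) = act (g' *m g) (h *m h') w.
Proof. by rewrite /act /= !mulmxA. Qed.

Lemma act_map S T (f : {lrmorphism S -> T}) (g h : 'M[S]_n) (w : W S) :
  pmap W f (act g h w) = act (map_mx f g) (map_mx f h) (pmap W f w).
Proof. by rewrite /act /= !map_mxM. Qed.

Lemma detg_unit S (g h : 'M[S]_n) : g *m h = 1%:M -> is_unit (\det g).
Proof. by move=> gh; exists (\det h); rewrite -det_mulmx gh det1. Qed.

Lemma mulmx_col S m (M : 'M[S]_(m, n)) (u : 'cV[S]_n) :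
  M *m u = \sum_j u j 0 *: col j M.
Proof.
apply/matrixP => i z; rewrite mxE summxE; apply: eq_bigr => j _.
by rewrite !mxE mulrC ord1.
Qed.

Definition word_span S (w : W S) : 'cV[S]_n -> Prop :=
  Defs.span (fun u => exists x, u = word_vec w x).

Definition stable_under S (w : W S) (N : 'cV[S]_n -> Prop) : Prop :=
  forall u, N u -> [/\ N (matA w *m u), N (matB w *m u) & N (matC w *m u)].

Lemma stable_mat S (w : W S) N u c : stable_under w N -> N u -> N (mat w c *m u).
Proof. by move=> st /st []; rewrite /mat; case: c => -[|[|c]]. Qed.

Lemma stable_word S (w : W S) N x : stable_under w N -> (forall i, N (col i (vecs w))) ->
  N (word_vec w x).
Proof.
move=> st Nv; case: x => l i; rewrite /word_vec /=.
elim: l => [|c l IH] /=; first by rewrite mul1mx.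
by rewrite -mulmxA; exact: stable_mat.
Qed.

Lemma word_span_stable S (w : W S) : stable_under w (word_span w).
Proof.
have sc c u : word_span w u -> word_span w (mat w c *m u).
  move=> hu; apply: (span_min (N := fun u => word_span w (mat w c *m u)) _ _ hu).
    split=> [|a x y hx hy]; first by rewrite mulmx0; exact: (span_submodule _).1.
    by rewrite mulmxDr -scalemxAr; exact: (span_submodule _).2.
  move=> _ [[l i] ->]; apply: span_sub; exists (c :: l, i); by rewrite /word_vec /= mulmxA.
move=> u hu; split.
- exact: (sc (@Ordinal 3 0 isT)).
- exact: (sc (@Ordinal 3 1 isT)).
- exact: (sc (@Ordinal 3 2 isT)).
Qed.

Lemma generating_span S (w : W S) : generating w <-> forall u, word_span w u.
Proof.
split=> [gen u|h N Ns NABC Nv u].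
  apply: gen; [exact: span_submodule | exact: word_span_stable |].
  by move=> i; apply: span_sub; exists ([::], i); rewrite /word_vec /= mul1mx.
apply: span_min Ns _ (h u) => _ [x ->]; exact: stable_word.
Qed.

(* By multilinearity the determinant of any matrix whose columns lie in the span
   of the word vectors is a combination of brackets. *)
Lemma det_word_span S (w : W S) (I : S -> Prop) (u : 'I_n -> 'cV[S]_n) : ideal I ->
  (forall X, I (bracket X w)) -> (forall i, word_span w (u i)) ->
  I (\det (\matrix_(i, j) u i j 0)).
Proof.
move=> iI IX; suff H m : forall u : 'I_n -> 'cV[S]_n, (forall i, word_span w (u i)) ->
    (forall i : 'I_n, (m <= i)%N -> exists x, u i = word_vec w x) ->
    I (\det (\matrix_(i, j) u i j 0)).
  move=> hu; apply: (H n) => // i; by rewrite leqNgt ltn_ord.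
elim: m => [|m IH] {}u hu hw.
  have /choice [X XP] : forall i, exists x, u i = word_vec w x by move=> i; exact: hw.
  rewrite -det_tr (_ : _^T = frame X w); first exact: IX.
  by apply/matrixP => i j; rewrite mxE [LHS]mxE XP frameE.
have [lt|le] := ltnP m n; last first.
  by apply: IH => // i; move=> mi; have := leq_trans le mi; rewrite leqNgt ltn_ord.
pose i0 := Ordinal lt; pose M v := \matrix_(i, j) (if i == i0 then v else u i) j (0 : 'I_1).
have -> : \matrix_(i, j) u i j 0 = M (u i0).
  by apply/matrixP => i j; rewrite !mxE; case: eqP => // ->.
apply: (@span_min _ _ _ (fun v => I (\det (M v))) (u i0) _ _ (hu i0)).
  have lin a x y : \det (M (a *: x + y)) = a * \det (M x) + 1 * \det (M y).
    apply: (@determinant_multilinear _ _ _ _ _ i0).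
    - by apply/rowP => j; rewrite !mxE eqxx !mxE mul1r.
    - by apply/matrixP => i j; rewrite !mxE eq_sym (negPf (neq_lift _ _)).
    - by apply/matrixP => i j; rewrite !mxE eq_sym (negPf (neq_lift _ _)).
  have D0 : \det (M 0) = 0.
    by have := lin (-1) 0 0; rewrite scaler0 addr0 mul1r mulN1r addNr.
  split=> [|a x y hx hy]; first by rewrite D0; exact: ideal0.
  by rewrite lin mul1r; apply: idealD => //; exact: idealM.
move=> v [x vx]; apply: IH => i.
  by case: eqP => // _; apply: span_sub; exists x.
move=> mi; case: eqP => [_|ne]; first by exists x.
by apply: hw; rewrite ltn_neqAle mi andbT; apply/eqP => e; apply: ne; exact: val_inj.
Qed.

(** If the words span, [det_word_span] applied to the standard basis puts 1 into the ideal of the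
    brackets. Conversely, by Cramer's rule the bracket times any vector is a combination of the
    columns of the frame. *)
Lemma generatingP S (w : W S) :
  generating w <-> unit_ideal (fun a => exists X, a = bracket X w).
Proof.
split=> [/generating_span gen|/unit_idealP [m [b [a [aX e1]]]] N Ns NABC Nv u].
  apply/unit_idealP; rewrite -(det1 S n).
  have -> : 1%:M = \matrix_(i, j) (delta_mx i 0 : 'cV[S]_n) j (0 : 'I_1).
    by apply/matrixP => i j; rewrite !mxE eqxx andbT eq_sym.
  apply: (@det_word_span S w) => // [|X]; first exact: idealspan_ideal.
  by apply: idealspan_sub; exists X.
rewrite -[u]scale1r e1 scaler_suml; apply: submodule_sum => // i _.
rewrite -scalerA; apply: submoduleZ => //; have [X ->] := aX i.
rewrite -mul_scalar_mx -mul_mx_adj -mulmxA mulmx_col.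
apply: submodule_sum => // j _; apply: submoduleZ => //.
have -> : col j (frame X w) = word_vec w (X j) by apply/colP => l; rewrite mxE frameE.
exact: stable_word.
Qed.

Lemma generating_fields S (w : W S) :
  (forall L (f : {lrmorphism S -> L}), is_field L -> generating (pmap W f w)) ->
  generating w.
Proof.
move=> h; apply/generatingP; apply: contrapT => /residue_field [L [f [Lf fX]]].
have /generatingP [m [a [b [aX]]]] := h L f Lf.
rewrite big1 => [/eqP|i _]; first by rewrite eq_sym oner_eq0.
by have [X ->] := aX i; rewrite bracket_map fX ?mulr0 //; exists X.
Qed.

(** Generation depends only on field points, hence is insensitive to nilpotents; this keeps
    first-order deformations inside [U]. *)
Lemma generating_nil S (w w' : W S) : generating w ->
  (forall L (f : {lrmorphism S -> L}), is_field L -> pmap W f w = pmap W f w') ->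
  generating w'.
Proof.
move=> gw e; apply: generating_fields => L f Lf; rewrite -e //.
exact: generating_stable.
Qed.

Lemma bracket_generating X S (w : W S) : is_unit (bracket X w) -> generating w.
Proof.
move=> [b wb]; apply/generatingP/unit_idealP; rewrite -wb mulrC.
by apply: idealM; [exact: idealspan_ideal | apply: idealspan_sub; exists X].
Qed.

Definition frame_inv X S (w : W S) : 'M[S]_n :=
  uinv (bracket X w) *: \adj (frame X w).

Lemma mul_frame_inv X S (w : W S) : is_unit (bracket X w) ->
  frame X w *m frame_inv X w = 1%:M.
Proof.
move=> uw; rewrite -scalemxAr mul_mx_adj -/(bracket X w).
by rewrite scale_scalar_mx mulrC mulr_uinv.
Qed.

Definition normalize X S (w : W S) : W S := act (frame_inv X w) (frame X w) w.

Lemma frame_normalize X S (w : W S) : is_unit (bracket X w) ->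
  frame X (normalize X w) = 1%:M.
Proof.
by move=> uw; rewrite frame_act; [|]; rewrite (mulmx1C (mul_frame_inv uw)).
Qed.

Lemma bracket_frame1 X S (w : W S) : frame X w = 1%:M -> bracket X w = 1.
Proof. by rewrite /bracket => ->; rewrite det1. Qed.

Lemma frame1_generating X S (w : W S) : frame X w = 1%:M -> generating w.
Proof. by move=> /bracket_frame1 b1; apply: (@bracket_generating X); rewrite b1; exact: is_unit1. Qed.

Lemma normalizeK X S (w : W S) : is_unit (bracket X w) ->
  act (frame X w) (frame_inv X w) (normalize X w) = w.
Proof. by move=> uw; apply: actK; exact/mulmx1C/mul_frame_inv. Qed.

Lemma normalize_map X S T (f : {lrmorphism S -> T}) (w : W S) : is_unit (bracket X w) ->
  pmap W f (normalize X w) = normalize X (pmap W f w).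
Proof.
move=> uw; rewrite act_map /normalize /frame_inv map_mxZ map_mx_adj /= uinv_map //.
by rewrite !bracket_map !frame_map.
Qed.

Lemma normalize_act X S (g h : 'M[S]_n) (w : W S) : g *m h = 1%:M ->
  is_unit (bracket X w) -> normalize X (act g h w) = normalize X w.
Proof.
move=> gh uw; have uw' : is_unit (bracket X (act g h w)).
  by rewrite bracket_act //; apply: is_unitM => //; exact: detg_unit gh.
have I1 := mul_frame_inv uw; have I2 := mul_frame_inv uw'.
rewrite /normalize act_comp; have -> : frame X (act g h w) = g *m frame X w.
  exact: frame_act.
have -> : frame_inv X (act g h w) = frame_inv X w *m h.
  rewrite -[LHS]mul1mx -(mulmx1C I1) -mulmxA; congr (_ *m _).
  rewrite -[frame X w]mul1mx -(mulmx1C gh) -!mulmxA [g *m (_ *m _)]mulmxA.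
  by rewrite -(frame_act X w gh) I2 mulmx1.
by rewrite -mulmxA (mulmx1C gh) mulmx1 !mulmxA (mulmx1C gh) mul1mx.
Qed.

End Words.

(** * The charts of the GIT quotient *)

Section Coordinates.
Variables (k : fieldType) (n r : nat).
Implicit Types S T L : comAlgType k.
Local Notation W := (W k n r).

Definition coord : finType := (('I_3 * 'I_n * 'I_n) + ('I_n * 'I_r))%type.

Definition wcoord S (w : W S) (c : coord) : S :=
  match c with inl (c, i, j) => mat w c i j | inr (i, j) => vecs w i j end.

Definition tuple_of S (F : coord -> S) : W S :=
  let M c := \matrix_(i, j) F (inl (c, i, j)) in
  Tuple3 (M (@Ordinal 3 0 isT)) (M (@Ordinal 3 1 isT)) (M (@Ordinal 3 2 isT))
    (\matrix_(i, j) F (inr (i, j))).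

Lemma wcoord_map S T (f : {lrmorphism S -> T}) (w : W S) c :
  wcoord (pmap W f w) c = f (wcoord w c).
Proof. by case: c => [[[c i] j]|[i j]]; rewrite /= ?mat_map mxE. Qed.

Lemma wcoordK S (F : coord -> S) : wcoord (tuple_of F) =1 F.
Proof.
case=> [[[c i] j]|[i j]] /=; rewrite /mat /= ?mxE //.
case: c => -[|[|[|//]]] p; rewrite /= mxE; congr (F (inl (_, _, _))); exact: val_inj.
Qed.

Lemma wcoord_ext S (w w' : W S) : wcoord w =1 wcoord w' -> w = w'.
Proof.
move=> e; have eM c : mat w c = mat w' c.
  by apply/matrixP => i j; exact: (e (inl (c, i, j))).
have := eM (@Ordinal 3 0 isT); have := eM (@Ordinal 3 1 isT).
have := eM (@Ordinal 3 2 isT); have ev : vecs w = vecs w'.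
  by apply/matrixP => i j; exact: (e (inr (i, j))).
by move: ev; clear; case: w w' => A B C v [A' B' C' v']; rewrite /mat /= => -> -> -> ->.
Qed.

Definition bracket_mor (X : 'I_n -> seq 'I_3 * 'I_r) : morphism W (A1 k) :=
  @Morphism k W (A1 k) (fun S w => bracket X w) (fun S T f w => bracket_map X f w).

Lemma bracket_semi_invariant X : semi_invariant 1 (bracket_mor X).
Proof. by move=> S g h w gh; rewrite expr1; exact: bracket_act. Qed.

End Coordinates.

Section Chart.
Variables (k : fieldType) (n r : nat) (Q : functor k) (pi : morphism (U k n r) Q).
Implicit Types S T L : comAlgType k.
Local Notation W := (W k n r).
Local Notation U := (U k n r).
Hypothesis pi_inv : forall S (g h : 'M[S]_n) (w w' : U S), g *m h = 1%:M ->
  sval w' = act g h (sval w) -> pi S w' = pi S w.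

Lemma U_ext S (w w' : U S) : sval w = sval w' -> w = w'.
Proof. by case: w w' => w gw [w' gw'] /= e; exact: eq_exist. Qed.

Section Fixed.
Variables (s : morphism W (A1 k)) (B : comAlgType k) (j : morphism (Spec B) Q).
Hypothesis chart : GIT_chart pi s j.

Lemma chart_inj S : injective (j S).
Proof. by case: chart => -[]. Qed.

Lemma chart_point S (w : U S) : is_unit (s S (sval w)) -> exists x, j S x = pi S w.
Proof. by move=> uw; case: chart => _ h _; exact/h. Qed.

Lemma chart_unit S (w : U S) x : j S x = pi S w -> is_unit (s S (sval w)).
Proof. by move=> jx; case: chart => _ h _; apply/h; exists x. Qed.

(** Naturality and invariance of [h] are required only where [s] is invertible, so formulas with
    [uinv] can be fed in without constructing a morphism on [U_ s]. *)
Lemma chart_fun (h : forall S, U S -> S) :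
  (forall S T (f : {lrmorphism S -> T}) (w : U S), is_unit (s S (sval w)) ->
     h T (pmap U f w) = f (h S w)) ->
  (forall S (g g' : 'M[S]_n) (w w' : U S), g *m g' = 1%:M -> is_unit (s S (sval w)) ->
     sval w' = act g g' (sval w) -> h S w' = h S w) ->
  exists! b : B, forall S (w : U S) x, j S x = pi S w -> h S w = x b.
Proof.
move=> hn hi; case: chart => _ _ univ.
have hn' S T (f : {lrmorphism S -> T}) (w : U_ s S) :
    h T (sval (pmap (U_ s) f w)) = f (h S (sval w)) by apply: hn; exact: (svalP w).
have [|b [hb bu]] := univ (Morphism (Y := A1 k) (mor := fun S (w : U_ s S) => h S (sval w)) hn').
  by move=> S g g' w w' gg' e; apply: hi gg' (svalP w) e.
exists b; split=> [S w x jx|b' hb'].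
  have uw : is_unit (s S (sval w)) by exact: chart_unit jx.
  exact: (hb S (exist _ w uw : U_ s S) x jx).
by apply: bu => S w x jx; exact: hb'.
Qed.

(** As [j] is injective, [b1] defines an invariant function on [U_ s], extended by 0 elsewhere. By
    hypothesis [b2] represents it too, and the representing element is unique. *)
Lemma chart_sep (b1 b2 : B) :
  (forall S (w : U S) x, j S x = pi S w -> x b1 = x b2) -> b1 = b2.
Proof.
move=> e.
pose h S (w : U S) : S := if pselect (exists x, j S x = pi S w) is left ex
  then sval (cid ex) b1 else 0.
have hE S (w : U S) x : j S x = pi S w -> h S w = x b1.
  move=> jx; rewrite /h; case: pselect => [ex|[]]; last by exists x.
  by case: (cid ex) => y /= jy; rewrite (chart_inj (etrans jy (esym jx))).
have [||b [_ bu]] := @chart_fun h.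
- move=> S T f w /chart_point [x jx]; rewrite (hE _ _ _ jx) (hE _ _ (f \o x : {lrmorphism B -> T})) //.
  by rewrite (mor_nat pi) -jx -(mor_nat j).
- move=> S g g' w w' gg' /chart_point [x jx] ew.
  by rewrite (hE _ _ _ jx) (hE _ _ x) // (pi_inv gg' ew).
by rewrite -(bu b1) => [|S w x /hE //]; apply: bu => S w x jx; rewrite -(e S w x jx); exact: hE.
Qed.

End Fixed.

Section BracketChart.
Variables (X : 'I_n -> seq 'I_3 * 'I_r) (B : comAlgType k) (j : morphism (Spec B) Q).
Hypothesis chart : GIT_chart pi (bracket_mor k X) j.

(** The coordinates of the normalized tuple are invariant functions, hence elements of [B], and form
    a tuple [wB] over [B] itself. The map [psi] classifying its image agrees with the identity at
    all points from [U], so it is the identity, and [wB] is a section of [pi] over the chart. *)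
Lemma bracket_chart_slice : exists wB : U B,
  [/\ frame X (sval wB) = 1%:M,
      forall S (x : Spec B S), j S x = pi S (pmap U x wB) &
      forall S (w : U S) x, j S x = pi S w -> normalize X (sval w) = sval (pmap U x wB)].
Proof.
have coordB c : exists b : B, forall S (w : U S) x, j S x = pi S w ->
    wcoord (normalize X (sval w)) c = x b.
  have [||b [hb _]] := chart_fun chart (h := fun S w => wcoord (normalize X (sval w)) c).
  - by move=> S T f w uw; rewrite -wcoord_map normalize_map.
  - by move=> S g g' w w' gg' uw ->; rewrite normalize_act.
  - by exists b.
have /choice [b bP] := coordB; pose w0 : W B := tuple_of b.
have w0P S (w : U S) x : j S x = pi S w -> normalize X (sval w) = pmap W x w0.
  by move=> jx; apply: wcoord_ext => c; rewrite wcoord_map wcoordK (bP _ _ _ _ jx).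
have fr : frame X w0 = 1%:M.
  apply/matrixP => i l; apply: (chart_sep chart) => S w x jx.
  have uw := chart_unit chart jx.
  transitivity (frame X (pmap W x w0) i l); first by rewrite frame_map [RHS]mxE.
  rewrite -(w0P S w x jx) frame_normalize // !mxE.
  by case: eqP => _; rewrite ?mulr1n ?mulr0n ?lr1 ?lr0.
pose wB : U B := exist _ w0 (frame1_generating fr).
have [psi jpsi] : exists psi, j B psi = pi B wB.
  by apply: (chart_point chart); rewrite /= bracket_frame1 //; exact: is_unit1.
have wN S (w : U S) x : j S x = pi S w -> pi S (pmap U x wB) = pi S w.
  move=> jx; have uw := chart_unit chart jx; apply: (pi_inv (mulmx1C (mul_frame_inv uw))).
  exact: esym (w0P _ _ _ jx).
have psiE b1 : psi b1 = b1.
  apply: (chart_sep chart) => S w x jx.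
  have : j S (x \o psi) = j S x.
    by rewrite (mor_nat j x psi) jpsi -mor_nat (wN _ w) // jx.
  by move=> /(chart_inj chart) e; rewrite -[in RHS]e.
exists wB; split=> // S x.
rewrite mor_nat -jpsi -mor_nat; congr (j S _); apply: lrmorphism_ext => y /=.
by rewrite psiE.
Qed.

End BracketChart.

Hypothesis charts : forall d s, (0 < d)%N -> semi_invariant d s ->
  (exists S (w : W S), s S w <> 0) ->
  exists B (j : morphism (Spec B) Q), GIT_chart pi s j.

Lemma bracket_chart X S (w : W S) : is_unit (bracket X w) ->
  exists B (j : morphism (Spec B) Q), GIT_chart pi (bracket_mor k X) j.
Proof.
move=> uw; apply: (@charts 1) => //; first exact: bracket_semi_invariant.
exists S, w => /= e; move: uw; rewrite e; exact: is_unit0.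
Qed.

Lemma orbit_bracket X S (w w' : U S) : pi S w = pi S w' ->
  is_unit (bracket X (sval w)) ->
  is_unit (bracket X (sval w')) /\ normalize X (sval w) = normalize X (sval w').
Proof.
move=> e uw; have [B [j chart]] := bracket_chart uw.
have [x jx] := chart_point chart uw.
have jx' : j S x = pi S w' by rewrite -e.
have [wB [_ _ wN]] := bracket_chart_slice chart.
by split; [exact: (chart_unit chart jx') | rewrite (wN _ _ _ jx) (wN _ _ _ jx')].
Qed.

(** If $u'=pu$, then $F(u')\,\mathrm{adj}\,F(u)=\det F(u)\cdot p$ for every frame $F$. Weighting
    these products by coefficients that express 1 through the brackets of $u$ gives one global
    matrix, so the group elements need not be glued. *)
Lemma orbit S (w w' : U S) : pi S w = pi S w' ->
  exists g h, g *m h = 1%:M /\ sval w' = act g h (sval w).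
Proof.
have half (u u' : U S) : pi S u = pi S u' -> exists g : 'M[S]_n,
    forall T (f : {lrmorphism S -> T}) (p q : 'M[T]_n), p *m q = 1%:M ->
    sval (pmap U f u') = act p q (sval (pmap U f u)) -> map_mx f g = p.
  move=> e; have /generatingP [m [a [b [aX e1]]]] := svalP u.
  have /choice [X XP] := aX.
  exists (\sum_i b i *: (frame (X i) (sval u') *m \adj (frame (X i) (sval u)))).
  move=> T f p q pq e'; rewrite -[RHS]scale1r -(lr1 f) -e1 lr_sum scaler_suml.
  rewrite raddf_sum; apply: eq_bigr => i _.
  apply: etrans (map_mxZ _ _ _) _; rewrite lrM -scalerA; congr (_ *: _).
  rewrite map_mxM map_mx_adj -!frame_map.
  have -> : pmap W f (sval u') = act p q (pmap W f (sval u)) by exact: e'.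
  rewrite frame_act // -mulmxA mul_mx_adj XP -bracket_map.
  by rewrite mul_mx_scalar.
move=> e; have [g gP] := half _ _ e; have [h hP] := half _ _ (esym e).
have loc X T (f : {lrmorphism S -> T}) : is_unit (f (bracket X (sval w))) ->
    map_mx f g *m map_mx f h = 1%:M /\
    pmap W f (sval w') = act (map_mx f g) (map_mx f h) (pmap W f (sval w)).
  rewrite -bracket_map => uf.
  have ef : pi T (pmap U f w) = pi T (pmap U f w') by rewrite !mor_nat e.
  have [uf' eN] := orbit_bracket ef uf.
  have I1 := mul_frame_inv uf; have I2 := mul_frame_inv uf'.
  set p := frame X _ in I1; set q := frame_inv X _ in I1.
  set p' := frame X _ in I2; set q' := frame_inv X _ in I2.
  have pq : (p' *m q) *m (p *m q') = 1%:M.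
    by rewrite -mulmxA (mulmxA q) (mulmx1C I1) mul1mx.
  have ea : sval (pmap U f w') = act (p' *m q) (p *m q') (sval (pmap U f w)).
    by rewrite -act_comp -[act q p _]/(normalize X _) eN normalizeK.
  have ea' : sval (pmap U f w) = act (p *m q') (p' *m q) (sval (pmap U f w')).
    by rewrite ea actK.
  by rewrite (gP _ _ _ _ pq ea) (hP _ _ _ _ (mulmx1C pq) ea').
have /generatingP gw := svalP w.
exists g, h; split.
  apply/matrixP => i l; apply: (eq_local gw) => _ [X ->] T f /loc [gh _].
  have -> : f ((g *m h) i l) = (map_mx f g *m map_mx f h) i l by rewrite -map_mxM [RHS]mxE.
  by rewrite gh !mxE; case: eqP => _; rewrite ?mulr1n ?mulr0n ?lr1 ?lr0.
apply: wcoord_ext => c; apply: (eq_local gw) => _ [X ->] T f /loc [_ e'].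
by rewrite -!wcoord_map act_map -e'.
Qed.

End Chart.

(** * Semi-invariants vanish at tuples that do not generate *)

Section Fields.
Variable k : fieldType.

(** Transfers linear algebra and root counting over a [fieldType] to an algebra known only to
    satisfy [is_field]. *)
Lemma field_ind (P : comNzRingType -> Prop) : (forall F : fieldType, P F) ->
  forall L : comAlgType k, is_field L -> P L.
Proof.
move=> PF L Lf.
have mulVf (x : L) : x != 0 -> uinv x * x = 1.
  by move=> /eqP/Lf ux; rewrite mulrC mulr_uinv.
have inv0 : uinv (0 : L) = 0.
  by rewrite /uinv; case: pselect => // u0; case: (is_unit0 u0).
pose b := GRing.ComNzRing_isField.Build L mulVf inv0.
pose F : fieldType := HB.pack (GRing.ComAlgebra.sort L) b.
exact: (PF F).
Qed.

(** [V] is merely a predicate. A matrix of maximal rank among those with rows in [V] has row space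
    [V], and its pseudo-inverse gives a projector, singular because [V] is proper. *)
Lemma subspace_projection (F : fieldType) n (V : 'cV[F]_n -> Prop) :
  submodule V -> (exists u, ~ V u) ->
  exists e : 'M_n, [/\ forall u, V u -> e *m u = u, forall u, V (e *m u) & \det e = 0].
Proof.
move=> sV [u0 Vu0].
pose P d := `[< exists m (M : 'M[F]_(m, n)), (forall i, V (row i M)^T) /\ \rank M = d >].
have ex : exists d, P d.
  exists 0%N; apply/asboolP; exists 0%N, 0; split=> [[]//|]; exact: mxrank0.
have bd d : P d -> (d <= n)%N.
  by move=> /asboolP [m [M [_ <-]]]; exact: rank_leq_col.
case: (ex_maxnP ex bd) => d /asboolP [m [M [MV Md]]] dmax.
have VM u : V u -> (u^T <= M)%MS.
  move=> Vu; have sub : (M <= col_mx M u^T)%MS.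
    by have := submx_refl (col_mx M u^T); rewrite col_mx_sub => /andP[].
  have : (\rank (col_mx M u^T) <= \rank M)%N.
    rewrite Md; apply/dmax/asboolP; exists (m + 1)%N, (col_mx M u^T); split=> // i.
    case: (split_ordP i) => j ->; first by rewrite rowKu.
    by rewrite rowKd [j]ord1 row_id trmxK.
  by rewrite (geq_leqif (mxrank_leqif_sup sub)) col_mx_sub => /andP[].
have Ve u : V ((pinvmx M *m M)^T *m u).
  rewrite -[u]trmxK -trmx_mul mulmxA mulmx_sum_row raddf_sum /=.
  apply: submodule_sum => // i _; rewrite linearZ /=; exact: submoduleZ.
exists (pinvmx M *m M)^T; split=> // [u /VM uM|].
  by rewrite -[u]trmxK -trmx_mul mulmxA mulmxKpV.
apply/eqP; apply: contra_notT Vu0; rewrite -unitfE => de.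
have eu : (pinvmx M *m M)^T \in unitmx by rewrite unitmxE.
by rewrite -[u0](mulKVmx eu).
Qed.

Lemma poly_eq0_nat (F : fieldType) (p : {poly F}) :
  (forall m, m.+1%:R != 0 :> F) -> (forall m, p.[m.+1%:R] = 0) -> p = 0.
Proof.
move=> ch h; case: (eqVneq p 0) => // pn0.
pose rs : seq F := [seq m.+1%:R | m <- iota 0 (size p)].
suff : (size rs < size p)%N by rewrite size_map size_iota ltnn.
apply: max_poly_roots pn0 _ _; first by apply/allP => _ /mapP [m _ ->]; apply/eqP.
rewrite map_inj_uniq ?iota_uniq // => a b.
wlog ab : a b / (a <= b)%N => [W|].
  by case/orP: (leq_total a b) => le e; [exact: W|apply/esym/W].
move=> /eqP; rewrite eq_sym -subr_eq0 -natrB // subSS.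
case: (ltngtP a b) ab => // lt _; rewrite -(subnSK lt).
by rewrite (negPf (ch _)).
Qed.

End Fields.

Section Degeneration.
Variables (R : comNzRingType) (n : nat) (e f : 'M[R]_n) (t t' : R).
Hypotheses (ef1 : e + f = 1%:M) (ee : e *m e = e) (tt' : t * t' = 1).

Let ef : e *m f = 0.
Proof. by apply: (addrI e); rewrite addr0 -{1}ee -mulmxDr ef1 mulmx1. Qed.
Let fe : f *m e = 0.
Proof. by apply: (addrI e); rewrite addr0 -{1}ee -mulmxDl ef1 mul1mx. Qed.
Let ff : f *m f = f.
Proof. by rewrite -[RHS]mulmx1 -ef1 mulmxDr fe add0r. Qed.

Lemma scaling_inv : (e + t *: f) *m (e + t' *: f) = 1%:M.
Proof.
rewrite mulmxDl !mulmxDr -!scalemxAl -!scalemxAr scalerA.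
by rewrite ee ef fe ff tt' !scaler0 addr0 add0r scale1r.
Qed.

(** [M] is block triangular for the decomposition given by [e] and [f], and conjugation by
    $\mathrm{diag}(1,t)$ undoes the scaling of the off-diagonal block by $t$. The scaled matrix
    still makes sense at $t=0$, where it is block diagonal. *)
Lemma degeneration_conj (M : 'M[R]_n) : e *m M *m e = M *m e ->
  (e + t *: f) *m (e *m M *m e + t *: (e *m M *m f) + f *m M *m f) *m (e + t' *: f) = M.
Proof.
move=> Me; rewrite -[RHS]mulmx1 -scaling_inv mulmxA; congr (_ *m _).
rewrite mulmxDl -scalemxAl !mulmxDr -!scalemxAr !mulmxA ee ef fe ff !mul0mx.
rewrite !scaler0 !addr0 !add0r Me -addrA -scalerDr -!mulmxDl.
by rewrite ef1 mul1mx.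
Qed.
End Degeneration.

Section Stability.
Variables (k : fieldType) (n r : nat).
Hypothesis char0 : forall m, m.+1%:R != 0 :> k.
Implicit Types S T L : comAlgType k.
Local Notation W := (W k n r).

Lemma char0_alg S m : m.+1%:R != 0 :> S.
Proof.
apply/eqP => e; have : (m.+1%:R^-1 *: m.+1%:R : S) = 1.
  by rewrite -[m.+1%:R in X in _ *: X](@mulr1 S) mulr_natl -scaler_nat scalerA mulVf ?scale1r.
by rewrite e scaler0 => /eqP; rewrite eq_sym oner_eq0.
Qed.

(* Scaling a complement of the span of the word vectors by t, and letting t tend
   to 0, degenerates w while s(w) does not change. *)
Lemma semi_invariant_generating (s : morphism W (A1 k)) d S (w : W S) : (0 < d)%N ->
  semi_invariant d s -> is_unit (s S w) -> generating w.
Proof.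
move=> d0 sd us; apply: generating_fields => L f Lf.
have {us} : s L (pmap W f w) <> 0.
  by rewrite mor_nat /= => e; move: (is_unit_map f us); rewrite e; exact: is_unit0.
move: (pmap W f w) => {f S}w ns.
apply/generating_span; apply: contrapT => /existsNP nsp.
pose proj (R : comNzRingType) := forall V : 'cV[R]_n -> Prop, @submodule R _ V ->
  (exists u, ~ V u) ->
  exists e : 'M_n, [/\ forall u, V u -> e *m u = u, forall u, V (e *m u) & \det e = 0].
have [e [eV Ve de]] := @field_ind k proj (fun F => @subspace_projection F n) L Lf _
  (span_submodule _) nsp.
have spw := @word_span_stable _ _ _ _ w.
have eM M : (forall u, word_span w u -> word_span w (M *m u)) -> e *m M *m e = M *m e.
  move=> st; apply/matrixP => i j; rewrite -[LHS]mulr1 -[RHS]mulr1.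
  have E (N : 'M[L]_n) : N i j * 1 = (N *m delta_mx j 0) i (0 : 'I_1).
    by rewrite mulr1 -colE mxE.
  by rewrite !E -!mulmxA eV //; exact/st/Ve.
have ev : e *m vecs w = vecs w.
  apply/matrixP => i j; have E (N : 'M[L]_(n, r)) : N i j = (N *m delta_mx j 0) i (0 : 'I_1).
    by rewrite -colE mxE.
  rewrite !E -mulmxA eV //; apply: span_sub; exists ([::], j).
  by rewrite /word_vec /= mul1mx colE.
have [c cE] := polyalg_const L.
pose x : polyalg L := 'X.
pose lam (R : comAlgType k) (e1 : 'M[R]_n) (t : R) := e1 + t *: (1%:M - e1).
pose deg (R : comAlgType k) (e1 : 'M[R]_n) (t : R) (M : 'M[R]_n) :=
  e1 *m M *m e1 + t *: (e1 *m M *m (1%:M - e1)) + (1%:M - e1) *m M *m (1%:M - e1).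

pose wt (R : comAlgType k) (e1 : 'M[R]_n) t (w1 : W R) : W R := Tuple3 (deg R e1 t (matA w1))
  (deg R e1 t (matB w1)) (deg R e1 t (matC w1)) (vecs w1).
pose ce := map_mx c e; pose cw := pmap W c w.
(* A polynomial in the parameter, obtained by evaluating [s] over $L[t]$. Semi-invariance makes it
   vanish at all positive integers, hence identically; at $t=0$ the determinant is $\det e=0$ and
   $d>0$, which leaves $s(w)=0$. *)
pose p : polyalg L := \det (lam _ ce x) ^+ d * s _ (wt _ ce x cw) - c (s _ w).
have ev_t (t : L) : p.[t] = \det (lam _ e t) ^+ d * s _ (wt _ e t w) - s _ w.
  have [E EE] := polyalg_eval (idfun : {lrmorphism L -> L}) t.
  have EE' q : E q = q.[t] by rewrite EE map_poly_id.
  have Ec a : E (c a) = a by rewrite EE' cE hornerC.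
  have Ecm m1 m2 (M : 'M_(m1, m2)) : map_mx E (map_mx c M) = M.
    by apply/matrixP => i j; rewrite !mxE Ec.
  have Ex : E x = t by rewrite EE' hornerX.
  have Exm (M : 'M_n) : map_mx E (x *: M) = t *: map_mx E M.
    by apply/matrixP => i j; rewrite !mxE lrM Ex.
  rewrite -EE' lrB Ec lrM lrX -det_map_mx.
  have -> : E (s _ (wt _ ce x cw)) = s L (pmap W E (wt _ ce x cw)) by rewrite mor_nat.
  congr (\det _ ^+ d * s L _ - _); last first.
    have Ed (M : 'M_n) : map_mx E (deg _ ce x (map_mx c M)) = deg _ e t M.
      by rewrite /deg !map_mxD Exm !map_mxM !map_mxB !map_mx1 !Ecm.
    by rewrite /wt -!Ed -[in RHS](Ecm _ _ (vecs w)).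
  by rewrite /lam map_mxD Exm map_mxB map_mx1 Ecm.
have p0 : p = 0 :> {poly L}.
  pose roots (R : comNzRingType) := forall q : {poly R}, (forall m, m.+1%:R != 0 :> R) ->
    (forall m, q.[m.+1%:R] = 0) -> q = 0.
  apply: (@field_ind k roots (@poly_eq0_nat) L Lf p (char0_alg L)) => m.
  have [t' tt'] : is_unit (m.+1%:R : L) by apply/Lf/eqP/char0_alg.
  move: (m.+1%:R : L) tt' => t tt'; rewrite ev_t.
  have ee : e *m e = e.
    have := eM 1%:M; rewrite mulmx1 mul1mx; apply=> u; by rewrite mul1mx.
  have ef1 : e + (1%:M - e) = 1%:M by rewrite addrC subrK.
  have ll : lam _ e t *m lam _ e t' = 1%:M by exact: scaling_inv.
  have lM M : (forall u, word_span w u -> word_span w (M *m u)) ->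
      lam _ e t *m deg _ e t M *m lam _ e t' = M.
    by move=> st; apply: degeneration_conj => //; exact: eM.
  have <- : s L (act (lam _ e t) (lam _ e t') (wt _ e t w)) =
      \det (lam _ e t) ^+ d * s L (wt _ e t w) by apply: sd.
  apply/eqP; rewrite subr_eq0; apply/eqP; congr (s L _).
  rewrite /act /wt /=; have lv : lam _ e t *m vecs w = vecs w.
    by rewrite /lam mulmxDl -scalemxAl mulmxBl mul1mx ev subrr scaler0 addr0.
  rewrite lv !lM //; first by case: (w).
  - by move=> u /spw [].
  - by move=> u /spw [].
  - by move=> u /spw [].
apply: ns; have := ev_t 0; rewrite p0 horner0 /lam scale0r addr0 de.
rewrite expr0n eqn0Ngt d0 mul0r sub0r => /eqP.
by rewrite eq_sym oppr_eq0 => /eqP.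
Qed.

End Stability.

(** * Cayley's Omega process *)

Section MpolyGeneral.
Variables (N : nat) (R : comNzRingType).
Implicit Types (D F : {mpoly R[N]}).

Lemma mpoly_ring_ind (P : {mpoly R[N]} -> Prop) :
  (forall c, P c%:MP) -> (forall i, P 'X_i) ->
  (forall p q, P p -> P q -> P (p + q)) -> (forall p q, P p -> P q -> P (p * q)) ->
  forall p, P p.
Proof.
move=> PC PX PD PM; apply: mpolyind => [|c m p _ _ Pp]; first by rewrite -(mpolyC0 N R); exact: PC.
apply: PD => //; rewrite -mul_mpolyC; apply: (PM) => //.
have P1 : P 1 by rewrite -mpolyC1; exact: PC.
rewrite mpolyXE_id; apply: (big_ind P) => // i _.
by elim: (m i) => [|e IH]; rewrite ?expr0 // exprS; exact: PM.
Qed.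

Lemma mderivXU (i j : 'I_N) : ('X_i : {mpoly R[N]})^`M(j) = (i == j)%:R.
Proof.
rewrite mderivX mnm1E; case: eqP => [->|_]; last by rewrite scale0r.
by rewrite scale1r (_ : (U_(j) - U_(j))%MM = 0%MM) ?mpolyX0 //; apply/mnmP => l;
  rewrite mnmBE mnm0E subnn.
Qed.

(** The apolar pairing: [D], read as a differential operator with constant coefficients, is applied
    to [F] and evaluated at the origin. *)
Definition apolar D F : R := \sum_(m <- msupp D) D@_m * (F^`M[m])@_0.

Lemma apolarE d D F : (msize D <= d)%N ->
  apolar D F = \sum_(m : 'X_{1..N < d}) D@_m * (F^`M[m])@_0.
Proof.
move=> le; rewrite /apolar (big_mksub 'X_{1..N < d}) ?msupp_uniq //=; first last.
  by move=> x /msize_mdeg_lt /leq_trans; apply.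
rewrite big_rmcond //= => j /memN_msupp_eq0 ->.
by rewrite mul0r.
Qed.

Lemma apolarDl D D' F : apolar (D + D') F = apolar D F + apolar D' F.
Proof.
pose d := maxn (msize (D + D')) (maxn (msize D) (msize D')).
rewrite !(@apolarE d) ?leq_max ?leqnn ?orbT // -big_split; apply: eq_bigr => m _.
by rewrite mcoeffD mulrDl.
Qed.

Lemma apolarZl c D F : apolar (c *: D) F = c * apolar D F.
Proof.
pose d := maxn (msize (c *: D)) (msize D).
rewrite !(@apolarE d) ?leq_max ?leqnn ?orbT // mulr_sumr; apply: eq_bigr => m _.
by rewrite mcoeffZ mulrA.
Qed.

Lemma apolarXl m F : apolar 'X_[m] F = (F^`M[m])@_0.
Proof. by rewrite /apolar msuppX big_seq1 mcoeffX eqxx mul1r. Qed.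

Lemma apolar0l F : apolar 0 F = 0.
Proof. by rewrite -(scale0r 0) apolarZl mul0r. Qed.

Lemma apolarDr D F G : apolar D (F + G) = apolar D F + apolar D G.
Proof.
by rewrite -big_split; apply: eq_bigr => m _; rewrite mderivmD mcoeffD mulrDr.
Qed.

Lemma apolarZr D c F : apolar D (c *: F) = c * apolar D F.
Proof.
by rewrite mulr_sumr; apply: eq_bigr => m _; rewrite mderivmZ mcoeffZ mulrCA.
Qed.

Lemma apolar0r D : apolar D 0 = 0.
Proof. by rewrite -(scale0r 0) apolarZr mul0r. Qed.

Lemma apolar_sumr D (I : Type) (s : seq I) (P : pred I) (F : I -> {mpoly R[N]}) :
  apolar D (\sum_(i <- s | P i) F i) = \sum_(i <- s | P i) apolar D (F i).
Proof. by apply: (big_morph (apolar D) (apolarDr D)); exact: apolar0r. Qed.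

Lemma apolar_mulX i D F : apolar ('X_i * D) F = apolar D (F^`M(i)).
Proof.
elim/mpolyind: D => [|c m p _ _ IH]; first by rewrite mulr0 !apolar0l.
rewrite mulrDr !apolarDl IH -scalerAr !apolarZl -mpolyXD !apolarXl.
by rewrite mderivmDm mderivmU1m.
Qed.

End MpolyGeneral.

Lemma apolar_map N (R S : comNzRingType) (f : {rmorphism R -> S}) (D F : {mpoly R[N]}) :
  apolar (map_mpoly f D) (map_mpoly f F) = f (apolar D F).
Proof.
elim/mpolyind: D => [|c m p _ _ IH]; first by rewrite !(raddf0, apolar0l).
rewrite !(raddfD, apolarDl) /= IH; congr (_ + _).
rewrite -mul_mpolyC rmorphM /= map_mpolyC map_mpolyX !mul_mpolyC !apolarZl rmorphM.
congr (_ * _); rewrite !apolarXl !mcoeff_mderivm addm0 mcoeff_map_mpoly.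
by rewrite rmorphMn.
Qed.

(** Distinct monomials are orthogonal, so the pairing of [D] with itself is $\sum_m m!\,D_m^2$,
    where $m!$ is the product of the factorials of the exponents. *)
Lemma apolar_self_gt0 N (D : {mpoly int[N]}) : D != 0 -> 0 < apolar D D.
Proof.
move=> D0; have ge (m : 'X_{1..N}) : 0 <= D@_m * (D^`M[m])@_0.
  rewrite mcoeff_mderivm addm0 mulrnAr mulrn_wge0 // -expr2; exact: sqr_ge0.
rewrite lt_neqAle sumr_ge0 ?andbT //; apply/eqP => /esym/eqP.
rewrite psumr_eq0 // => /allP h.
have : mlead D \in msupp D by rewrite mlead_supp.
move=> /[dup] /h /=; rewrite mcoeff_mderivm addm0 mulrnAr mulrn_eq0 -expr2 sqrf_eq0.
rewrite mcoeff_msupp => /orP[|/eqP ->]; last by rewrite eqxx.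
by rewrite eqn0Ngt prodn_gt0 // => i; rewrite ffactnn fact_gt0.
Qed.

Section GenericMatrix.
Variable n : nat.

Definition nvars := #|{: 'I_n * 'I_n}|.

Section Ring.
Variable R : comNzRingType.
Local Notation P := {mpoly R[nvars]}.

Definition generic_mx (A : comNzRingType) : 'M[{mpoly A[nvars]}]_n :=
  \matrix_(i, j) 'X_(enum_rank (i, j)).

Definition mx_var (A : Type) (M : 'M[A]_n) (t : 'I_nvars) : A :=
  M (enum_val t).1 (enum_val t).2.

Definition mx_eval (A : comNzRingType) (f : R -> A) (M : 'M[A]_n) (F : P) : A :=
  mmap f (mx_var M) F.

Lemma mx_evalX (A : comNzRingType) (f : {rmorphism R -> A}) (M : 'M[A]_n) i j :
  mx_eval f M 'X_(enum_rank (i, j)) = M i j.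
Proof. by rewrite /mx_eval mmapX mmap1U /mx_var enum_rankK. Qed.

(** The right translation $F(X)\mapsto F(Xg)$. *)
Definition translate (g : 'M[R]_n) (F : P) : P :=
  mmap (@mpolyC _ R) (mx_var (generic_mx R *m map_mx (@mpolyC _ R) g)) F.

HB.instance Definition _ g := GRing.RMorphism.copy (translate g)
  (mmap (@mpolyC _ R) (mx_var (generic_mx R *m map_mx (@mpolyC _ R) g))).

Lemma translateM g p q : translate g (p * q) = translate g p * translate g q.
Proof. exact: rmorphM. Qed.

Lemma translateD g p q : translate g (p + q) = translate g p + translate g q.
Proof. exact: rmorphD. Qed.

Lemma translateX g i j :
  translate g 'X_(enum_rank (i, j)) = \sum_l g l j *: 'X_(enum_rank (i, l)).
Proof.
rewrite /translate mmapX mmap1U /mx_var enum_rankK mxE; apply: eq_bigr => l _.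
by rewrite !mxE mulrC mul_mpolyC.
Qed.

Lemma translateC g c : translate g c%:MP = c%:MP.
Proof. exact: mmapC. Qed.

Lemma mderiv_sum (I : Type) (s : seq I) (F : I -> P) j :
  (\sum_(i <- s) F i)^`M(j) = \sum_(i <- s) (F i)^`M(j).
Proof. exact: raddf_sum. Qed.

(* Both sides are derivations along translate g, so it suffices to compare them
   on the variables. *)
Lemma mderiv_translate g F i j : (translate g F)^`M(enum_rank (i, j)) =
  \sum_l g j l *: translate g (F^`M(enum_rank (i, l))).
Proof.
elim/mpoly_ring_ind: F => [c|t|p q hp hq|p q hp hq].
- rewrite translateC mderivC big1 // => l _.
  by rewrite mderivC raddf0 scaler0.
- rewrite -[t]enum_valK; case: (enum_val t) => a b.
  rewrite translateX mderiv_sum.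
  under eq_bigr do rewrite mderivZ mderivXU (inj_eq enum_rank_inj) xpair_eqE.
  under [RHS]eq_bigr do rewrite mderivXU (inj_eq enum_rank_inj) xpair_eqE rmorph_nat.
  rewrite (bigD1 j) //= eqxx andbT big1 ?addr0 => [|l /negPf ->]; last first.
    by rewrite andbF scaler0.
  rewrite [RHS](bigD1 b) //= eqxx andbT [X in _ + X]big1 ?addr0 // => l.
  by rewrite eq_sym => /negPf ->; rewrite andbF scaler0.
- rewrite translateD mderivD hp hq -big_split; apply: eq_bigr => l _.
  by rewrite mderivD translateD scalerDr.
- rewrite translateM mderivM hp hq mulr_suml mulr_sumr -big_split; apply: eq_bigr => l _.
  by rewrite mderivM translateD !translateM scalerDr scalerAl scalerAr.
Qed.

Lemma translate0 g F : (translate g F)@_0 = F@_0.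
Proof.
elim/mpoly_ring_ind: F => [c|t|p q hp hq|p q hp hq].
- by rewrite translateC.
- rewrite -[t]enum_valK; case: (enum_val t) => a b; rewrite translateX raddf_sum /=.
  rewrite big1 => [|l _]; first by rewrite mcoeffX mnm1_eq0.
  by rewrite mcoeffZ mcoeffX mnm1_eq0 mulr0.
- by rewrite translateD !mcoeffD hp hq.
- by rewrite translateM !(rmorphM (mcoeff 0%MM)) /= hp hq.
Qed.

(** Translation by the transpose is the adjoint for the apolar pairing. For a linear form [D] this
    is the chain rule [mderiv_translate]. *)
Lemma apolar_translate g D F : apolar (translate g^T D) F = apolar D (translate g F).
Proof.
(* Carrying a further factor [D'] makes the property of [D] multiplicative, so that only constants
   and variables have to be checked. *)
pose G D := forall F, apolar (translate g^T D) F = apolar D (translate g F).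
suff H : forall D', G D' -> G (D * D').
  rewrite -[D]mulr1; apply: H => {}F; rewrite rmorph1 -mpolyX0 !apolarXl !mderivm0m.
  by rewrite translate0.
elim/mpoly_ring_ind: D {F} => [c|t|p q hp hq|p q hp hq] D' GD' F.
- by rewrite translateM translateC !mul_mpolyC !apolarZl GD'.
- rewrite -[t]enum_valK; case: (enum_val t) => i j.
  rewrite translateM translateX mulr_suml apolar_mulX mderiv_translate apolar_sumr.
  rewrite (big_morph (fun D => apolar D F) (fun D D' => apolarDl D D' F) (apolar0l F)).
  apply: eq_bigr => l _.
  by rewrite -scalerAl apolarZl apolar_mulX apolarZr GD' mxE.
- by rewrite mulrDl translateD !apolarDl hp // hq.
- by rewrite -mulrA; apply: hp; apply: hq.
Qed.

End Ring.

Definition generic_det (R : comNzRingType) : {mpoly R[nvars]} := \det (generic_mx R).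

Lemma translate_det (R : comNzRingType) (g : 'M[R]_n) :
  translate g (generic_det R) = (\det g)%:MP * generic_det R.
Proof.
rewrite /generic_det -det_map_mx mulrC -(det_map_mx (@mpolyC _ R)) -det_mulmx.
congr (\det _); apply/matrixP => i j; transitivity (translate g 'X_(enum_rank (i, j))); first by rewrite !mxE.
rewrite translateX mxE.
by apply: eq_bigr => l _; rewrite !mxE mulrC mul_mpolyC.
Qed.

(* Up to a nonzero constant this is det(d/dX)^p F at X = 0 (Cayley's Omega process). *)
Definition omega (R : comNzRingType) p (F : {mpoly R[nvars]}) : R :=
  apolar (generic_det R ^+ p) F.

Lemma omega_translate (R : comNzRingType) p (g : 'M[R]_n) F :
  omega p (translate g F) = \det g ^+ p * omega p F.
Proof.
rewrite /omega -apolar_translate rmorphXn /= translate_det det_tr exprMn -rmorphXn /=.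
by rewrite mul_mpolyC apolarZl.
Qed.

Lemma map_generic_det (R S : comNzRingType) (f : {rmorphism R -> S}) :
  map_mpoly f (generic_det R) = generic_det S.
Proof.
rewrite /generic_det -det_map_mx; congr (\det _); apply/matrixP => i j.
by rewrite !mxE /= map_mpolyX.
Qed.

Lemma omega_map (R S : comNzRingType) (f : {rmorphism R -> S}) p F :
  omega p (map_mpoly f F) = f (omega p F).
Proof.
by rewrite /omega -apolar_map rmorphXn /= map_generic_det.
Qed.

Lemma generic_det_neq0 p : generic_det int ^+ p != 0.
Proof.
apply/eqP => /(congr1 (mx_eval idfun 1%:M)).
rewrite /mx_eval [RHS]raddf0 rmorphXn /=.
rewrite -det_map_mx (_ : map_mx _ _ = 1%:M) ?det1 ?expr1n //.
by apply/matrixP => i j; rewrite mxE [in LHS]mxE; exact: (mx_evalX idfun 1%:M).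
Qed.

(** The constant is the self-pairing of $\det^p$ over the integers, positive by [apolar_self_gt0],
    and base change carries it to [R]. *)
Lemma omega_det (R : comNzRingType) p : exists m : nat,
  omega p (generic_det R ^+ p) = m.+1%:R.
Proof.
have := apolar_self_gt0 (generic_det_neq0 p).
case E : (apolar _ _) => [[|m]|m] // _; exists m.
rewrite -(map_generic_det (intr : {rmorphism int -> R})) -rmorphXn omega_map.
by rewrite /omega E.
Qed.

Lemma omega_sum (R : comNzRingType) p (I : Type) (s : seq I) (P : pred I)
    (F : I -> {mpoly R[nvars]}) :
  omega p (\sum_(i <- s | P i) F i) = \sum_(i <- s | P i) omega p (F i).
Proof. exact: apolar_sumr. Qed.

Lemma omegaC (R : comNzRingType) p c (F : {mpoly R[nvars]}) :
  omega p (c%:MP * F) = c * omega p F.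
Proof. by rewrite mul_mpolyC /omega apolarZr. Qed.

(* Substituting t - X for X turns det X into a monic polynomial in t. *)
Lemma generic_det_regular (R : comNzRingType) (F : {mpoly R[nvars]}) :
  generic_det R * F = 0 -> F = 0.
Proof.
pose A := {poly {mpoly R[nvars]}}.
pose f : {rmorphism R -> A} := polyC \o @mpolyC _ R.
pose e := mx_eval f (char_poly_mx (generic_mx R)).
have eM p q : e (p * q) = e p * e q by exact: rmorphM.
have eD p q : e (p + q) = e p + e q by exact: rmorphD.
move=> /(congr1 e); rewrite eM [e 0]raddf0.
have -> : e (generic_det R) = char_poly (generic_mx R).
  rewrite /generic_det /e /mx_eval -det_map_mx; congr (\det _).
  apply/matrixP => i j; rewrite mxE [in LHS]mxE.
  exact: (mx_evalX f (char_poly_mx (generic_mx R))).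
move=> eF; have {}eF : e F = 0.
  by apply: (monic_lreg (char_poly_monic (generic_mx R))); rewrite eF mulr0.
(* Setting $t=0$ in $p(t-X)$ gives $p(-X)$; a second change of sign recovers $p$, so [e] is
   injective. *)
pose G p := mx_eval (@mpolyC nvars R) (- generic_mx R) (e p).[0].
suff GE : forall p, G p = p by rewrite -(GE F) /G eF horner0 /mx_eval raddf0.
apply: mpoly_ring_ind => [c|t|p q|p q]; rewrite /G.
- by rewrite /e /mx_eval mmapC hornerC mmapC.
- rewrite -[t]enum_valK; case: (enum_val t) => i j.
  have -> : e 'X_(enum_rank (i, j)) = char_poly_mx (generic_mx R) i j.
    exact: (mx_evalX f).
  have -> : (char_poly_mx (generic_mx R) i j).[0] = - generic_mx R i j.
    by rewrite !mxE hornerD hornerN hornerC hornerMn hornerX mul0rn sub0r.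
  rewrite mxE /mx_eval; apply: etrans (raddfN _ _) _.
  apply: (canLR (@opprK _)); rewrite -[- 'X__]/(- 'X_(enum_rank (i, j))).
  have := mx_evalX (@mpolyC nvars R) (- generic_mx R) i j.
  by rewrite /mx_eval !mxE.
- by move=> hp hq; rewrite -[in RHS]hp -[in RHS]hq eD hornerD; exact: rmorphD.
- by move=> hp hq; rewrite -[in RHS]hp -[in RHS]hq eM hornerM; exact: rmorphM.
Qed.
End GenericMatrix.

(** * Averaging over the general linear group *)

Section GenericGroup.
Variables (k : fieldType) (n : nat).
Implicit Types S T L : comAlgType k.

Definition mg_alg S : k -> {mpoly S[nvars n]} := @mpolyC _ S \o in_alg S.
HB.instance Definition _ S := GRing.RMorphism.on (@mg_alg S).
Definition mgalg S : comAlgType k := algify (@mg_alg S).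

Lemma mgalg_const S : exists c : {lrmorphism S -> mgalg S}, c =1 @mpolyC (nvars n) S.
Proof.
apply: mk_lrmorphism; first exact: (rmorphB (@mpolyC _ S)).
  by split; [exact: (rmorph1 (@mpolyC _ S)) | exact: (rmorphM (@mpolyC _ S))].
move=> c x; rewrite algify_scaleE -mulr_algl.
exact: (rmorphM (@mpolyC _ S)).
Qed.

Definition mg_const S : {lrmorphism S -> mgalg S} := sval (cid (mgalg_const S)).
Lemma mg_constE S x : mg_const S x = x%:MP.
Proof. exact: (svalP (cid (mgalg_const S))). Qed.

Definition mg_mx S : 'M[mgalg S]_n := generic_mx n S.

Lemma mgalg_eval S T (f : {lrmorphism S -> T}) (M : 'M[T]_n) :
  exists e : {lrmorphism mgalg S -> T}, e =1 mx_eval f M.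
Proof.
apply: mk_lrmorphism; rewrite /mx_eval.
- exact: (rmorphB (mmap f (mx_var M))).
- split; first exact: (rmorph1 (mmap f (mx_var M))).
  exact: (rmorphM (mmap f (mx_var M))).
- move=> c x; rewrite algify_scaleE.
  apply: etrans (rmorphM (mmap f (mx_var M)) (mg_alg S c) x) _.
  rewrite -[RHS]mulr_algl; congr (_ * _); rewrite /mg_alg /= mmapC; exact: lrA.
Qed.

Definition mg_eval S T (f : {lrmorphism S -> T}) M : {lrmorphism mgalg S -> T} :=
  sval (cid (mgalg_eval f M)).
Lemma mg_evalE S T (f : {lrmorphism S -> T}) M F : mg_eval f M F = mx_eval f M F.
Proof. exact: (svalP (cid (mgalg_eval f M))). Qed.

Lemma mg_eval_const S T (f : {lrmorphism S -> T}) M x : mg_eval f M (mg_const S x) = f x.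
Proof. by rewrite mg_evalE mg_constE /mx_eval mmapC. Qed.

Lemma mg_eval_mx S T (f : {lrmorphism S -> T}) M : map_mx (mg_eval f M) (mg_mx S) = M.
Proof.
apply/matrixP => i j; rewrite !mxE mg_evalE.
exact: (mx_evalX f M).
Qed.

Lemma mg_eval_det S T (f : {lrmorphism S -> T}) M :
  mg_eval f M (\det (mg_mx S)) = \det M.
Proof. by rewrite -det_map_mx mg_eval_mx. Qed.

Lemma mg_ext S T (phi psi : {lrmorphism mgalg S -> T}) :
  (forall c, phi (mg_const S c) = psi (mg_const S c)) ->
  map_mx phi (mg_mx S) = map_mx psi (mg_mx S) -> phi =1 psi.
Proof.
move=> ec eX; apply: mpoly_ring_ind => [c|t|p q hp hq|p q hp hq].
- by rewrite -mg_constE.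
- rewrite -[t]enum_valK; case: (enum_val t) => i j.
  by have := congr1 (fun M : 'M_n => M i j) eX; rewrite !mxE.
- by rewrite (lrD phi) (lrD psi) hp hq.
- by rewrite (lrM phi) (lrM psi) hp hq.
Qed.

Lemma mg_evalP S T (phi : {lrmorphism mgalg S -> T}) :
  phi =1 mg_eval (phi \o mg_const S) (map_mx phi (mg_mx S)).
Proof. by apply: mg_ext => [c|]; rewrite ?mg_eval_const ?mg_eval_mx. Qed.

(* An identity over the generic point of GL_n extends to matrices, as the
   generic determinant is not a zero divisor. *)
Lemma mg_eq0 S (F : mgalg S) :
  (forall T (f : {lrmorphism S -> T}) (g h : 'M[T]_n), g *m h = 1%:M ->
     mg_eval f g F = 0) -> F = 0.
Proof.
move=> h; have [e] : exists e, \det (mg_mx S) ^+ e * F = 0.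
  apply: eq0_at => T phi ud; rewrite mg_evalP.
  apply: (h _ _ _ (uinv (phi (\det (mg_mx S))) *: \adj (map_mx phi (mg_mx S)))).
  by rewrite -scalemxAr mul_mx_adj det_map_mx scale_scalar_mx mulrC mulr_uinv.
elim: e => [|e IH]; rewrite ?expr0 ?mul1r // exprS -mulrA.
by move=> /(@generic_det_regular n S) /IH.
Qed.

Lemma mg_map S T (f : {lrmorphism S -> T}) :
  exists phi : {lrmorphism mgalg S -> mgalg T}, phi =1 map_mpoly f.
Proof.
exists (mg_eval (mg_const T \o f) (mg_mx T)) => F; rewrite mg_evalE /mx_eval /map_mpoly.
apply: eq_bigr => m _; congr (_ * _); first by rewrite /= mg_constE.
apply: eq_bigr => t _; rewrite /mx_var mxE -surjective_pairing enum_valK //.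
Qed.

Lemma mg_translate S (g : 'M[S]_n) :
  exists phi : {lrmorphism mgalg S -> mgalg S}, phi =1 translate g.
Proof.
set phi := mg_eval (mg_const S) (mg_mx S *m map_mx (mg_const S) g).
exists phi; apply: mpoly_ring_ind => [c|t|p q hp hq|p q hp hq].
- by rewrite translateC -mg_constE mg_eval_const.
- rewrite -[t]enum_valK; case: (enum_val t) => i j; rewrite translateX.
  have := congr1 (fun M : 'M_n => M i j)
    (mg_eval_mx (mg_const S) (mg_mx S *m map_mx (mg_const S) g)).
  rewrite mxE [in LHS]mxE => ->; rewrite mxE; apply: eq_bigr => l _.
  by rewrite !mxE mg_constE mulrC mul_mpolyC.
- by rewrite (lrD phi) hp hq translateD.
- by rewrite (lrM phi) hp hq translateM.
Qed.

End GenericGroup.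

(** * Semi-invariants as polynomials, and their averages *)

Section Coordinate_ring.
Variables (k : fieldType) (n r : nat).
Implicit Types S T L : comAlgType k.
Local Notation W := (W k n r).

Definition Wring : comAlgType k := {mpoly k[#|coord n r|]}.
Definition Wgeneric : W Wring := tuple_of (fun c => 'X_(enum_rank c)).

Lemma Wring_point S (w : W S) : exists f : {lrmorphism Wring -> S}, pmap W f Wgeneric = w.
Proof.
pose h (t : 'I_#|coord n r|) := wcoord w (enum_val t).
have [||| f fE] := @mk_lrmorphism _ Wring S (mmap (in_alg S) h).
- exact: rmorphB.
- by split; [exact: rmorph1 | exact: rmorphM].
- by move=> c x; rewrite mmapZ /= mulr_algl.
exists f; apply: wcoord_ext => c; rewrite wcoord_map wcoordK fE mmapX mmap1U /h.
by rewrite enum_rankK.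
Qed.

Definition at_point S (w : W S) : {lrmorphism Wring -> S} := sval (cid (Wring_point w)).

Lemma at_pointP S (w : W S) : pmap W (at_point w) Wgeneric = w.
Proof. exact: svalP (cid (Wring_point w)). Qed.

Lemma at_point_eq S (w : W S) (f : {lrmorphism Wring -> S}) :
  pmap W f Wgeneric = w -> f =1 at_point w.
Proof.
rewrite -{1}(at_pointP w) => e; apply: (@mpoly_ring_ind _ k) => [c|t|p q hp hq|p q hp hq].
- by rewrite -alg_mpolyC (lrA f) (lrA (at_point w)).
- have := congr1 (fun w => wcoord w (enum_val t)) e.
  by rewrite !wcoord_map wcoordK enum_valK.
- by rewrite (lrD f) (lrD (at_point w)) hp hq.
- by rewrite (lrM f) (lrM (at_point w)) hp hq.
Qed.

Lemma at_point_map S T (f : {lrmorphism S -> T}) (w : W S) a :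
  f (at_point w a) = at_point (pmap W f w) a.
Proof.
apply: (at_point_eq (f := f \o at_point w)).
by rewrite pmap_comp at_pointP.
Qed.

Definition poly_mor (a : Wring) : morphism W (A1 k) :=
  @Morphism k W (A1 k) (fun S w => at_point w a)
    (fun S T f w => esym (at_point_map f w a)).

Lemma mor_at_point (s : morphism W (A1 k)) S (w : W S) :
  s S w = at_point w (s _ Wgeneric).
Proof. by rewrite -{1}(at_pointP w) mor_nat. Qed.

(** As a function of $g$, the value $a(g\cdot w)$ is a polynomial in the entries of $g$ and
    $g^{-1}$; [F] is what remains after clearing the powers of $\det g$. *)
Lemma translate_poly (a : Wring) : exists e (F : mgalg n Wring),
  forall S (w : W S) (g h : 'M[S]_n), g *m h = 1%:M ->
    mg_eval (at_point w) g F = \det g ^+ e * at_point (act g h w) a.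
Proof.
have [|R [l loc]] := @localization_exists _ _ (\det (mg_mx n Wring)).
  move=> e de; have /eqP : (1 : {mpoly Wring[nvars n]}) = 0.
    elim: e de => [//|e IH]; rewrite exprS.
    by move=> /(@generic_det_regular n Wring) /IH.
  by rewrite oner_eq0.
have [ul lsurj _] := loc.
pose X := map_mx l (mg_mx n Wring); pose Y := uinv (\det X) *: \adj X.
have XY : X *m Y = 1%:M.
  by rewrite -scalemxAr mul_mx_adj scale_scalar_mx mulrC mulr_uinv // det_map_mx.
pose c : {lrmorphism Wring -> R} := l \o mg_const n Wring.
have [F [e lF]] := lsurj (at_point (act X Y (pmap W c Wgeneric)) a).
exists e, F => S w g h gh.
have [|E EE] := localization_factor (f := mg_eval (at_point w) g) loc.
  by rewrite mg_eval_det; exact: detg_unit gh.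
rewrite -EE /= -lF lrM lrX at_point_map mulrC; congr (_ ^+ e * at_point _ a).
  by rewrite [E _]EE mg_eval_det.
have EX : map_mx E X = g by rewrite -map_mx_comp (eq_map_mx _ EE) mg_eval_mx.
have EY : map_mx E Y = h.
  have := congr1 (map_mx E) XY; rewrite map_mxM EX map_mx1 => gY.
  by rewrite -[LHS]mul1mx -(mulmx1C gh) -mulmxA gY mulmx1.
rewrite act_map EX EY; congr (act g h _).
rewrite -pmap_comp -[RHS](at_pointP w); congr (pmap W _ _).
by apply: lrmorphism_ext => x /=; rewrite [E _]EE mg_eval_const.
Qed.

(** With $F(X,w)=\det(X)^e a(X\cdot w)$ one has $F(Xg,w)=\det(g)^e F(X,g\cdot w)$. Applying the
    Omega process in $X$ to both sides gives $\det(g)^p\,\Omega F(w)=\det(g)^e\,\Omega F(g\cdot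
    w)$. *)
Lemma omega_semi_invariant (a : Wring) e p (F : mgalg n Wring) : (e <= p)%N ->
  (forall S (w : W S) (g h : 'M[S]_n), g *m h = 1%:M ->
    mg_eval (at_point w) g F = \det g ^+ e * at_point (act g h w) a) ->
  semi_invariant (p - e) (poly_mor (omega p F)).
Proof.
move=> ep FP S g h w gh.
have [phi phiE] := mg_map n (at_point w).
have [phi' phiE'] := mg_map n (at_point (act g h w)).
have [tau tauE] := mg_translate g.
have key : tau (phi F) = mg_const n S (\det g ^+ e) * phi' F.
  apply/eqP; rewrite -subr_eq0; apply/eqP/mg_eq0 => T f g1 h1 gh1.
  have comp (v : W S) (psi : {lrmorphism mgalg n Wring -> mgalg n S}) (M : 'M[T]_n) :
      psi =1 map_mpoly (at_point v) ->
      mg_eval f M (psi F) = mg_eval (at_point (pmap W f v)) M F.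
    move=> psiE; have := @mg_ext _ _ _ _ (mg_eval f M \o psi) (mg_eval (at_point (pmap W f v)) M).
    apply=> [x|] /=.
      have e1 : psi (mg_const n _ x) = mg_const n _ (at_point v x).
        by rewrite psiE !mg_constE; exact: map_mpolyC.
      by rewrite e1 !mg_eval_const at_point_map.
    rewrite map_mx_comp mg_eval_mx (_ : map_mx psi _ = mg_mx n S) ?mg_eval_mx //.
    by apply/matrixP => i j; rewrite !mxE psiE map_mpolyX.
  have ctau G : mg_eval f g1 (tau G) = mg_eval f (g1 *m map_mx f g) G.
    have := @mg_ext _ _ _ _ (mg_eval f g1 \o tau) (mg_eval f (g1 *m map_mx f g)).
    apply=> [x|] /=.
      have e1 : tau (mg_const n _ x) = mg_const n _ x by rewrite tauE mg_constE translateC.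
      by rewrite e1 !mg_eval_const.
    rewrite mg_eval_mx map_mx_comp.
    have -> : map_mx tau (mg_mx n S) = mg_mx n S *m map_mx (mg_const n S) g.
      apply/matrixP => i j; rewrite !mxE tauE translateX; apply: eq_bigr => l _.
      by rewrite !mxE mg_constE mulrC mul_mpolyC.
    rewrite (map_mxM (mg_eval f g1)) mg_eval_mx; congr (_ *m _); apply/matrixP => i j.
    by rewrite !mxE; exact: mg_eval_const.
  have fgh : map_mx f g *m map_mx f h = 1%:M by rewrite -map_mxM gh map_mx1.
  have ghgh : (g1 *m map_mx f g) *m (map_mx f h *m h1) = 1%:M.
    by rewrite -mulmxA (mulmxA (map_mx f g)) fgh mul1mx.
  rewrite lrB lrM ctau (comp w) // (comp (act g h w)) // mg_eval_const.
  rewrite (FP _ _ _ _ ghgh) (FP _ _ _ _ gh1) det_mulmx exprMn lrX -det_map_mx.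
  by rewrite act_map act_comp mulrCA mulrA subrr.
have := congr1 (@omega n S p) key.
rewrite tauE omega_translate mg_constE omegaC phiE phiE' !omega_map /= => H.
apply: (unitI (is_unitX e (detg_unit gh))).
by rewrite mulrA -exprD subnKC // H.
Qed.

Hypothesis char0 : forall m, m.+1%:R != 0 :> k.

(* Reynolds' argument: a power of s lies in the ideal of the brackets, and
   applying the Omega process makes the coefficients semi-invariant. *)
Lemma semi_invariant_brackets (s : morphism W (A1 k)) d : (0 < d)%N ->
  semi_invariant d s -> exists M c m (X : 'I_m -> 'I_n -> seq 'I_3 * 'I_r)
    (t : 'I_m -> morphism W (A1 k)),
  [/\ (0 < M)%N, forall i, semi_invariant (d * M - 1) (t i) &
    forall S (w : W S), c.+1%:R * s S w ^+ M = \sum_i t i S w * bracket (X i) w].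
Proof.
move=> d0 sd; pose as_ := s Wring Wgeneric.
have [M0 [m [a0 [b [bX E0]]]]] : exists e,
    idealspan (fun b => exists X, b = bracket X Wgeneric) (as_ ^+ e * 1).
  apply: mem_radical => T f us fX.
  have : generating (pmap W f Wgeneric).
    by apply: (semi_invariant_generating char0 d0 sd); rewrite mor_nat.
  move=> /generatingP [m [a [b [aX]]]]; rewrite big1 => [/eqP|i _]; first by rewrite eq_sym oner_eq0.
  by have [X ->] := aX i; rewrite bracket_map fX ?mulr0 //; exists X.
have /choice [X XP] := bX.
(* One more factor $s$ makes the exponent positive. *)
pose a i := as_ * a0 i; pose M := M0.+1.
have EM S (w : W S) : s S w ^+ M = \sum_i at_point w (a i) * bracket (X i) w.
  rewrite mor_at_point -lrX exprS -[as_ ^+ _]mulr1 E0 mulr_sumr lr_sum.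
  apply: eq_bigr => i _; rewrite XP /a /GRing.scale /= mulrA lrM; congr (_ * _).
  by rewrite -bracket_map at_pointP.
have /choice [eF eFP] : forall i, exists eF : nat * mgalg n Wring,
    forall S (w : W S) (g h : 'M[S]_n), g *m h = 1%:M ->
    mg_eval (at_point w) g eF.2 = \det g ^+ eF.1 * at_point (act g h w) (a i).
  by move=> i; have [e [F FP]] := translate_poly (a i); exists (e, F).
pose e := (\max_i (eF i).1)%N.
pose D : mgalg n Wring := \det (mg_mx n Wring).
pose F i := (eF i).2 * D ^+ (e.+1 - (eF i).1).
have ele i : ((eF i).1 <= e.+1)%N by apply/leqW/(leq_bigmax i).
have FP i S (w : W S) (g h : 'M[S]_n) : g *m h = 1%:M ->
    mg_eval (at_point w) g (F i) = \det g ^+ e.+1 * at_point (act g h w) (a i).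
  move=> gh; rewrite lrM lrX mg_eval_det (eFP _ _ _ _ _ gh) mulrAC -exprD.
  by rewrite subnKC.
(* The coefficients then have weight $p-(e+1)=dM-1$, complementary to the weight 1 of a bracket.
   Evaluating the relation for $s^M$ at $g\cdot w$ and multiplying by $\det(g)^e$ gives the identity
   [key], to which the Omega process is applied. *)
pose p := (e + d * M)%N.
have dM : (0 < d * M)%N by rewrite muln_gt0 d0.
have [c cP] := omega_det n Wring p.
exists M, c, m, X, (fun i => poly_mor (omega p (F i))); split=> // [i|S w].
  have -> : (d * M - 1 = p - e.+1)%N by rewrite /p -[e.+1]addn1 subnDl.
  apply: omega_semi_invariant (FP i).
  by rewrite /p -[e.+1]addn1 leq_add2l.
have key : D ^+ p * mg_const n _ (as_ ^+ M) =
    \sum_i F i * mg_const n _ (bracket (X i) Wgeneric).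
  apply/eqP; rewrite -subr_eq0; apply/eqP/mg_eq0 => T f g h gh.
  pose v := pmap W f Wgeneric.
  have fE F' : mg_eval f g F' = mg_eval (at_point v) g F'.
    apply: mg_ext => [x|]; last by rewrite !mg_eval_mx.
    by rewrite !mg_eval_const; apply: at_point_eq.
  have fE' x : f x = at_point v x by apply: at_point_eq.
  rewrite lrB lr_sum lrM lrX !mg_eval_const mg_eval_det.
  under eq_bigr => i _ do rewrite lrM mg_eval_const fE (FP _ _ _ _ _ gh) -bracket_map.
  rewrite lrX fE' -mor_at_point /p exprD exprM -mulrA -exprMn -(sd _ _ _ _ gh) EM.
  rewrite mulr_sumr.
  apply/eqP; rewrite subr_eq0; apply/eqP/eq_bigr => i _.
  by rewrite (bracket_act _ _ gh) exprSr -!mulrA; congr (_ * _); rewrite mulrCA.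
have := congr1 (at_point w \o @omega n Wring p) key.
rewrite /= mg_constE [_ * _%:MP]mulrC omegaC -[D]/(generic_det n Wring) cP.
rewrite lrM lrX -mor_at_point mulrC => H.
have -> : c.+1%:R = at_point w c.+1%:R by rewrite (rmorph_nat (at_point w)).
rewrite H [omega _ _]omega_sum lr_sum; apply: eq_bigr => i _.
by rewrite mg_constE mulrC omegaC lrM mulrC -bracket_map at_pointP.
Qed.

End Coordinate_ring.

(** * The quotient morphism is surjective *)

Lemma adj_mul_regular (R : comNzRingType) n (g g' X : 'M[R]_n) : g *m g' = 1%:M ->
  (forall a, \det X * a = 0 -> a = 0) -> \adj (g *m X) = \det g *: (\adj X *m g').
Proof.
move=> gg' reg; apply/eqP; rewrite -subr_eq0; set D := _ - _.
have DgX : D *m (g *m X) = 0.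
  rewrite mulmxBl mul_adj_mx det_mulmx -scalemxAl -mulmxA (mulmxA g').
  by rewrite (mulmx1C gg') mul1mx mul_adj_mx scale_scalar_mx subrr.
have detD : \det (g *m X) *: D = 0.
  by rewrite -mul_mx_scalar -mul_mx_adj mulmxA DgX mul0mx.
apply/eqP/matrixP => i j; rewrite [RHS]mxE; apply: reg.
have : \det g' * (\det (g *m X) * D i j) = 0.
  by have := congr1 (fun M : 'M_n => M i j) detD; rewrite mxE [RHS]mxE => ->; rewrite mulr0.
by rewrite det_mulmx !mulrA -det_mulmx (mulmx1C gg') det1 mul1r.
Qed.

(** The direct computation cancels a determinant. It is carried out for the generic matrix, whose
    determinant is regular, and then specialized to [F], whose determinant may be a zero divisor. *)
Lemma adj_mul_unit (k : fieldType) n (S : comAlgType k) (g g' F : 'M[S]_n) :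
  g *m g' = 1%:M -> \adj (g *m F) = \det g *: (\adj F *m g').
Proof.
move=> gg'; pose c := mg_const n S; pose X := mg_mx n S.
pose e := mg_eval (idfun : {lrmorphism S -> S}) F.
have cgg : map_mx c g *m map_mx c g' = 1%:M by rewrite -map_mxM gg' map_mx1.
have Ec (M : 'M[S]_n) : map_mx e (map_mx c M) = M.
  by apply/matrixP => p q; rewrite !mxE mg_eval_const.
have eX : map_mx e X = F by exact: mg_eval_mx.
have E := adj_mul_regular (X := X) cgg (@generic_det_regular n S).
have {E} := congr1 (map_mx e) E.
rewrite (map_mx_adj e).
rewrite (map_mxM e).
rewrite (map_mxZ e).
rewrite (map_mxM e).
rewrite (map_mx_adj e).
rewrite eX !Ec => ->.
by congr (_ *: _); rewrite -det_map_mx Ec.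
Qed.

Section Surjectivity.
Variables (k : fieldType) (n r : nat) (Q : functor k) (pi : morphism (U k n r) Q).
Hypothesis char0 : forall m, m.+1%:R != 0 :> k.
Hypothesis git : GIT_quotient pi.
Implicit Types S T L : comAlgType k.
Local Notation W := (W k n r).
Local Notation U := (U k n r).

Let pi_inv : forall S (g h : 'M[S]_n) (w w' : U S), g *m h = 1%:M ->
  sval w' = act g h (sval w) -> pi S w' = pi S w.
Proof. by case: git. Qed.

Lemma normalize_point X S (w w' : U S) : is_unit (bracket X (sval w)) ->
  sval w' = normalize X (sval w) -> pi S w' = pi S w.
Proof. by move=> uw e; apply: (pi_inv (mulmx1C (mul_frame_inv uw))). Qed.

Section Fixed.
Variables (d : nat) (s : morphism W (A1 k)) (B : comAlgType k) (j : morphism (Spec B) Q).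
Hypotheses (d0 : (0 < d)%N) (sd : semi_invariant d s) (chart : GIT_chart pi s j).

(** The element represents the invariant function $h/s^M$, with the denominator multiplied out. *)
Lemma quotient_fun e M (h : forall S, W S -> S) : (e = d * M)%N ->
  (forall S T (f : {lrmorphism S -> T}) (w : W S), h T (pmap W f w) = f (h S w)) ->
  (forall S (g g' : 'M[S]_n) (w : W S), g *m g' = 1%:M ->
     h S (act g g' w) = \det g ^+ e * h S w) ->
  exists b : B, forall S (w : U S) x, j S x = pi S w ->
    x b * s S (sval w) ^+ M = h S (sval w).
Proof.
move=> eM hn hi.
have UM S (a : S) : is_unit a -> a ^+ M * uinv a ^+ M = 1.
  by move=> ua; rewrite -exprMn mulr_uinv // expr1n.
have [||b [hb _]] := chart_fun chart
  (h := fun S w => h S (sval w) * uinv (s S (sval w)) ^+ M).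
- move=> S T f w uw; rewrite lrM lrX uinv_map //; congr (_ * uinv _ ^+ M).
    exact: hn.
  exact: (mor_nat s).
- move=> S g g' w w' gg' uw ->; rewrite hi // (sd _ gg').
  have ug := is_unitX d (detg_unit gg').
  have -> : uinv (\det g ^+ d * s S (sval w)) =
      uinv (\det g ^+ d) * uinv (s S (sval w)).
    by apply: uinv_eq; rewrite mulrACA !mulr_uinv ?mulr1.
  by rewrite exprMn mulrACA eM exprM UM // mul1r.
exists b => S w x jx; rewrite -(hb _ _ _ jx) -mulrA [uinv _ ^+ M * _]mulrC UM ?mulr1 //.
exact: chart_unit jx.
Qed.

(** Since semi-invariants vanish off [U], the generic tuple over the localization at [s] is a point
    of [U], through which all of [U_ s] factors. If [s] were nilpotent, [U_ s] would have no points
    and [chart_sep] would give $1=0$ in [B]. *)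
Lemma chart_generic : exists (R : comAlgType k) (l : {lrmorphism Wring k n r -> R}) (u : U R),
  [/\ is_localization (s _ (Wgeneric k n r)) l, sval u = pmap W l (Wgeneric k n r) &
      is_unit (s R (sval u))].
Proof.
have [|R [l loc]] := @localization_exists _ _ (s _ (Wgeneric k n r)).
  move=> e se; have : (1 : B) = 0; last by move/eqP; rewrite oner_eq0.
  apply: (chart_sep pi_inv chart) => S w x /(chart_unit chart) us.
  have := is_unitX e us; rewrite mor_at_point -lrX se lr0 => u0.
  by case: (is_unit0 u0).
have us : is_unit (s R (pmap W l (Wgeneric k n r))) by rewrite mor_nat; case: loc.
by exists R, l, (exist _ _ (semi_invariant_generating char0 d0 sd us)).
Qed.

(** Extends [chart_sep] to $B_b$. At the generic tuple the numerator of [a] is killed by a power of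
    [b]; as every point of [U_ s] is a specialization of that tuple, the same product vanishes in
    [B]. *)
Lemma localized_sep (b : B) (C : comAlgType k) (l : {lrmorphism B -> C}) (a : C) : is_localization b l ->
  (forall S (phi : {lrmorphism C -> S}) (w : U S), j S (phi \o l) = pi S w -> phi a = 0) ->
  a = 0.
Proof.
move=> loc h; have [ul lsurj lker] := loc; have [alpha [e ea]] := lsurj a.
have [R [lR [u [locR uE us]]]] := chart_generic.
have [y jy] := chart_point chart us.
have [e' He'] : exists e', y b ^+ e' * y alpha = 0.
  apply: eq0_at => T phi uphi.
  have [E EE] := localization_factor (f := phi \o y) loc uphi.
  have jE : j T (E \o l) = pi T (pmap U phi u).
    rewrite (mor_nat pi) -jy -(mor_nat j); congr (j T _); exact: lrmorphism_ext.
  by rewrite -[LHS]EE /= -ea lrM (h _ _ _ jE) mul0r.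
have : l (b ^+ e' * alpha) = 0.
  have -> : b ^+ e' * alpha = 0; last exact: lr0.
  apply: (chart_sep pi_inv chart) => S w x jx; rewrite (lr0 x).
  have uw := chart_unit chart jx.
  have [|E EE] := localization_factor (f := at_point (sval w)) locR.
    by rewrite -mor_at_point.
  have wE : pmap U E u = w.
    apply: U_ext; apply: etrans (congr1 (pmap W E) uE) _.
    rewrite -(pmap_comp (f0 := W)) -[RHS]at_pointP; congr (pmap W _ _).
    exact: lrmorphism_ext.
  have -> : x = E \o y.
    apply: (chart_inj chart); rewrite jx (mor_nat j E y) jy -mor_nat wE //.
  by rewrite /= lrM lrX He' lr0.
rewrite lrM lrX => /(unitX0 ul) la; apply: (unitX0 (d := e) ul).
by rewrite mulrC ea.
Qed.

(** The functions $b_i=t_i\,[X_i]/s^M$, where $[X_i]$ is the bracket, add up to $c+1$, so one of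
    them is nonzero at [x]. Over $B_{b_i}$ the bracket is invertible, and the normalized tuple has
    coordinates there. This gives a section of [pi] over the open set $b_i\ne0$, which is evaluated
    at [x]. *)
Lemma chart_surjective K (x : Spec B K) : is_field K ->
  exists w : U K, pi K w = j K x.
Proof.
move=> Kf.
have [M [c [m [X [t [M0 td tE]]]]]] := semi_invariant_brackets char0 d0 sd.
have dM : (0 < d * M)%N by rewrite muln_gt0 d0.
have coef i : exists b : B, forall S (w : U S) x, j S x = pi S w ->
    x b * s S (sval w) ^+ M = t i S (sval w) * bracket (X i) (sval w).
  apply: (@quotient_fun (d * M) M (fun S w => t i S w * bracket (X i) w)) => //.
    by move=> S T f w; rewrite bracket_map mor_nat lrM.
  move=> S g g' w gg'; rewrite (td i _ _ _ _ gg') (bracket_act _ _ gg').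
  by rewrite mulrACA -exprSr subn1 prednK.
have /choice [b bP] := coef.
have sumb : \sum_i b i = c.+1%:R.
  apply: (chart_sep pi_inv chart) => S w y jy.
  have us := is_unitX M (chart_unit chart jy).
  apply: (unitI us); rewrite (rmorph_nat y) [RHS]mulrC tE lr_sum mulr_sumr.
  by apply: eq_bigr => i _; rewrite mulrC (bP _ _ _ _ jy).
have [i xi] : exists i, x (b i) <> 0.
  apply: contrapT => /forallNP x0; have /eqP : x c.+1%:R = 0.
    by rewrite -sumb lr_sum big1 // => i _; apply: contrapT.
  by rewrite (rmorph_nat x) (negPf (char0_alg char0 _ _)).
have {}xi := Kf _ xi; set Y := X i in bP.
have [C [l loc]] : exists (C : comAlgType k) (l : {lrmorphism B -> C}),
    is_localization (b i) l.
  apply: localization_exists => e be; have := is_unitX e xi.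
  by rewrite -lrX be lr0; exact: is_unit0.
have [ul _ _] := loc.
(* Using the adjugate in place of the inverse multiplies the normalized coordinates by the bracket;
   the factor $t_i$ completes the weight to $dM$. Dividing by $b_i$ recovers the coordinates
   themselves. *)
have coordB cc : exists b' : B, forall S (w : U S) x, j S x = pi S w ->
    x b' * s S (sval w) ^+ M =
    wcoord (act (\adj (frame Y (sval w))) (frame Y (sval w)) (sval w)) cc * t i S (sval w).
  apply: (@quotient_fun (d * M) M
    (fun S w => wcoord (act (\adj (frame Y w)) (frame Y w) w) cc * t i S w)) => //.
    move=> S T f w; rewrite lrM (mor_nat (t i)); congr (_ * _).
    by rewrite -wcoord_map act_map map_mx_adj frame_map.
  move=> S g g' w gg'; rewrite (td i _ _ _ _ gg').
  have -> : act (\adj (frame Y (act g g' w))) (frame Y (act g g' w)) (act g g' w) =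
      act (\det g *: \adj (frame Y w)) (frame Y w) w.
    rewrite frame_act // (adj_mul_unit _ gg') act_comp -scalemxAl.
    by rewrite -mulmxA (mulmx1C gg') mulmx1 mulmxA (mulmx1C gg') mul1mx.
  have -> : wcoord (act (\det g *: \adj (frame Y w)) (frame Y w) w) cc =
      \det g * wcoord (act (\adj (frame Y w)) (frame Y w) w) cc.
    by case: cc => [[[cc p] q]|[p q]] /=; rewrite ?mat_act /= -!scalemxAl mxE.
  by rewrite mulrACA -exprS subn1 prednK.
have /choice [bc bcP] := coordB.
pose w0 : W C := tuple_of (fun cc => l (bc cc) * uinv (l (b i))).
have w0P S (phi : {lrmorphism C -> S}) (w : U S) : j S (phi \o l) = pi S w ->
    is_unit (bracket Y (sval w)) /\ pmap W phi w0 = normalize Y (sval w).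
  move=> jphi; have us := chart_unit chart jphi.
  have ub : is_unit (phi (l (b i))) by exact: is_unit_map.
  have E := bP i _ _ _ jphi; have utb := is_unitM ub (is_unitX M us).
  rewrite E in utb; have uY := is_unitMr utb; have ut := is_unitMl utb.
  split=> //; apply: wcoord_ext => cc; rewrite wcoord_map wcoordK.
  have sc : wcoord (act (\adj (frame Y (sval w))) (frame Y (sval w)) (sval w)) cc =
      bracket Y (sval w) * wcoord (normalize Y (sval w)) cc.
    have -> : \adj (frame Y (sval w)) = bracket Y (sval w) *: frame_inv Y (sval w).
      by rewrite scalerA mulr_uinv // scale1r.
    by case: cc => [[[cc p] q]|[p q]] /=; rewrite ?mat_act /= -!scalemxAl mxE.
  have Ec := bcP cc _ _ _ jphi; rewrite sc in Ec.
  apply: (unitI utb); rewrite lrM uinv_map // -{1}E.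
  rewrite [phi (l (b i)) * _]mulrC mulrACA [phi (l (b i)) * uinv _]mulr_uinv // mulr1.
  by rewrite mulrC; apply: etrans Ec _; rewrite mulrAC [_ * t i S _]mulrC.
have sep a : (forall S (phi : {lrmorphism C -> S}) (w : U S), is_unit (bracket Y (sval w)) ->
    is_unit (s S (sval w)) -> j S (phi \o l) = pi S w ->
    pmap W phi w0 = normalize Y (sval w) -> phi a = 0) -> a = 0.
  move=> h; apply: (localized_sep loc) => S phi w jphi; have [uY ew] := w0P _ _ _ jphi.
  exact: h uY (chart_unit chart jphi) jphi ew.
have fr : frame Y w0 = 1%:M.
  apply/matrixP => p q; apply/eqP; rewrite -subr_eq0; apply/eqP/sep.
  move=> S phi w uY _ _ ew; rewrite lrB.
  have -> : phi (frame Y w0 p q) = frame Y (pmap W phi w0) p q by rewrite frame_map [RHS]mxE.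
  rewrite ew frame_normalize // !mxE.
  by case: eqP => _; rewrite ?mulr1n ?mulr0n ?lr1 ?lr0 subrr.
pose wC : U C := exist _ w0 (frame1_generating fr).
(* At a normalized tuple [s] takes the value of $s/[Y]^d$ at the original one, where $[Y]$ is the
   bracket, and $[Y]^d/s$ is an invariant function. *)
have us : is_unit (s C w0).
  have [|||bs bsP] := @quotient_fun d 1 (fun S w => bracket Y w ^+ d).
  - by rewrite muln1.
  - by move=> S T f w; rewrite bracket_map lrX.
  - by move=> S g g' w gg'; rewrite (bracket_act _ _ gg') exprMn.
  exists (l bs); apply/eqP; rewrite -subr_eq0; apply/eqP/sep.
  move=> S phi w uY uw jphi ew; rewrite lrB lrM lr1.
  have -> : phi (s C w0) = s S (pmap W phi w0) by rewrite mor_nat.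
  rewrite ew (sd _ (mulmx1C (mul_frame_inv uY))).
  rewrite -mulrA [s S _ * _]mulrC.
  have := bsP _ _ _ jphi; rewrite expr1 /= => ->.
  by rewrite -exprMn /bracket -det_mulmx (mulmx1C (mul_frame_inv uY)) det1 expr1n subrr.
have [psi jpsi] : exists psi, j C psi = pi C wC by exact: (chart_point chart).
have psiE : psi =1 l.
  move=> a; apply/eqP; rewrite -subr_eq0; apply/eqP/sep.
  move=> S phi w uY _ jphi ew; rewrite lrB; apply/eqP; rewrite subr_eq0; apply/eqP.
  have : j S (phi \o psi) = j S (phi \o l).
    rewrite (mor_nat j phi psi) jpsi -mor_nat jphi.
    exact: (normalize_point uY).
  by move=> /(chart_inj chart) /(congr1 (fun f : {lrmorphism B -> S} => f a)).
have [E EE] := localization_factor (f := x) loc xi.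
exists (pmap U E wC); rewrite mor_nat -jpsi -mor_nat; congr (j K _).
by apply: lrmorphism_ext => y /=; rewrite psiE -[RHS]EE.
Qed.

End Fixed.

Lemma field_point_lift K (q : Q K) : is_field K -> exists w : U K, pi K w = q.
Proof.
move=> Kf; case: (git) => _ _ _ /(_ K q Kf) [d [s [B [j [d0 sd chart [x <-]]]]]].
exact: (chart_surjective d0 sd chart).
Qed.

(** The quantification over [T] replaces the localization at [g], which does not exist if [g] is
    nilpotent. The condition on the frame singles out one lift in its orbit. *)
Definition lift_at S (q : Q S) (X : 'I_n -> seq 'I_3 * 'I_r) (g : S) : Prop :=
  forall T (f : {lrmorphism S -> T}), is_unit (f g) ->
    exists w : U T, pi T w = pmap Q f q /\ frame X (sval w) = 1%:M.

Lemma git_orbit S (w w' : U S) : pi S w = pi S w' ->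
  exists g h, g *m h = 1%:M /\ sval w' = act g h (sval w).
Proof. by case: (git) => _ _ charts _; exact: orbit. Qed.

(** Otherwise all such [g] vanish in some residue field. The point lifts there, with some bracket
    invertible, so it lies in the chart of this bracket. The elements defining the preimage of that
    open chart in [Spec S] are themselves such [g], and they cannot all vanish at a point of it. *)
Lemma lift_cover S (q : Q S) : unit_ideal (fun g => exists X, lift_at q X g).
Proof.
case: (git) => _ _ charts _; apply: contrapT => /residue_field [L [f [Lf fG]]].
have [w wq] := field_point_lift (pmap Q f q) Lf.
have /generatingP gw := svalP w.
have [X uX] : exists X, is_unit (bracket X (sval w)).
  apply: contrapT => /forallNP nX; case: gw => m [a [b [aX]]].
  rewrite big1 => [/eqP|i _]; first by rewrite eq_sym oner_eq0.
  have [X aE] := aX i; have -> : a i = 0; last by rewrite mulr0.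
  by apply: contrapT => /Lf; rewrite aE; exact: nX.
have [B [j chart]] := bracket_chart charts uX.
have [wB [fB wBP _]] := bracket_chart_slice pi_inv chart.
have [[_ jopen] _ _] := chart; have [I IP] := jopen S q.
have [_ [m [a [b [aI e1]]]]] : True /\ unit_ideal (fun b => exists2 a, I a & b = f a).
  by split=> //; apply/IP; rewrite -wq; have [x jx] := chart_point chart uX; exists x.
have /eqP := e1; rewrite big1 => [|i _]; first by rewrite eq_sym oner_eq0.
have [a' Ia ->] := aI i; rewrite fG ?mulr0 //; exists X => T h uh.
have /IP [x jx] : unit_ideal (fun b => exists2 a, I a & b = h a).
  have [c hc] := uh; exists 1%N, (fun=> h a'), (fun=> c); split=> [_|]; first by exists a'.
  by rewrite big_ord1 mulrC.
exists (pmap U x wB); split; first by rewrite -jx wBP.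
by rewrite [sval _]/(pmap W x (sval wB)) frame_map fB map_mx1.
Qed.

End Surjectivity.

(** * Free quotients of S[x,y,z]^r and commuting matrices *)

Section Evaluation.
Variables (k : fieldType) (n r : nat).
Implicit Types S T L : comAlgType k.
Local Notation W := (W k n r).
Local Notation U := (U k n r).
Local Notation free_mod := (@free_mod k r).

Definition commuting S (w : W S) : Prop :=
  forall c c', mat w c *m mat w c' = mat w c' *m mat w c.

Definition mnm_word (m : 'X_{1..3}) : seq 'I_3 := flatten [seq nseq (m c) c | c <- enum 'I_3].

Definition word_mnm (l : seq 'I_3) : 'X_{1..3} := [multinom count_mem c l | c < 3].

Lemma count_mnm_word m c : count_mem c (mnm_word m) = m c.
Proof.
rewrite count_flatten sumnE !big_map -/(index_enum _) (bigD1 c) //= big1 ?addn0.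
  by rewrite count_nseq /= eqxx mul1n.
by move=> c' /negPf ne; rewrite count_nseq /= ne mul0n.
Qed.

Lemma perm_count (s t : seq 'I_3) : (forall c, count_mem c s = count_mem c t) -> perm_eq s t.
Proof. by move=> h; apply/allP => x _; apply/eqP; exact: h. Qed.

Lemma mnm_wordS m c : perm_eq (mnm_word (U_(c) + m)%MM) (c :: mnm_word m).
Proof.
apply: perm_count => c'; rewrite -cat1s count_cat !count_mnm_word mnmDE mnm1E.
by rewrite /= addn0.
Qed.

Lemma word_mnmK l : perm_eq (mnm_word (word_mnm l)) l.
Proof. by apply: perm_count => x; rewrite count_mnm_word mnmE. Qed.

Lemma word_mx_perm S (w : W S) l l' : commuting w -> perm_eq l l' ->
  word_mx w l = word_mx w l'.
Proof.
move=> cw; have cons c l1 l2 : word_mx w (l1 ++ c :: l2) = mat w c *m word_mx w (l1 ++ l2).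
  by elim: l1 => //= c' l1 ->; rewrite !mulmxA cw.
elim: l l' => [|c l IH] l' pl.
  by move: pl; rewrite perm_sym => /perm_nilP ->.
have cl : c \in l' by rewrite -(perm_mem pl) mem_head.
case/splitPr: cl pl => l1 l2 pl; rewrite cons /= (IH (l1 ++ l2)) //.
by move: pl; rewrite -[c :: l2]cat1s perm_sym perm_catCA /= perm_cons perm_sym.
Qed.

(** Monomials are evaluated on sorted words, so [ev] is defined and [S]-linear for every tuple; for
    commuting tuples it is compatible with multiplication by the variables ([ev_mulX]). *)
Definition ev S (w : W S) (p : free_mod S) : 'cV[S]_n :=
  \sum_i \sum_(m <- msupp (p 0 i)) (p 0 i)@_m *: word_vec w (mnm_word m, i).

Lemma evE S (w : W S) (p : free_mod S) D : bounded D p ->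
  ev w p = \sum_i \sum_(m : 'X_{1..3 < D}) (p 0 i)@_m *: word_vec w (mnm_word m, i).
Proof.
move=> pD; apply: eq_bigr => i _.
rewrite (big_mksub 'X_{1..3 < D}) ?msupp_uniq //=; first last.
  by move=> x /msize_mdeg_lt /leq_trans; apply; exact: pD.
rewrite big_rmcond //= => m /memN_msupp_eq0 ->.
by rewrite scale0r.
Qed.

Lemma bounded3 S (p q s : free_mod S) : exists D, [/\ bounded D p, bounded D q & bounded D s].
Proof.
have [D1 h1] := boundedP p; have [D2 h2] := boundedP q; have [D3 h3] := boundedP s.
exists (maxn D1 (maxn D2 D3)).
by split; [apply: h1 | apply: h2 | apply: h3]; rewrite !leq_max leqnn ?orbT.
Qed.

Lemma evD S (w : W S) p q : ev w (p + q) = ev w p + ev w q.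
Proof.
have [D [h1 h2 h3]] := bounded3 (p + q) p q.
rewrite (evE w h1) (evE w h2) (evE w h3) -big_split; apply: eq_bigr => i _.
rewrite -big_split; apply: eq_bigr => m _.
by rewrite mxE mcoeffD scalerDl.
Qed.

Lemma evZ S (w : W S) c p : ev w (c%:MP *: p) = c *: ev w p.
Proof.
have [D [h1 h2 _]] := bounded3 (c%:MP *: p) p p.
rewrite (evE w h1) (evE w h2) scaler_sumr; apply: eq_bigr => i _.
rewrite scaler_sumr; apply: eq_bigr => m _.
by rewrite mxE mcoeffCM scalerA.
Qed.

Lemma ev0 S (w : W S) : ev w 0 = 0.
Proof. by have := evZ w 0 0; rewrite scaler0 scale0r. Qed.

Lemma ev_sum S (w : W S) (I : Type) (s : seq I) (P : pred I) (F : I -> free_mod S) :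
  ev w (\sum_(i <- s | P i) F i) = \sum_(i <- s | P i) ev w (F i).
Proof. by apply: (big_morph (ev w) (evD w)); exact: ev0. Qed.

Lemma evB S (w : W S) p q : ev w (p - q) = ev w p - ev w q.
Proof.
have -> : - q = (-1)%:MP *: q by rewrite mpolyCN scaleN1r.
by rewrite evD evZ scaleN1r.
Qed.

Lemma ev_mono S (w : W S) m i : ev w (mono S (i, m)) = word_vec w (mnm_word m, i).
Proof.
have E j : mono S (i, m) 0 j = 'X_[m] *+ (j == i) by rewrite /mono /= !mxE eqxx mulr_natr.
rewrite /ev (bigD1 i) //= [X in _ + X]big1 ?addr0 => [|j /negPf ne].
  by rewrite E eqxx msuppX big_seq1 mcoeffX eqxx scale1r.
by rewrite E ne msupp0 big_nil.
Qed.

Lemma ev_map S T (f : {lrmorphism S -> T}) (w : W S) p :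
  ev (pmap W f w) (free_mod_map f p) = map_mx f (ev w p).
Proof.
have [D h] := boundedP p; have [D' h'] := boundedP (free_mod_map f p).
rewrite (evE w (h _ (leq_maxl D D'))) (evE _ (h' _ (leq_maxr D D'))).
rewrite [RHS]raddf_sum; apply: eq_bigr => i _.
rewrite [RHS]raddf_sum; apply: eq_bigr => m _.
by rewrite mxE mcoeff_map_mpoly word_vec_map; apply/esym/map_mxZ.
Qed.

Lemma ev_act S (g h : 'M[S]_n) (w : W S) p : g *m h = 1%:M ->
  ev (act g h w) p = g *m ev w p.
Proof.
move=> gh; rewrite mulmx_sumr; apply: eq_bigr => i _.
rewrite mulmx_sumr; apply: eq_bigr => m _.
by rewrite word_vec_act // scalemxAr.
Qed.

Lemma free_mod_ind S (P : free_mod S -> Prop) : P 0 ->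
  (forall p q, P p -> P q -> P (p + q)) -> (forall c p, P p -> P (c%:MP *: p)) ->
  (forall b, P (mono S b)) -> forall p, P p.
Proof.
move=> P0 PD PZ Pm p; have [D /(_ _ (leqnn _)) pD] := boundedP p.
by rewrite (free_modE pD); apply: (big_ind P) => // b _; exact: PZ.
Qed.

Lemma mono_mulX S c i m : 'X_c *: mono S (i, m) = mono S (i, (U_(c) + m)%MM) :> free_mod S.
Proof. by rewrite /mono /= scalerA mpolyXD. Qed.

Lemma ev_mulX S (w : W S) c p : commuting w -> ev w ('X_c *: p) = mat w c *m ev w p.
Proof.
move=> cw; apply: (@free_mod_ind S (fun p => ev w ('X_c *: p) = mat w c *m ev w p)).
- by rewrite scaler0 ev0 mulmx0.
- by move=> q s hq hs; rewrite scalerDr !evD hq hs mulmxDr.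
- by move=> a q hq; rewrite scalerA mulrC -scalerA !evZ hq scalemxAr.
- move=> [i m]; rewrite mono_mulX !ev_mono /word_vec mulmxA; congr (_ *m _).
  by rewrite (word_mx_perm cw (mnm_wordS m c)).
Qed.

Lemma ev_delta S (w : W S) i : ev w (delta_mx 0 i) = col i (vecs w).
Proof.
have -> : delta_mx 0 i = mono S (i, 0%MM) by rewrite /mono /= mpolyX0 scale1r.
rewrite ev_mono /word_vec (_ : mnm_word 0 = [::]) ?mul1mx //.
by apply/nilP; rewrite /nilp -sum1_size big_flatten big_map big1 // => c _;
  rewrite mnm0E big_nil.
Qed.

Lemma ev_word S (w : W S) l i : commuting w ->
  ev w (mono S (i, word_mnm l)) = word_vec w (l, i).
Proof. by move=> cw; rewrite ev_mono /word_vec (word_mx_perm cw (word_mnmK l)). Qed.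

Lemma ker_submodule S (w : W S) : commuting w -> submodule (fun p => ev w p = 0).
Proof.
move=> cw; split; first exact: ev0.
move=> a x y hx hy; rewrite evD hy addr0; move: x hx; move: a {y hy}.
apply: mpoly_ring_ind => [c x hx|c x hx|a b ha hb x hx|a b ha hb x hx].
- by rewrite evZ hx scaler0.
- by rewrite ev_mulX // hx mulmx0.
- by rewrite scalerDl evD ha // hb // addr0.
- by rewrite -scalerA; apply: ha; exact: hb.
Qed.

Lemma ev_surj S (w : W S) : commuting w -> generating w -> forall u, exists p, ev w p = u.
Proof.
move=> cw gw; apply: gw.
- split; first by exists 0; exact: ev0.
  by move=> a x y [p <-] [q <-]; exists (a%:MP *: p + q); rewrite evD evZ.
- move=> u [p <-]; split.
  + by exists ('X_(@Ordinal 3 0 isT) *: p); rewrite ev_mulX.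
  + by exists ('X_(@Ordinal 3 1 isT) *: p); rewrite ev_mulX.
  + by exists ('X_(@Ordinal 3 2 isT) *: p); rewrite ev_mulX.
- by move=> i; exists (delta_mx 0 i); rewrite ev_delta.
Qed.

Lemma cV_sum_delta S (u : 'cV[S]_n) : u = \sum_j u j 0 *: delta_mx j 0.
Proof.
rewrite [LHS]matrix_sum_delta; apply: eq_bigr => j _; by rewrite big_ord1.
Qed.

Lemma mulmx_ext S m (M M' : 'M[S]_(m, n)) : (forall u : 'cV_n, M *m u = M' *m u) -> M = M'.
Proof.
move=> h; apply/matrixP => i j.
have := congr1 (fun v : 'cV_m => v i 0) (h (delta_mx j 0)).
by rewrite -!colE !mxE.
Qed.

(** Both evaluations identify the same quotient module with $S^n$. The change of basis intertwines
    the multiplications by the variables and the images of the generators. *)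
Lemma same_kernel_orbit S (w w' : W S) : commuting w -> generating w ->
  commuting w' -> generating w' -> (forall p, ev w p = 0 <-> ev w' p = 0) ->
  exists g h, g *m h = 1%:M /\ w' = act g h w.
Proof.
have half (u v : W S) : commuting u -> generating u ->
    (forall p, ev u p = 0 -> ev v p = 0) -> exists g : 'M[S]_n, forall p, g *m ev u p = ev v p.
  move=> cu gu uv.
  have /choice [q qP] := fun j => ev_surj cu gu (delta_mx j 0 : 'cV_n).
  exists (\matrix_(i, j) ev v (q j) i 0) => p; rewrite mulmx_col.
  have : ev u (p - \sum_j (ev u p j 0)%:MP *: q j) = 0.
    rewrite evB ev_sum {1}(cV_sum_delta (ev u p)) -sumrB big1 // => j _.
    by rewrite evZ qP subrr.
  move=> /uv; rewrite evB ev_sum => /eqP; rewrite subr_eq0 => /eqP ->.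
  apply: eq_bigr => j _; rewrite evZ; congr (_ *: _).
  by apply/colP => i; rewrite !mxE.
move=> cw gw cw' gw' e.
have [g gP] := half w w' cw gw (fun p => (e p).1).
have [h hP] := half w' w cw' gw' (fun p => (e p).2).
have gh : g *m h = 1%:M.
  apply: mulmx_ext => u; have [p <-] := ev_surj cw' gw' u.
  by rewrite -mulmxA hP gP mul1mx.
exists g, h; split=> //; apply: wcoord_ext; case=> [[[c i] j]|[i j]] /=.
  congr (fun_of_matrix _ i j); apply: mulmx_ext => u; have [p <-] := ev_surj cw' gw' u.
  by rewrite mat_act -!mulmxA hP -!ev_mulX // gP.
have := congr1 (fun v : 'cV_n => v i 0) (gP (delta_mx 0 j)).
by rewrite !ev_delta !colE mulmxA -!colE !mxE => <-.
Qed.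

(** Preimages [p j] of the standard basis split the evaluation. Modulo the base change of the kernel
    every element is a combination of their images ([red]), and evaluation over [T] detects its
    coefficients. *)
Lemma base_change_kernel S T (f : {lrmorphism S -> T}) (w : W S) : commuting w ->
  generating w -> forall q, ev (pmap W f w) q = 0 <->
    base_change f (fun p => ev w p = 0) q.
Proof.
move=> cw gw q; have cfw : commuting (pmap W f w).
  by move=> c c'; rewrite !mat_map -!map_mxM cw.
split=> [|bq]; last first.
  apply: (span_min (ker_submodule cfw)) bq => _ [p wp ->].
  by rewrite ev_map wp map_mx0.
set BC := base_change _ _; have sBC : submodule BC by exact: span_submodule.
have /choice [p pP] := fun j => ev_surj cw gw (delta_mx j 0 : 'cV_n).
have red q1 : exists c : 'I_n -> T, BC (q1 - \sum_j (c j)%:MP *: free_mod_map f (p j)).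
  apply: (@free_mod_ind T (fun q1 => exists c : 'I_n -> T,
    BC (q1 - \sum_j (c j)%:MP *: free_mod_map f (p j)))).
  - exists (fun=> 0); rewrite big1 ?subr0 => [|j _]; first exact: sBC.1.
    by rewrite mpolyC0 scale0r.
  - move=> x y [c hc] [d hd]; exists (fun j => c j + d j).
    have -> : \sum_j (c j + d j)%:MP *: free_mod_map f (p j) =
      \sum_j (c j)%:MP *: free_mod_map f (p j) + \sum_j (d j)%:MP *: free_mod_map f (p j).
      by rewrite -big_split; apply: eq_bigr => j _; rewrite mpolyCD scalerDl.
    by rewrite opprD addrACA; exact: submoduleD.
  - move=> a x [c hc]; exists (fun j => a * c j).
    have -> : \sum_j (a * c j)%:MP *: free_mod_map f (p j) =
      a%:MP *: \sum_j (c j)%:MP *: free_mod_map f (p j).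
      by rewrite scaler_sumr; apply: eq_bigr => j _; rewrite mpolyCM scalerA.
    by rewrite -scalerBr; exact: submoduleZ.
  - move=> b; exists (fun j => f (ev w (mono S b) j 0)).
    rewrite -free_mod_map_comb -(mono_map f) -free_mod_mapB; apply: span_sub.
    exists (mono S b - \sum_j (ev w (mono S b) j 0)%:MP *: p j) => //.
    rewrite evB ev_sum {1}(cV_sum_delta (ev w (mono S b))) -sumrB big1 // => j _.
    by rewrite evZ pP subrr.
have [c hc] := red q => q0.
have : ev (pmap W f w) (q - \sum_j (c j)%:MP *: free_mod_map f (p j)) = 0.
  apply: (span_min (ker_submodule cfw)) hc => _ [p1 wp ->].
  by rewrite ev_map wp map_mx0.
rewrite evB q0 sub0r ev_sum => /eqP; rewrite oppr_eq0 => /eqP c0.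
have {}c0 j : c j = 0.
  have := congr1 (fun u : 'cV_n => u j 0) c0; rewrite summxE (bigD1 j) //= big1.
    by rewrite evZ ev_map pP !mxE !eqxx lr1 mulr1 addr0.
  move=> i /negPf ne; rewrite evZ ev_map pP !mxE eq_sym ne /= lr0 mulr0 //.
have : BC (q - 0); last by rewrite subr0.
rewrite (_ : 0 = \sum_j (c j)%:MP *: free_mod_map f (p j)) //.
by rewrite big1 // => j _; rewrite c0 mpolyC0 scale0r.
Qed.

(** With [g] invertible the quotient is free on the classes of the [e j], and [eps] reads off
    coordinates. Multiplication by the variables gives the matrices, the classes of the standard
    generators give the vectors. *)
Lemma free_quotient_tuple S (N : free_mod S -> Prop) g (e : 'I_n -> free_mod S) :
  submodule N -> free_at N g e -> is_unit g ->
  exists w : W S, [/\ commuting w, generating w & forall p, ev w p = 0 <-> N p].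
Proof.
move=> sN [gen indep] ug.
have ex p : exists u : 'cV[S]_n, N (p - \sum_j (u j 0)%:MP *: e j).
  have [d [c hc]] := gen p; have [b gb] := is_unitX d ug.
  exists (\col_j (b * c j)).
  have -> : \sum_j ((\col_j (b * c j)) j (0 : 'I_1))%:MP *: e j =
      b%:MP *: \sum_j (c j)%:MP *: e j.
    by rewrite scaler_sumr; apply: eq_bigr => j _; rewrite mxE mpolyCM scalerA.
  rewrite -[p in p - _]scale1r -(mpolyC1 3 S) -gb mulrC mpolyCM -scalerA -scalerBr.
  exact: submoduleZ.
have /choice [eps epsP] := ex.
have sum_sub (u v : 'cV[S]_n) : \sum_j ((u - v) j 0)%:MP *: e j =
    \sum_j (u j 0)%:MP *: e j - \sum_j (v j 0)%:MP *: e j.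
  by rewrite -sumrB; apply: eq_bigr => j _; rewrite !mxE mpolyCB scalerBl.
have N0u (u : 'cV[S]_n) : N (\sum_j (u j 0)%:MP *: e j) -> u = 0.
  move=> /indep [d hd]; apply/colP => j; rewrite mxE.
  exact: (unitX0 (d := d) ug).
have uniq p (u : 'cV[S]_n) : N (p - \sum_j (u j 0)%:MP *: e j) -> eps p = u.
  move=> hu; apply/eqP; rewrite -subr_eq0; apply/eqP/N0u; rewrite sum_sub.
  have := submoduleB sN hu (epsP p).
  by rewrite opprB addrC addrA subrK.
have epsD p q : eps (p + q) = eps p + eps q.
  apply: uniq; have -> : \sum_j ((eps p + eps q) j 0)%:MP *: e j =
      \sum_j (eps p j 0)%:MP *: e j + \sum_j (eps q j 0)%:MP *: e j.
    by rewrite -big_split; apply: eq_bigr => j _; rewrite mxE mpolyCD scalerDl.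
  by rewrite opprD addrACA; exact: submoduleD.
have epsZ c p : eps (c%:MP *: p) = c *: eps p.
  apply: uniq; have := submoduleZ c%:MP sN (epsP p); congr N.
  rewrite scalerBr scaler_sumr; congr (_ - _); apply: eq_bigr => j _.
  by rewrite mxE mpolyCM scalerA.
have eps_sum (F : 'I_n -> free_mod S) : eps (\sum_j F j) = \sum_j eps (F j).
  apply: (big_morph eps epsD); apply: uniq; rewrite big1 ?subrr; first exact: sN.1.
  by move=> j _; rewrite mxE mpolyC0 scale0r.
have eps0 p : eps p = 0 <-> N p.
  split=> [p0|Np]; last first.
    apply: uniq; rewrite big1 ?subr0 // => j _; by rewrite mxE mpolyC0 scale0r.
  have := epsP p; rewrite p0 big1 ?subr0 // => j _; by rewrite mxE mpolyC0 scale0r.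
have eps_e (u : 'cV[S]_n) : eps (\sum_j (u j 0)%:MP *: e j) = u.
  by apply: uniq; rewrite subrr; exact: sN.1.
pose M c : 'M[S]_n := \matrix_(i, j) eps ('X_c *: e j) i 0.
have epsX c p : eps ('X_c *: p) = M c *m eps p.
  have : N ('X_c *: (p - \sum_j (eps p j 0)%:MP *: e j)) by apply: submoduleZ.
  rewrite scalerBr => /eps0; rewrite -scaleN1r -(mpolyC1 3 S) -mpolyCN epsD epsZ.
  rewrite scaleN1r => /eqP; rewrite subr_eq0 => /eqP ->.
  rewrite scaler_sumr eps_sum mulmx_col; apply: eq_bigr => j _.
  rewrite scalerA mulrC -scalerA epsZ; congr (_ *: _).
  by apply/colP => i; rewrite !mxE.
pose w : W S := tuple_of (fun c => match c with inl (c, i, j) => M c i j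
  | inr (i, j) => eps (delta_mx 0 j) i 0 end).
have matw c : mat w c = M c.
  by apply/matrixP => i j; exact: (wcoordK _ (inl (c, i, j))).
have vecw j : col j (vecs w) = eps (delta_mx 0 j).
  by apply/colP => i; rewrite mxE; exact: (wcoordK _ (inr (i, j))).
have cw : commuting w.
  move=> c c'; rewrite !matw; apply: mulmx_ext => u; rewrite -(eps_e u).
  by rewrite -!mulmxA -!epsX !scalerA mulrC.
have evw p : ev w p = eps p.
  have act_ind (a : {mpoly S[3]}) : forall p, ev w p = eps p -> ev w (a *: p) = eps (a *: p).
    elim/mpoly_ring_ind: a => [c|c|a b ha hb|a b ha hb] q hq.
    - by rewrite evZ epsZ hq.
    - by rewrite ev_mulX // epsX matw hq.
    - by rewrite scalerDl evD epsD ha // hb.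
    - by rewrite -scalerA; apply: ha; exact: hb.
  apply: (@free_mod_ind S (fun p => ev w p = eps p)).
  - by rewrite ev0; apply/esym/eps0; exact: sN.1.
  - by move=> q s hq hs; rewrite evD epsD hq hs.
  - by move=> c q; exact: act_ind.
  - by move=> b; apply: act_ind; rewrite ev_delta vecw.
exists w; split=> // [N' sN' NABC Nv u|p]; last by rewrite evw; exact: eps0.
rewrite -(eps_e u) -evw; apply: (@free_mod_ind S (fun p => N' (ev w p))).
- by rewrite ev0; exact: sN'.1.
- by move=> p q hp hq; rewrite evD; exact: submoduleD.
- by move=> c p hp; rewrite evZ; exact: submoduleZ.
- by move=> [i m]; rewrite ev_mono; exact: stable_word.
Qed.

End Evaluation.

(** * The closed immersion *)

Lemma free_mod_comb_scale (k : fieldType) (n r : nat) (S : comAlgType k) (a b : S)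
    (p : free_mod r S) (c : 'I_n -> S) (e : 'I_n -> free_mod r S) :
  a%:MP *: (b%:MP *: p - \sum_j (c j)%:MP *: e j) =
  (a * b)%:MP *: p - \sum_j (a * c j)%:MP *: e j.
Proof.
rewrite scalerBr scaler_sumr scalerA -mpolyCM; congr (_ - _).
by apply: eq_bigr => j _; rewrite scalerA -mpolyCM.
Qed.

Section Immersion.
Variables (k : fieldType) (n r : nat) (Q : functor k) (pi : morphism (U k n r) Q).
Hypothesis char0 : forall m, m.+1%:R != 0 :> k.
Hypothesis git : GIT_quotient pi.
Implicit Types S T L V : comAlgType k.
Local Notation W := (W k n r).
Local Notation U := (U k n r).
Local Notation free_mod := (@free_mod k r).
Local Notation Quot := (Quot k n r).

Let pi_inv : forall S (g h : 'M[S]_n) (w w' : U S), g *m h = 1%:M ->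
  sval w' = act g h (sval w) -> pi S w' = pi S w.
Proof. by case: git. Qed.

Let Qsheaf : zariski_sheaf Q.
Proof. by case: git. Qed.

Lemma commuting_act S (g h : 'M[S]_n) (w : W S) : g *m h = 1%:M ->
  commuting w -> commuting (act g h w).
Proof.
move=> gh cw c c'; have E (M N : 'M[S]_n) :
    (g *m M *m h) *m (g *m N *m h) = g *m (M *m N) *m h.
  by rewrite !mulmxA -(mulmxA _ h g) (mulmx1C gh) mulmx1.
by rewrite !mat_act !E cw.
Qed.

Lemma commuting_map S T (f : {lrmorphism S -> T}) (w : W S) :
  commuting w -> commuting (pmap W f w).
Proof. by move=> cw c c'; rewrite !mat_map -!map_mxM cw. Qed.

Lemma commuting_orbit S (w w' : U S) : pi S w = pi S w' ->
  commuting (sval w) -> commuting (sval w').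
Proof. by move=> /(git_orbit git) [g [h [gh ->]]]; exact: commuting_act. Qed.

Lemma ev_orbit S (w w' : U S) p : pi S w = pi S w' ->
  ev (sval w) p = 0 -> ev (sval w') p = 0.
Proof.
by move=> /(git_orbit git) [g [h [gh ->]]] e; rewrite (ev_act _ _ gh) e mulmx0.
Qed.

Lemma pi_comp S T V (f : {lrmorphism S -> T}) (g : {lrmorphism T -> V})
    (h : {lrmorphism S -> V}) (q : Q S) (w : U T) : g \o f =1 h ->
  pi T w = pmap Q f q -> pi V (pmap U g w) = pmap Q h q.
Proof. by move=> e wq; rewrite mor_nat wq (pmap_compE _ e). Qed.

Lemma mx_eq0_local S m1 m2 (M : 'M[S]_(m1, m2)) (G : S -> Prop) : unit_ideal G ->
  (forall g, G g -> forall T (f : {lrmorphism S -> T}), is_unit (f g) -> map_mx f M = 0) ->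
  M = 0.
Proof.
move=> G1 h; apply/matrixP => i j; apply: (eq_local G1) => g Gg T f ug.
have := congr1 (fun M : 'M_(m1, m2) => M i j) (h g Gg T f ug).
by rewrite !mxE lr0.
Qed.

Lemma commuting_local S (w : W S) (G : S -> Prop) : unit_ideal G ->
  (forall g, G g -> forall T (f : {lrmorphism S -> T}), is_unit (f g) ->
     commuting (pmap W f w)) -> commuting w.
Proof.
move=> G1 h c c'; apply/eqP; rewrite -subr_eq0; apply/eqP.
apply: (mx_eq0_local G1) => g Gg T f ug.
by rewrite map_mxB !map_mxM -!mat_map (h g Gg T f ug) subrr.
Qed.

Definition represents S (N : Quot S) T (f : {lrmorphism S -> T}) (w : U T) : Prop :=
  commuting (sval w) /\ forall p, ev (sval w) p = 0 <-> base_change f (sval N) p.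

Lemma free_at_represents S (N : Quot S) g e T (f : {lrmorphism S -> T}) :
  free_at (n := n) (sval N) g e -> is_unit (f g) -> exists w, represents N f w.
Proof.
move=> fr ug; have fr' := free_at_base_change f (svalP N).1 fr.
have [w [cw gw wN]] := free_quotient_tuple (span_submodule _) fr' ug.
by exists (exist _ w gw).
Qed.

Lemma represents_cover S (N : Quot S) : unit_ideal (fun g =>
  forall T (f : {lrmorphism S -> T}), is_unit (f g) -> exists w, represents N f w).
Proof.
have [_ lf] := svalP N; apply/unit_idealP.
apply: unit_ideal_min lf; first exact: idealspan_ideal.
by move=> g [e fr]; apply: idealspan_sub => T f; exact: (free_at_represents fr).
Qed.

Lemma represents_pi S (N : Quot S) T (f : {lrmorphism S -> T}) w w' :
  represents N f w -> represents N f w' -> pi T w = pi T w'.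
Proof.
move=> [cw wN] [cw' wN'].
have [|g [h [gh e]]] := same_kernel_orbit cw (svalP w) cw' (svalP w').
  by move=> p; split=> [/wN /wN'|/wN' /wN].
by rewrite (pi_inv gh e).
Qed.

Lemma base_change_comp S (N : Quot S) T V (f : {lrmorphism S -> T}) (h : {lrmorphism T -> V}) :
  base_change h (base_change f (sval N)) = base_change (h \o f) (sval N).
Proof. by have := congr1 sval (pmap_comp (f0 := Quot) f h N). Qed.

Lemma represents_map S (N : Quot S) T V (f : {lrmorphism S -> T}) (h : {lrmorphism T -> V}) w :
  represents N f w -> represents N (h \o f) (pmap U h w).
Proof.
move=> [cw wN]; split=> [|p]; first exact: commuting_map.
have E : base_change f (sval N) = (fun p => ev (sval w) p = 0).
  by apply/funext => x; apply/propext; split=> /wN.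
have bc : base_change (h \o f : {lrmorphism S -> V}) (sval N) =
    base_change h (fun p => ev (sval w) p = 0).
  by rewrite -E; exact: esym (base_change_comp N f h).
by rewrite bc; exact: (base_change_kernel h cw (svalP w)).
Qed.

Lemma iota_exists S (N : Quot S) : exists q : Q S,
  forall T (f : {lrmorphism S -> T}) w, represents N f w -> pmap Q f q = pi T w.
Proof.
have [||| q qP] := sheaf_glue Qsheaf
  (Rel := fun T (f : {lrmorphism S -> T}) x => exists w, represents N f w /\ x = pi T w).
- move=> T V f g _ [w [wN ->]]; exists (pmap U g w); split; last by rewrite mor_nat.
  exact: represents_map.
- by move=> T f _ _ [w [wN ->]] [w' [wN' ->]]; exact: represents_pi wN wN'.
- apply/unit_idealP; apply: unit_ideal_min (represents_cover N) => [|g gP].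
    exact: idealspan_ideal.
  apply: idealspan_sub => T f /gP [w wN]; by exists (pi T w), w.
by exists q => T f w wN; apply: qP; exists w.
Qed.

Definition iota_point S (N : Quot S) : Q S := sval (cid (iota_exists N)).

Lemma iota_pointP S (N : Quot S) T (f : {lrmorphism S -> T}) w :
  represents N f w -> pmap Q f (iota_point N) = pi T w.
Proof. exact: (svalP (cid (iota_exists N))). Qed.

Lemma iota_unique S (N : Quot S) (q : Q S) (G : S -> Prop) : unit_ideal G ->
  (forall g, G g -> forall T (f : {lrmorphism S -> T}), is_unit (f g) ->
     exists w, represents N f w /\ pi T w = pmap Q f q) -> iota_point N = q.
Proof.
move=> G1 h; apply: (sheaf_sep Qsheaf G1) => g Gg T f ug.
by have [w [wN <-]] := h g Gg T f ug; exact: iota_pointP.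
Qed.

Lemma iota_nat S T (f : {lrmorphism S -> T}) (N : Quot S) :
  iota_point (pmap Quot f N) = pmap Q f (iota_point N).
Proof.
apply: (iota_unique (represents_cover (pmap Quot f N))) => g gP V h /gP [w wN].
exists w; split=> //; rewrite -pmap_comp; apply/esym/iota_pointP.
by move: wN; rewrite /represents /= base_change_comp.
Qed.

Definition iota : morphism Quot Q := @Morphism k Quot Q iota_point iota_nat.

(** Membership in [N'] is local. Where [N'] has a basis, [p] has coordinates [c]; a tuple
    representing [N'] is locally conjugate to one representing [N], hence kills [p], and so [c] is
    killed by a power of [g]. *)
Lemma iota_le S (N N' : Quot S) : iota_point N = iota_point N' ->
  forall p, sval N p -> sval N' p.
Proof.
move=> e p Np; have [sN' lf] := svalP N'.
rewrite -[p]scale1r -(mpolyC1 3 S).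
apply: (@unit_ideal_pow _ _ _ (fun a => sval N' (a%:MP *: p))) lf.
  apply: mkideal => [|x y hx hy|a x hx].
  - by rewrite mpolyC0 scale0r; exact: sN'.1.
  - by rewrite mpolyCD scalerDl; exact: submoduleD.
  - by rewrite mpolyCM -scalerA; exact: submoduleZ.
move=> g [b fr]; have [[d [c hc]] _] := (fr.1 p, fr.2).
have [d' hd'] : exists d', forall j, g ^+ d' * c j = 0.
  apply: ex_uniform => [j d1 d2 le h|j]; first by rewrite -(subnK le) exprD -mulrA h mulr0.
  apply: eq0_at => T f ug.
  have [sT frT] : submodule (base_change f (sval N')) /\
    free_at (base_change f (sval N')) (f g) (fun j => free_mod_map f (b j)).
    by split; [exact: span_submodule | exact: free_at_base_change].
  have [w [cw wN']] := free_at_represents fr ug.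
  have wp : ev (sval w) (free_mod_map f p) = 0.
    have G1 : unit_ideal (fun x => exists2 y, (forall T (f : {lrmorphism S -> T}),
        is_unit (f y) -> exists w, represents N f w) & x = f y).
      by apply: unit_ideal_map (represents_cover N) => y hy; exists y.
    apply: (mx_eq0_local G1) => _ [y hy ->] V h uh.
    have [w1 w1N] := hy V (h \o f) uh; rewrite -ev_map.
    have w2N : represents N' (h \o f) (pmap U h w) by apply: represents_map; split.
    apply: (@ev_orbit V w1 (pmap U h w)).
      by rewrite -(iota_pointP w1N) -(iota_pointP w2N) e.
    have -> : free_mod_map h (free_mod_map f p) = free_mod_map (h \o f) p.
      by apply/matrixP => i j'; rewrite !mxE; apply/mpolyP => m; rewrite !mcoeff_map_mpoly.
    by apply/w1N.2; apply: span_sub; exists p.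
  have : base_change f (sval N') (\sum_j (f (c j))%:MP *: free_mod_map f (b j)).
    have : base_change f (sval N') (free_mod_map f ((g ^+ d)%:MP *: p - \sum_j (c j)%:MP *: b j)).
      by apply: span_sub; exists ((g ^+ d)%:MP *: p - \sum_j (c j)%:MP *: b j).
    rewrite free_mod_mapB free_mod_map_comb free_mod_mapZ => h1.
    rewrite -[X in base_change _ _ X](subKr (map_mpoly f (g ^+ d)%:MP *: free_mod_map f p)).
    apply: submoduleB => //; apply: submoduleZ => //; exact/wN'.
  by move=> /frT.2 [d1 /(_ j)]; exact: unitX0.
exists (d' + d)%N; rewrite exprD mpolyCM -scalerA.
have -> : (g ^+ d')%:MP *: ((g ^+ d)%:MP *: p) =
    (g ^+ d')%:MP *: ((g ^+ d)%:MP *: p - \sum_j (c j)%:MP *: b j).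
  rewrite scalerBr scaler_sumr [X in _ = _ - X]big1 ?subr0 // => j _.
  by rewrite scalerA -mpolyCM hd' mpolyC0 scale0r.
exact: submoduleZ.
Qed.

Lemma iota_inj S : injective (iota S).
Proof.
move=> N N' e; apply: eq_sig_hprop => [x|]; first exact: Prop_irrelevance.
apply/funext => p; apply/propext; split; exact: iota_le.
Qed.

(** Asking for all lifts over all algebras makes the condition stable under base change by
    construction; [comm_point_local] reduces it to one lift over each member of a cover. *)
Definition comm_point S (q : Q S) : Prop :=
  forall T (f : {lrmorphism S -> T}) (w : U T), pi T w = pmap Q f q -> commuting (sval w).

Lemma iota_comm S (N : Quot S) : comm_point (iota_point N).
Proof.
move=> T f w wq; have := unit_ideal_map (f := f) (H := fun x => exists2 y,
  (forall T (f : {lrmorphism S -> T}), is_unit (f y) -> exists w, represents N f w) &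
  x = f y) _ (represents_cover N) => /(_ _)/commuting_local; apply.
  by move=> y hy; exists y.
move=> _ [y hy ->] V h uh; have [w1 w1N] := hy V (h \o f) uh.
apply: (@commuting_orbit V w1 (pmap U h w) _ w1N.1).
by rewrite -(iota_pointP w1N) mor_nat wq -pmap_comp.
Qed.

(** A finite cover by actual localizations, for the arguments in which denominators are cleared with
    a common exponent. *)
Lemma lifted_cover S (q : Q S) : exists m (a : 'I_m -> S) (S_ : 'I_m -> comAlgType k)
    (l : forall i, {lrmorphism S -> S_ i}) (w : forall i, U (S_ i)),
  [/\ unit_ideal (fun x => exists i, x = a i), forall i, is_localization (a i) (l i) &
      forall i, pi _ (w i) = pmap Q (l i) q].
Proof.
have [m [a [S_ [l [Ga a1 loc]]]]] := affine_cover (lift_cover char0 git q).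
have ex i : exists w : U (S_ i), pi _ w = pmap Q (l i) q.
  have [X liftX] := Ga i; have [ul _ _] := loc i.
  by have [w [wq _]] := liftX _ _ ul; exists w.
exists m, a, S_, l, (fun i => sval (cid (ex i))); split=> // i.
exact: svalP (cid (ex i)).
Qed.

Lemma cover_map S T (f : {lrmorphism S -> T}) m (a : 'I_m -> S) :
  unit_ideal (fun x => exists i, x = a i) -> unit_ideal (fun x => exists i, x = f (a i)).
Proof. by apply: unit_ideal_map => _ [i ->]; exists i. Qed.

Lemma comm_point_local S (q : Q S) :
  (forall X g, lift_at pi q X g -> forall T (f : {lrmorphism S -> T}), is_unit (f g) ->
     exists w : U T, pi T w = pmap Q f q /\ commuting (sval w)) -> comm_point q.
Proof.
move=> h T f w wq; have := unit_ideal_map (f := f) (H := fun x => exists2 y,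
  (exists X, lift_at pi q X y) & x = f y) _ (lift_cover char0 git q)
  => /(_ _)/commuting_local; apply; first by move=> y hy; exists y.
move=> _ [y [X hy] ->] V g ug; have [w1 [w1q cw1]] := h X y hy V (g \o f) ug.
apply: (@commuting_orbit V w1 (pmap U g w) _ cw1).
by rewrite w1q mor_nat wq -pmap_comp.
Qed.

(** * Recovering the submodule from a point with commuting lifts *)

Section Kernel.
Variables (S : comAlgType k) (q : Q S) (cq : comm_point q).

Definition kernel_point (p : free_mod S) : Prop :=
  forall T (f : {lrmorphism S -> T}) (w : U T), pi T w = pmap Q f q ->
    ev (sval w) (free_mod_map f p) = 0.

Lemma kernel_point_submodule : submodule kernel_point.
Proof.
split=> [T f w wq|a x y hx hy T f w wq].
  by rewrite /free_mod_map map_mx0 ev0.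
have sk := ker_submodule (cq wq).
rewrite free_mod_mapD free_mod_mapZ; apply: (submoduleD sk); last exact: hy.
by apply: (submoduleZ _ sk); exact: hx.
Qed.

(** On each of finitely many charts a power of [g] kills the value of [p]; the largest exponent
    works for all, and any other lift is locally conjugate to those on the charts. *)
Lemma kernel_point_radical g p :
  (forall T (f : {lrmorphism S -> T}) (w : U T), pi T w = pmap Q f q -> is_unit (f g) ->
     ev (sval w) (free_mod_map f p) = 0) ->
  exists e, kernel_point ((g ^+ e)%:MP *: p).
Proof.
move=> h; have [m [a [S_ [l [w [a1 loc wq]]]]]] := lifted_cover q.
have [e eP] : exists e, forall ic : 'I_m * 'I_n,
    l ic.1 g ^+ e * ev (sval (w ic.1)) (free_mod_map (l ic.1) p) ic.2 0 = 0.
  apply: ex_uniform => [ic d1 d2 le hd|[i c]] /=.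
    by rewrite -(subnK le) exprD -mulrA hd mulr0.
  apply: eq0_at => T f uf.
  have := h T (f \o l i) (pmap U f (w i)) _ uf.
  have -> : free_mod_map (f \o l i) p = free_mod_map f (free_mod_map (l i) p).
    by apply/matrixP => x y; rewrite !mxE; apply/mpolyP => z; rewrite !mcoeff_map_mpoly.
  rewrite [sval _]/(pmap W f (sval (w i))) ev_map => /(_ (pi_comp (frefl _) (wq i))).
  by move=> /(congr1 (fun M : 'cV_n => M c 0)); rewrite !mxE.
exists e => T f v vq.
apply: (mx_eq0_local (cover_map f a1)) => _ [i ->] V h' uh.
have [E EE] := localization_factor (f := h' \o f) (loc i) uh.
rewrite -ev_map.
have -> : free_mod_map h' (free_mod_map f ((g ^+ e)%:MP *: p)) =
    free_mod_map E (free_mod_map (l i) ((g ^+ e)%:MP *: p)).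
  apply/matrixP => x y; rewrite !mxE; apply/mpolyP => z; rewrite !mcoeff_map_mpoly.
  exact: esym (EE _).
apply: (@ev_orbit V (pmap U E (w i)) (pmap U h' v)).
  by rewrite (pi_comp EE (wq i)) mor_nat vq -pmap_comp.
rewrite [sval _]/(pmap W E (sval (w i))) ev_map free_mod_mapZ map_mpolyC evZ.
have -> : l i (g ^+ e) *: ev (sval (w i)) (free_mod_map (l i) p) = 0.
  by apply/colP => c; rewrite mxE lrX (eP (i, c)) mxE.
exact: map_mx0.
Qed.

Definition word_basis (X : 'I_n -> seq 'I_3 * 'I_r) j : free_mod S :=
  mono S ((X j).2, word_mnm (X j).1).

Lemma ev_word_basis X T (f : {lrmorphism S -> T}) (w : U T) j : pi T w = pmap Q f q ->
  frame X (sval w) = 1%:M -> ev (sval w) (free_mod_map f (word_basis X j)) = delta_mx j 0.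
Proof.
move=> wq fw; rewrite mono_map (ev_word _ _ (cq wq)) -surjective_pairing.
by apply/colP => i; rewrite -frameE fw !mxE eqxx andbT.
Qed.

Lemma ev_word_comb X T (f : {lrmorphism S -> T}) (w : U T) (c : 'I_n -> T) :
  pi T w = pmap Q f q -> frame X (sval w) = 1%:M ->
  ev (sval w) (\sum_j (c j)%:MP *: free_mod_map f (word_basis X j)) = \col_j c j.
Proof.
move=> wq fw; rewrite ev_sum [RHS]cV_sum_delta; apply: eq_bigr => j _.
by rewrite evZ (ev_word_basis _ wq fw) mxE.
Qed.

(** A lift with frame 1 sends the monomials of the words in [X] to the standard basis. The
    coordinates of [p] over $S_g$ are fractions; after clearing denominators the difference vanishes
    wherever [g] is invertible, hence lies in the kernel up to a power of [g]. *)
Lemma kernel_point_free X g : lift_at pi q X g -> free_at kernel_point g (word_basis X).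
Proof.
move=> lg; split=> [p|c Nc]; last first.
  apply: ex_uniform => [j d1 d2 le h|j]; first by rewrite -(subnK le) exprD -mulrA h mulr0.
  apply: eq0_at => T f /lg [w [wq fw]].
  have := Nc T f w wq; rewrite free_mod_map_comb (ev_word_comb _ wq fw).
  by move=> /(congr1 (fun M : 'cV_n => M j 0)); rewrite !mxE.
(* For nilpotent [g] there is no localization, but a power of [g] kills every [p]. *)
have [[e ge]|gn] := pselect (exists e, g ^+ e = 0).
  exists e, (fun=> 0); rewrite ge mpolyC0 scale0r big1 ?subr0 => [|j _].
    exact: kernel_point_submodule.1.
  by rewrite scale0r.
have [|T [l loc]] := @localization_exists _ S g; first by move=> e ge; apply: gn; exists e.
have [ul lsurj _] := loc; have [w [wq fw]] := lg T l ul.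
have [d /choice [c hc]] : exists d, forall j, exists c,
    ev (sval w) (free_mod_map l p) j 0 * l g ^+ d = l c.
  apply: ex_uniform => [j d1 d2 le [c hc]|j].
    by exists (g ^+ (d2 - d1) * c); rewrite lrM lrX -hc mulrCA -exprD subnK.
  by have [c [d hc]] := lsurj (ev (sval w) (free_mod_map l p) j 0); exists d, c.
have [|e he] := @kernel_point_radical g ((g ^+ d)%:MP *: p - \sum_j (c j)%:MP *: word_basis X j).
  move=> V f v vq uf; have [E EE] := localization_factor (f := f) loc uf.
  have -> : free_mod_map f ((g ^+ d)%:MP *: p - \sum_j (c j)%:MP *: word_basis X j) =
      free_mod_map E (free_mod_map l ((g ^+ d)%:MP *: p - \sum_j (c j)%:MP *: word_basis X j)).
    apply/matrixP => x y; rewrite !mxE; apply/mpolyP => z; rewrite !mcoeff_map_mpoly.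
    exact: esym (EE _).
  apply: (@ev_orbit V (pmap U E w) v); first by rewrite (pi_comp EE wq) vq.
  rewrite [sval _]/(pmap W E (sval w)) ev_map.
  rewrite free_mod_mapB free_mod_map_comb free_mod_mapZ map_mpolyC evB evZ.
  rewrite (ev_word_comb _ wq fw) (_ : _ - _ = 0) ?map_mx0 //.
  apply/colP => j; rewrite !mxE /= -hc lrX mulrC.
  by apply/eqP; rewrite subr_eq0.
exists (e + d)%N, (fun j => g ^+ e * c j); move: he.
by rewrite free_mod_comb_scale -exprD.
Qed.

Lemma kernel_quot_point : quot_point n kernel_point.
Proof.
split; first exact: kernel_point_submodule.
apply/unit_idealP; apply: unit_ideal_min (lift_cover char0 git q) => [|g [X lg]].
  exact: idealspan_ideal.
by apply: idealspan_sub; exists (word_basis X); exact: kernel_point_free.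
Qed.

Lemma comm_image : mor_image iota q.
Proof.
exists (exist _ kernel_point kernel_quot_point).
apply: (iota_unique (lift_cover char0 git q)) => g [X lg] T f ug.
have [w [wq fw]] := lg T f ug; exists w; split=> //; split=> [|p]; first exact: cq wq.
have sk := ker_submodule (cq wq).
set BC := base_change f _.
have BCk p' : BC p' -> ev (sval w) p' = 0.
  by apply: (span_min sk) => _ [x Nx ->]; exact: Nx.
split=> [wp|]; last exact: BCk.
have [gen _] := free_at_base_change f kernel_point_submodule (kernel_point_free lg).
have sBC : submodule BC by exact: span_submodule.
have [d [c hc]] := gen p.
have c0 j : c j = 0.
  have /eqP := BCk _ hc; rewrite evB evZ wp scaler0 sub0r oppr_eq0 (ev_word_comb _ wq fw).
  by move=> /eqP /(congr1 (fun M : 'cV_n => M j 0)); rewrite !mxE.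
move: hc; rewrite big1 ?subr0 => [hp|j _]; last by rewrite c0 mpolyC0 scale0r.
have [b gb] := is_unitX d ug.
rewrite -[p]scale1r -(mpolyC1 3 T) -gb mulrC mpolyCM -scalerA.
exact: submoduleZ.
Qed.

End Kernel.

Lemma image_comm S (q : Q S) : mor_image iota q <-> comm_point q.
Proof.
split=> [[N <-]|]; first exact: iota_comm.
exact: comm_image.
Qed.

(** [I] consists of all functions vanishing wherever the lifts commute; the issue is that it is
    large enough. An entry of a commutator on chart $i$ is a fraction $b/a_i^d$. On another chart,
    where $a_i$ is invertible, the lifts are conjugate, so $b$ lies in the ideal of the commutator
    entries there up to a power of $a_i$. With a common exponent over the finitely many charts,
    $a_i^e b$ belongs to [I]. *)
Lemma comm_closed : closed_subset (mor_image iota).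
Proof.
move=> S q; pose I (a : S) := forall T (f : {lrmorphism S -> T}), comm_point (pmap Q f q) ->
  f a = 0.
exists I => T f; rewrite image_comm; split=> [cf a|fI]; first by apply.
move=> V h v vq.
have [m [a [S_ [l [w [a1 loc wq]]]]]] := lifted_cover q.
pose D i c c' := mat (sval (w i)) c *m mat (sval (w i)) c' -
  mat (sval (w i)) c' *m mat (sval (w i)) c.
have killed i c c' x y : exists b d e, D i c c' x y * l i (a i) ^+ d = l i b /\ I (a i ^+ e * b).
  have [_ lsurj _] := loc i; have [b [d hb]] := lsurj (D i c c' x y).
  have [e eP] : exists e, forall i', idealspan
      (fun z => exists c c' x y, z = D i' c c' x y) (l i' (a i) ^+ e * l i' b).
    apply: ex_uniform => [i' d1 d2 le hd|i'].
      rewrite -(subnK le) exprD -mulrA; apply: idealM => //; exact: idealspan_ideal.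
    apply: mem_radical => T' phi ua phiD.
    have [E EE] := localization_factor (f := phi \o l i') (loc i) ua.
    have cE : commuting (pmap W E (sval (w i))).
      apply: (@commuting_orbit T' (pmap U phi (w i')) (pmap U E (w i))).
        by rewrite (pi_comp EE (wq i)) (pi_comp (frefl _) (wq i')).
      move=> c1 c2; rewrite [sval _]/(pmap W phi (sval (w i'))) !mat_map -!map_mxM.
      apply/eqP; rewrite -subr_eq0 -map_mxB; apply/eqP/matrixP => x' y'.
      by rewrite [LHS]mxE [RHS]mxE; apply: phiD; exists c1, c2, x', y'.
    have ED : E (D i c c' x y) = 0.
      have -> : E (D i c c' x y) = map_mx E (D i c c') x y by rewrite [RHS]mxE.
      by rewrite /D map_mxB !map_mxM -!mat_map cE subrr mxE.
    by rewrite -[LHS]EE /= -hb lrM ED mul0r.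
  exists b, d, e; split=> // T' g cg.
  apply: (eq_local (cover_map g a1)) => _ [i' ->] T2 h2 u2.
  have [E EE] := localization_factor (f := h2 \o g) (loc i') u2.
  have cE : commuting (pmap W E (sval (w i'))).
    by apply: (cg T2 h2 (pmap U E (w i'))); rewrite (pi_comp EE (wq i')) -pmap_comp.
  rewrite lr0 -[LHS]EE /= lrM lrX.
  apply: (idealspan_min (ker_ideal E)) (eP i') => _ [c1 [c2 [x' [y' ->]]]].
  have -> : E (D i' c1 c2 x' y') = map_mx E (D i' c1 c2) x' y' by rewrite [RHS]mxE.
  by rewrite /D map_mxB !map_mxM -!mat_map cE subrr mxE.
apply: (commuting_local (cover_map (h \o f : {lrmorphism S -> V}) a1)) => _ [i ->] T' g ug.
have [E EE] := localization_factor (f := g \o (h \o f)) (loc i) ug.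
apply: (@commuting_orbit T' (pmap U E (w i)) (pmap U g v)).
  rewrite (pi_comp EE (wq i)) mor_nat vq -!pmap_comp; congr (pmap Q _ q).
  exact: lrmorphism_ext.
move=> c c'; rewrite [sval _]/(pmap W E (sval (w i))) !mat_map -!map_mxM.
apply/eqP; rewrite -subr_eq0 -map_mxB -/(D i c c'); apply/eqP/matrixP => x y.
rewrite [LHS]mxE [RHS]mxE.
have [b [d [e [hb Ib]]]] := killed i c c' x y.
have Eb : E (l i b) = 0.
  rewrite [LHS]EE; apply: (unitX0 (d := e) ug).
  by have := congr1 (g \o h) (fI _ Ib); rewrite /= !lrM !lrX !lr0.
have ua : is_unit (E (l i (a i))) by apply: is_unit_map; case: (loc i).
by apply: (unitX0 (d := d) ua); rewrite mulrC -lrX -lrM hb.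
Qed.

Lemma iota_closed_immersion : closed_immersion iota.
Proof. by split; [exact: iota_inj | exact: comm_closed]. Qed.

End Immersion.

(** * The potential *)

Section SquareZeroFacts.
Variables (k : fieldType) (S : comAlgType k) (M : lmodType S).

Lemma sqzero_section_exists :
  exists s : {lrmorphism S -> sqzero M}, s =1 (fun a => (a, 0) : sqzero M).
Proof.
apply: mk_lrmorphism.
- by move=> a b; congr pair; rewrite subr0.
- by split=> // a b; congr pair; rewrite /= !scaler0 addr0.
- by move=> c a; congr pair; rewrite /= scaler0.
Qed.

Definition sqzero_in : {lrmorphism S -> sqzero M} := sval (cid sqzero_section_exists).
Lemma sqzero_inE a : sqzero_in a = (a, 0). Proof. exact: svalP (cid sqzero_section_exists) a. Qed.

Definition sqzero_eps (m : M) : sqzero M := (0, m).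

Lemma sqzeroE (x : sqzero M) : x = sqzero_in x.1 + sqzero_eps x.2.
Proof. by rewrite sqzero_inE; case: x => a m; congr pair; rewrite /= ?addr0 ?add0r. Qed.

Lemma sqzero_eps_mul m m' : sqzero_eps m * sqzero_eps m' = 0.
Proof. by congr pair; rewrite /= ?mulr0 // !scale0r addr0. Qed.

Lemma sqzero_in_eps a m : sqzero_in a * sqzero_eps m = sqzero_eps (a *: m).
Proof. by rewrite sqzero_inE; congr pair; rewrite /= ?mulr0 // scaler0 addr0. Qed.

Lemma sqzero_fst_in a : @sqzero_fst k S M (sqzero_in a) = a.
Proof. by rewrite sqzero_inE. Qed.

End SquareZeroFacts.

Definition restriction (k : fieldType) (S T : comAlgType k) (l : {lrmorphism S -> T}) : Type := T.

Section Restriction.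
Variables (k : fieldType) (S T : comAlgType k) (l : {lrmorphism S -> T}).
Local Notation E := (restriction l).
HB.instance Definition _ := GRing.Zmodule.copy E T.
Definition restriction_scale (a : S) (x : E) : E := l a * x.
Fact restriction_scaleA a b x :
  restriction_scale a (restriction_scale b x) = restriction_scale (a * b) x.
Proof. by rewrite /restriction_scale lrM mulrA. Qed.
Fact restriction_scale1 : left_id 1 restriction_scale.
Proof. by move=> x; rewrite /restriction_scale lr1 mul1r. Qed.
Fact restriction_scaleDr : right_distributive restriction_scale +%R.
Proof. by move=> c x y; rewrite /restriction_scale; exact: mulrDr. Qed.
Fact restriction_scaleDl x : {morph restriction_scale^~ x : a b / a + b}.
Proof. by move=> a b; rewrite /restriction_scale lrD; exact: mulrDl. Qed.
HB.instance Definition _ := GRing.Zmodule_isLmodule.Build S E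
  restriction_scaleA restriction_scale1 restriction_scaleDr restriction_scaleDl.

(** As an [l]-semilinear map the identity induces, via [sqzero_map], a morphism from the extension
    of [S] by this module to the dual numbers over [T], where the deformation is computed. *)
Definition restriction_id (x : E) : (T : comAlgType k)^o := x.
Fact restriction_id_additive : zmod_morphism restriction_id. Proof. by []. Qed.
Fact restriction_id_scalable : scalable_for (l \; *:%R) restriction_id. Proof. by []. Qed.
HB.instance Definition _ := GRing.isZmodMorphism.Build E (T : comAlgType k)^o restriction_id
  restriction_id_additive.
HB.instance Definition _ := GRing.isScalable.Build S E (T : comAlgType k)^o (l \; *:%R)
  restriction_id restriction_id_scalable.
End Restriction.

Section Potential.
Variables (k : fieldType) (n r : nat).
Implicit Types S T L V : comAlgType k.
Local Notation W := (W k n r).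

Lemma potential_map S T (f : {lrmorphism S -> T}) (w : W S) :
  potential (pmap W f w) = f (potential w).
Proof.
rewrite /potential /= -!map_mxM -map_mxB -map_mxM; exact: trace_map_mx.
Qed.

Lemma mat0 S (w : W S) : mat w (@Ordinal 3 0 isT) = matA w. Proof. by []. Qed.
Lemma mat1 S (w : W S) : mat w (@Ordinal 3 1 isT) = matB w. Proof. by []. Qed.
Lemma mat2 S (w : W S) : mat w (@Ordinal 3 2 isT) = matC w. Proof. by []. Qed.

(* At a commuting tuple the potential is stationary along I modulo I^2. *)
Lemma potential_near_commuting S (I : S -> Prop) (w w0 : W S) : ideal I ->
  (forall x y, I x -> I y -> x * y = 0) -> commuting w0 ->
  (forall c i j, I (mat w c i j - mat w0 c i j)) -> potential w = 0.
Proof.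
move=> iI I2 c0 ww0.
pose J (M : 'M[S]_n) := forall i j, I (M i j).
have JJ M N : J M -> J N -> M *m N = 0.
  by move=> JM JN; apply/matrixP => i j; rewrite !mxE big1 // => l _; exact: I2.
have JD M N : J M -> J N -> J (M + N) by move=> JM JN i j; rewrite mxE; exact: idealD.
have JMl M N : J N -> J (M *m N).
  by move=> JN i j; rewrite mxE; apply: ideal_sum => // l _; exact: idealM.
have JMr M N : J M -> J (M *m N).
  by move=> JM i j; rewrite mxE; apply: ideal_sum => // l _; exact: idealMr.
have JN M : J M -> J (- M).
  by move=> JM i j; rewrite mxE -mulN1r; exact: idealM.
have Jw c : J (mat w c - mat w0 c) by move=> i j; rewrite !mxE; exact: ww0.
have Jcomm c c' : J (mat w c *m mat w0 c' - mat w0 c' *m mat w c).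
  have -> : mat w c *m mat w0 c' - mat w0 c' *m mat w c =
      (mat w c - mat w0 c) *m mat w0 c' - mat w0 c' *m (mat w c - mat w0 c).
    by rewrite mulmxBl mulmxBr (c0 c c') opprB addrA subrK.
  by apply: JD; [exact: JMr | exact/JN/JMl].
have Jcc c c' : J (mat w c *m mat w c' - mat w c' *m mat w c).
  have -> : mat w c *m mat w c' - mat w c' *m mat w c =
    (mat w c *m (mat w c' - mat w0 c') - (mat w c' - mat w0 c') *m mat w c) +
    (mat w c *m mat w0 c' - mat w0 c' *m mat w c).
    by rewrite mulmxBr mulmxBl opprB -addrA [_ - _ + (_ - _)]addrC !addrA !subrK.
  by apply: (JD) => //; apply: JD; [exact: JMl | exact/JN/JMr].
rewrite /potential -mat0 -mat1 -mat2.
set A := mat w _; set B := mat w _; set C := mat w _.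
pose A0 := mat w0 (@Ordinal 3 0 isT); pose B0 := mat w0 (@Ordinal 3 1 isT).
set X := B *m C - C *m B; have JX : J X by exact: Jcc.
(* The difference is a product of two matrices with entries in [I], hence 0. The same device
   replaces [B] by [B0] once the cyclicity of the trace has moved the commutator. *)
have -> : A *m X = A0 *m X.
  by apply/eqP; rewrite -subr_eq0 -mulmxBl; apply/eqP/JJ => //; exact: Jw.
set Y := C *m A0 - A0 *m C; have JY : J Y by exact: Jcomm.
have -> : \tr (A0 *m X) = \tr (Y *m B).
  rewrite mulmxBr mulmxBl !raddfB /=; congr (_ - _); last by rewrite mulmxA.
  by rewrite mulmxA mxtrace_mulC mulmxA.
have -> : Y *m B = Y *m B0.
  by apply/eqP; rewrite -subr_eq0 -mulmxBr; apply/eqP/JJ => //; exact: Jw.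
rewrite mulmxBl raddfB /= -!mulmxA mxtrace_mulC -!mulmxA.
rewrite [\tr (A0 *m _)]mxtrace_mulC -!mulmxA.
have e : A0 *m B0 = B0 *m A0 by exact: c0.
apply/eqP; rewrite subr_eq0; apply/eqP.
by rewrite mxtrace_mulC -mulmxA e [RHS]mxtrace_mulC -mulmxA.
Qed.

Definition perturb S (w : W S) (v : S) (c0 : 'I_3) (P : 'M[S]_n) : W S :=
  tuple_of (fun x => match x with
    | inl (c, i, j) => mat w c i j + (if c == c0 then v * P i j else 0)
    | inr (i, j) => vecs w i j end).

Lemma mat_perturb S (w : W S) v c0 P c :
  mat (perturb w v c0 P) c = mat w c + (if c == c0 then v *: P else 0).
Proof.
apply/matrixP => i j; rewrite [LHS](wcoordK _ (inl (c, i, j))) mxE.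
by case: eqP => _; rewrite !mxE.
Qed.

Lemma vecs_perturb S (w : W S) v c0 P : vecs (perturb w v c0 P) = vecs w.
Proof. by apply/matrixP => i j; rewrite [LHS](wcoordK _ (inr (i, j))). Qed.

Lemma tuple_ext S (w w' : W S) : mat w =1 mat w' -> vecs w = vecs w' -> w = w'.
Proof.
move=> eM ev; apply: wcoord_ext => -[[[c i] j]|[i j]] /=; first by rewrite eM.
by rewrite ev.
Qed.

Lemma perturb_map S T (f : {lrmorphism S -> T}) (w : W S) v c0 P :
  pmap W f (perturb w v c0 P) = perturb (pmap W f w) (f v) c0 (map_mx f P).
Proof.
apply: tuple_ext => [c|]; last first.
  by rewrite vecs_perturb [LHS]/(map_mx f (vecs (perturb w v c0 P))) vecs_perturb.
rewrite mat_map !mat_perturb mat_map map_mxD; congr (_ + _).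
by case: eqP => _; rewrite ?map_mx0 //; exact: map_mxZ.
Qed.

Lemma perturb_act S (g h : 'M[S]_n) (w : W S) v c0 P :
  perturb (act g h w) v c0 (g *m P *m h) = act g h (perturb w v c0 P).
Proof.
apply: tuple_ext => [c|]; last by rewrite vecs_perturb [RHS]/(g *m vecs (perturb w v c0 P)) vecs_perturb.
rewrite mat_act !mat_perturb mat_act mulmxDr mulmxDl; congr (_ + _).
by case: eqP => _; rewrite ?mulmx0 ?mul0mx // -scalemxAr -scalemxAl.
Qed.

Lemma perturbZ S (w : W S) v u c0 P : perturb w v c0 (u *: P) = perturb w (v * u) c0 P.
Proof.
apply: tuple_ext => [c|]; last by rewrite !vecs_perturb.
by rewrite !mat_perturb; case: eqP => // _; rewrite scalerA.
Qed.

Lemma perturb0 S (w : W S) c0 P : perturb w 0 c0 P = w.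
Proof.
apply: tuple_ext => [c|]; last by rewrite vecs_perturb.
by rewrite mat_perturb; case: eqP; rewrite ?scale0r addr0.
Qed.

Lemma perturb_generating S (w : W S) v c0 P : v * v = 0 -> generating w ->
  generating (perturb w v c0 P).
Proof.
move=> v2 gw; apply: (generating_nil gw) => L f Lf; rewrite perturb_map.
have -> : f v = 0; last by rewrite perturb0.
apply: contrapT => /Lf [b fb].
have /eqP : f v * f v * (b * b) = 0 by rewrite -lrM v2 lr0 mul0r.
by rewrite mulrACA !fb mulr1 oner_eq0.
Qed.

Definition next (c : 'I_3) : 'I_3 := inord (c.+1 %% 3).

(** The gradient of the potential in the component [c] under the trace form; the cyclic numbering
    takes care of the signs. *)
Definition bracket_of S (w : W S) c : 'M[S]_n :=
  mat w (next c) *m mat w (next (next c)) - mat w (next (next c)) *m mat w (next c).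

Lemma bracket_of_commuting S (w : W S) : (forall c, bracket_of w c = 0) -> commuting w.
Proof.
move=> h.
have h0 c c1 c2 : next c = c1 -> next (next c) = c2 -> mat w c1 *m mat w c2 = mat w c2 *m mat w c1.
  by move=> <- <-; apply/eqP; rewrite -subr_eq0; apply/eqP/h.
pose o0 := @Ordinal 3 0 isT; pose o1 := @Ordinal 3 1 isT; pose o2 := @Ordinal 3 2 isT.
have n0 : next o0 = o1 by apply: val_inj; rewrite /= inordK.
have n1 : next o1 = o2 by apply: val_inj; rewrite /= inordK.
have n2 : next o2 = o0 by apply: val_inj; rewrite /= inordK.
have c12 : mat w o1 *m mat w o2 = mat w o2 *m mat w o1 by apply: (h0 o0); rewrite ?n0 ?n1.
have c20 : mat w o2 *m mat w o0 = mat w o0 *m mat w o2 by apply: (h0 o1); rewrite ?n1 ?n2.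
have c01 : mat w o0 *m mat w o1 = mat w o1 *m mat w o0 by apply: (h0 o2); rewrite ?n2 ?n0.
have all3 c : [\/ c = o0, c = o1 | c = o2].
  by case: c => -[|[|[|//]]] p; [constructor 1|constructor 2|constructor 3]; exact: val_inj.
by move=> c c'; case: (all3 c) => ->; case: (all3 c') => ->.
Qed.

(** An exact identity for every [v]: the potential is linear in each matrix separately, and
    cyclicity of the trace brings the perturbed factor to the front. *)
Lemma potential_perturb S (w : W S) v c P :
  potential (perturb w v c P) = potential w + v * \tr (P *m bracket_of w c).
Proof.
pose o0 := @Ordinal 3 0 isT; pose o1 := @Ordinal 3 1 isT; pose o2 := @Ordinal 3 2 isT.
have n0 : next o0 = o1 by apply: val_inj; rewrite /= inordK.
have n1 : next o1 = o2 by apply: val_inj; rewrite /= inordK.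
have n2 : next o2 = o0 by apply: val_inj; rewrite /= inordK.
have cyc (M N K : 'M[S]_n) : \tr (M *m (N *m K)) = \tr (N *m (K *m M)).
  by rewrite mxtrace_mulC mulmxA.
rewrite /potential -!mat0 -!mat1 -!mat2 !mat_perturb -/o0 -/o1 -/o2.
have [->|[->|->]] : c = o0 \/ c = o1 \/ c = o2.
  by case: c => -[|[|[|//]]] p; [left|right; left|right; right]; exact: val_inj.
- rewrite eqxx /= !addr0 mulmxDl raddfD /= /bracket_of n0 n1 -scalemxAl; congr (_ + _).
  exact: mxtraceZ.
- rewrite eqxx /= !addr0 /bracket_of n1 n2.
  move: (mat w o0) (mat w o1) (mat w o2) => A B C.
  have -> : (B + v *: P) *m C - C *m (B + v *: P) =
      (B *m C - C *m B) + v *: (P *m C - C *m P).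
    by rewrite mulmxDl mulmxDr opprD addrACA -scalemxAl -scalemxAr scalerBr.
  rewrite mulmxDr raddfD /= -scalemxAr mxtraceZ; congr (_ + _ * _).
  by rewrite !mulmxBr !raddfB /= cyc -[\tr (P *m (A *m C))]cyc -[\tr (C *m _)]cyc.
- rewrite eqxx /= !addr0 /bracket_of n2 n0.
  move: (mat w o0) (mat w o1) (mat w o2) => A B C.
  have -> : B *m (C + v *: P) - (C + v *: P) *m B =
      (B *m C - C *m B) + v *: (B *m P - P *m B).
    by rewrite mulmxDl mulmxDr opprD addrACA -scalemxAl -scalemxAr scalerBr.
  rewrite mulmxDr raddfD /= -scalemxAr mxtraceZ; congr (_ + _ * _).
  by rewrite !mulmxBr !raddfB /= cyc [\tr (B *m _)]cyc; congr (_ - _); exact: cyc.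
Qed.

End Potential.

(** * The critical locus *)

Section CriticalLocus.
Variables (k : fieldType) (n r : nat) (Q : functor k) (pi : morphism (U k n r) Q).
Hypothesis char0 : forall m, m.+1%:R != 0 :> k.
Hypothesis git : GIT_quotient pi.
Variable f : morphism Q (A1 k).
Hypothesis fP : forall (S : comAlgType k) (w : U k n r S),
  f S (pi S w) = potential (sval w).
Implicit Types S T L V R : comAlgType k.
Local Notation W := (W k n r).
Local Notation U := (U k n r).

Let pi_inv : forall S (g h : 'M[S]_n) (w w' : U S), g *m h = 1%:M ->
  sval w' = act g h (sval w) -> pi S w' = pi S w.
Proof. by case: git. Qed.

Let Qsheaf : zariski_sheaf Q.
Proof. by case: git. Qed.

(** Any lift of [g] is invertible: its determinant times a lift of the inverse determinant is $1+v$
    with $v^2=0$, and $1-v$ inverts this. *)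
Lemma lift_nilpotent_matrix S T (p : {lrmorphism S -> T}) (I : S -> Prop) (g h : 'M[T]_n) :
  (forall y, exists x, y = p x) -> (forall x, p x = 0 <-> I x) ->
  (forall x y, I x -> I y -> x * y = 0) -> g *m h = 1%:M ->
  exists g1 h1 : 'M[S]_n, [/\ g1 *m h1 = 1%:M, map_mx p g1 = g & map_mx p h1 = h].
Proof.
move=> psurj pI I2 gh.
have /choice [lift liftE] := psurj.
pose g1 := map_mx lift g.
have pg1 : map_mx p g1 = g by apply/matrixP => i j; rewrite !mxE -liftE.
have ug : is_unit (\det g1).
  have [b hb] := detg_unit gh; have [a ea] := psurj b.
  pose v := \det g1 * a - 1.
  have Iv : I v.
    apply/pI; rewrite lrB lrM lr1 -det_map_mx pg1 -ea hb; exact: subrr.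
  exists (a * (1 - v)); rewrite mulrA (_ : \det g1 * a = 1 + v); last by rewrite addrC subrK.
  by rewrite mulrC -subr_sqr expr1n expr2 (I2 _ _ Iv Iv) subr0.
pose h1 := uinv (\det g1) *: \adj g1.
have gh1 : g1 *m h1 = 1%:M.
  by rewrite -scalemxAr mul_mx_adj scale_scalar_mx mulrC mulr_uinv.
exists g1, h1; split=> //.
have : map_mx p g1 *m map_mx p h1 = 1%:M by rewrite -map_mxM gh1 map_mx1.
rewrite pg1 => gph; rewrite -[LHS]mul1mx -(mulmx1C gh) -mulmxA gph; exact: mulmx1.
Qed.

(** Modulo the ideal generated by the image of [M], the point [y] and the constant extension of [q]
    coincide, so [w] and [w0] become conjugate. The conjugating matrix lifts because the ideal has
    square zero; thus [w] differs from a commuting tuple by entries in this ideal. *)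
Lemma comm_potential S (q : Q S) (M : lmodType S) (y : Q (sqzero M)) T
    (F : {lrmorphism sqzero M -> T}) (w w0 : U T) :
  pmap Q (@sqzero_fst k S M) y = q -> pi T w = pmap Q F y ->
  pi T w0 = pmap Q (F \o sqzero_in M) q -> commuting (sval w0) ->
  potential (sval w) = 0.
Proof.
move=> yq wy w0q cw0.
pose I := idealspan (fun x => exists m, x = F (sqzero_eps m)).
have iI : ideal I by exact: idealspan_ideal.
have Ieps m x : I x -> F (sqzero_eps m) * x = 0.
  apply: (idealspan_min (J := fun x => F (sqzero_eps m) * x = 0)).
    apply: mkideal => [|a b ha hb|a b hb]; first exact: mulr0.
      by rewrite mulrDr ha hb addr0.
    by rewrite mulrCA hb mulr0.
  by move=> _ [m' ->]; rewrite -lrM sqzero_eps_mul lr0.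
have I2 x z : I x -> I z -> x * z = 0.
  move=> Ix Iz; apply: (idealspan_min (J := fun x => x * z = 0)) Ix.
    apply: mkideal => [|a b ha hb|a b hb]; first exact: mul0r.
      by rewrite mulrDl ha hb addr0.
    by rewrite -mulrA hb mulr0.
  by move=> _ [m ->]; exact: Ieps.
have I1 : ~ I 1.
  by move=> I1; have /eqP := I2 _ _ I1 I1; rewrite mulr1 oner_eq0.
have [R [p [psurj pI]]] := quotient_algebra iI I1.
have pF (x : sqzero M) : p (F x) = p (F (sqzero_in M (@sqzero_fst k S M x))).
  rewrite [in LHS](sqzeroE x) !lrD (_ : p (F (sqzero_eps _)) = 0) ?addr0 //.
  by apply/pI/idealspan_sub; exists x.2.
have e : pi R (pmap U p w0) = pi R (pmap U p w).
  rewrite !mor_nat wy w0q -yq -!pmap_comp; congr (pmap Q _ y).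
  by apply: lrmorphism_ext => x /=; rewrite [RHS]pF.
have [g [h [gh ew]]] := git_orbit git e.
have [g1 [h1 [gh1 pg ph]]] := lift_nilpotent_matrix psurj pI I2 gh.
apply: (potential_near_commuting iI I2 (commuting_act gh1 cw0)) => c i j.
apply/pI; rewrite lrB; apply/eqP; rewrite subr_eq0; apply/eqP.
have E (v : W T) : p (mat v c i j) = mat (pmap W p v) c i j.
  by rewrite mat_map [RHS]mxE.
by rewrite !E act_map pg ph; congr (mat _ c i j).
Qed.

Lemma comm_zero S (q : Q S) : comm_point pi q -> zero_scheme (exact_form f) q.
Proof.
move=> cq M y yq; rewrite /exact_form /=.
(* The value of [f] vanishes along with its derivative, so no component needs to be isolated. *)
suff -> : f (sqzero M) y = 0 by [].
apply: (eq_local (lift_cover char0 git y)) => g [X lg] T F ug; rewrite lr0.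
have [w [wy _]] := lg T F ug.
have -> : F (f _ y) = f T (pmap Q F y) by rewrite mor_nat.
rewrite -wy fP.
pose Fs := F \o sqzero_in M : {lrmorphism S -> T}.
have c1 : unit_ideal (fun x => exists2 z, (exists X, lift_at pi q X z) & x = Fs z).
  by apply: unit_ideal_map (lift_cover char0 git q) => z hz; exists z.
apply: (eq_local c1) => _ [z [X' lz] ->] V h uh; rewrite lr0 -potential_map.
have [w0 [w0q _]] := lz V (h \o Fs) uh.
apply: (@comm_potential S q M y V (h \o F) (pmap U h w) w0) => //.
- by rewrite mor_nat wy -pmap_comp.
- by rewrite w0q; congr (pmap Q _ q); exact: lrmorphism_ext.
- exact: (cq V (h \o Fs)).
Qed.

(** * Deformations detecting the entries of the commutators *)

Section Deformation.
Variables (S : comAlgType k) (q : Q S) (X : 'I_n -> seq 'I_3 * 'I_r) (g : S).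
Hypothesis lg : lift_at pi q X g.
Variables (Sg : comAlgType k) (l : {lrmorphism S -> Sg}).
Hypothesis ul : is_unit (l g).
Variables (c0 : 'I_3) (i0 j0 : 'I_n).

Local Notation M := (restriction l : lmodType S).
Local Notation E := (sqzero M).

(** The conjugate of an elementary matrix by the frame, with the adjugate in place of the inverse:
    defined for every tuple, at the price of a factor $\det a$ under the action of [a]. *)
Definition direction T (w : W T) : 'M[T]_n :=
  frame X w *m delta_mx i0 j0 *m \adj (frame X w).

Lemma direction_map T V (h : {lrmorphism T -> V}) (w : W T) :
  map_mx h (direction w) = direction (pmap W h w).
Proof. by rewrite /direction !map_mxM map_mx_adj map_delta_mx !frame_map. Qed.

Lemma direction_act T (a b : 'M[T]_n) (w : W T) : a *m b = 1%:M ->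
  direction (act a b w) = \det a *: (a *m direction w *m b).
Proof.
move=> ab; rewrite /direction frame_act // (adj_mul_unit _ ab) -scalemxAr.
by rewrite !mulmxA.
Qed.

(** The element $g^{-d}$ of the localization, seen as a vector of the module. *)
Definition gpow d : M := uinv (l g) ^+ d.

Lemma gpowD d e : g ^+ d *: gpow (e + d) = gpow e.
Proof.
have aux (x u : Sg) : x * u = 1 -> x ^+ d * u ^+ (e + d) = u ^+ e.
  by move=> xu; rewrite exprD mulrCA -exprMn xu expr1n mulr1.
rewrite [LHS]/(l (g ^+ d) * uinv (l g) ^+ (e + d)) lrX.
by apply: aux; exact: mulr_uinv.
Qed.

(* The first-order deformation w + eps s(w)^{-1} F E_{ij} adj(F) of the lift w,
   where F is the frame of w, s(w) its determinant, and eps s(w)^{-1} makes sense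
   as an element of R because s(w) divides a power of g. *)
Definition deformed R (F : {lrmorphism E -> R}) (x : Q R) : Prop :=
  exists (w w1 : U R) a d,
  [/\ pi R w = pmap Q (F \o sqzero_in M) q,
      bracket X (sval w) * a = F (sqzero_in M g) ^+ d,
      sval w1 = perturb (sval w) (a * F (sqzero_eps (gpow d))) c0 (direction (sval w)) &
      x = pi R w1].

Lemma eps_gpow R (F : {lrmorphism E -> R}) d e :
  F (sqzero_eps (gpow d)) = F (sqzero_in M g) ^+ e * F (sqzero_eps (gpow (d + e))).
Proof. by rewrite -lrX -lrM -lrX sqzero_in_eps gpowD. Qed.

Lemma deformed_map R V (F : {lrmorphism E -> R}) (h : {lrmorphism R -> V}) x :
  deformed F x -> deformed (h \o F) (pmap Q h x).
Proof.
move=> [w [w1 [a [d [wq wa e1 ->]]]]].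
exists (pmap U h w), (pmap U h w1), (h a), d; split.
- by rewrite mor_nat wq -pmap_comp; congr (pmap Q _ q); exact: lrmorphism_ext.
- by rewrite [sval _]/(pmap W h (sval w)) bracket_map -lrM wa lrX.
- apply: etrans (congr1 (pmap W h) e1) _; rewrite perturb_map lrM direction_map.
  by [].
- by rewrite mor_nat.
Qed.

(** Under a change of lift the direction and the bracket are multiplied by the same determinant, so
    their quotient is equivariant. Different exponents [d] are compared at their sum, by
    [eps_gpow]. *)
Lemma deformed_fun R (F : {lrmorphism E -> R}) x x' :
  deformed F x -> deformed F x' -> x = x'.
Proof.
move=> [w [w1 [a [d [wq wa e1 ->]]]]] [w' [w1' [a' [d' [wq' wa' e1' ->]]]]].
have [b [b' [bb ew]]] := git_orbit git (etrans wq (esym wq')).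
apply/esym/(pi_inv bb); rewrite e1 e1' ew direction_act // -perturb_act perturbZ.
congr (perturb _ _ _ _).
rewrite (eps_gpow F d' d) (eps_gpow F d d') [(d' + d)%N]addnC -wa -wa' ew.
rewrite (bracket_act _ _ bb); set m := F _.
rewrite [RHS]mulrA [a * _]mulrC [a' * _]mulrA [LHS]mulrAC; congr (_ * m).
by rewrite [LHS]mulrC -!mulrA; congr (_ * _); exact: mulrCA.
Qed.

(** Here [w] is a lift adapted to another frame. Its bracket for [X] divides a power of [g]: where
    [g] is invertible there is a lift with frame 1 in the same orbit, so this bracket cannot
    vanish. *)
Lemma deformed_cover : unit_ideal (fun e : E => forall R (F : {lrmorphism E -> R}),
  is_unit (F e) -> exists x, deformed F x).
Proof.
apply: (unit_ideal_map (f := sqzero_in M)) (lift_cover char0 git q) => z [Y lz] R F uz.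
have [w [wq _]] := lz R (F \o sqzero_in M) uz.
have [d [m [a [b [bE e1]]]]] : exists e,
    idealspan (fun x => x = bracket X (sval w)) (F (sqzero_in M g) ^+ e * 1).
  apply: mem_radical => V h ug hb.
  have [w' [w'q fw']] := lg (f := h \o (F \o sqzero_in M)) ug.
  have e : pi V w' = pi V (pmap U h w) by rewrite w'q mor_nat wq -pmap_comp.
  have [p [p' [pp ew]]] := git_orbit git e.
  have := detg_unit pp; rewrite -[\det p]mulr1 -(bracket_frame1 fw') -(bracket_act _ _ pp).
  by rewrite -ew [sval _]/(pmap W h (sval w)) bracket_map hb // => /is_unit0.
have E1 : bracket X (sval w) * \sum_i a i = F (sqzero_in M g) ^+ d.
  rewrite -[RHS]mulr1 e1 mulr_sumr; apply: eq_bigr => i _.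
  by rewrite bE mulrC.
pose v := (\sum_i a i) * F (sqzero_eps (gpow d)).
have v2 : v * v = 0.
  by rewrite mulrACA -lrM sqzero_eps_mul lr0 mulr0.
pose w1 : U R := exist _ _
  (@perturb_generating _ _ _ _ (sval w) v c0 (direction (sval w)) v2 (svalP w)).
by exists (pi R w1), w, w1, (\sum_i a i), d.
Qed.

Lemma deformation_exists : exists y : Q E,
  pmap Q (@sqzero_fst k S M) y = q /\
  forall R (F : {lrmorphism E -> R}) x, deformed F x -> pmap Q F y = x.
Proof.
have [y yP] := sheaf_glue Qsheaf deformed_map deformed_fun deformed_cover.
exists y; split=> //.
have cov : unit_ideal (fun z => exists2 e, (forall R (F : {lrmorphism E -> R}),
    is_unit (F e) -> exists x, deformed F x) & z = @sqzero_fst k S M e).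
  by apply: (unit_ideal_map (f := @sqzero_fst k S M)) deformed_cover => e he; exists e.
apply: (sheaf_sep Qsheaf cov).
move=> _ [e he ->] R h uh.
have [x dx] := he R (h \o @sqzero_fst k S M) uh.
rewrite -pmap_comp (yP _ _ _ dx).
have [w [w1 [a [d [wq _ e1 ->]]]]] := dx.
have -> : w1 = w.
  apply: U_ext; rewrite e1.
  have -> : (h \o @sqzero_fst k S M : {lrmorphism E -> R}) (sqzero_eps (gpow d)) = 0
    by exact: (lr0 h).
  by rewrite mulr0 perturb0.
rewrite wq; congr (pmap Q _ q); apply: lrmorphism_ext => z /=.
by rewrite sqzero_fst_in.
Qed.

End Deformation.

(** The deformed point is pushed to the dual numbers over $S_g$, where the lift [w0] has frame 1.
    There the deformation just adds $\epsilon$ times an elementary matrix to one component, and the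
    derivative of the potential is one entry of a commutator of [w0]. *)
Lemma zero_comm S (q : Q S) : zero_scheme (exact_form f) q -> comm_point pi q.
Proof.
move=> zq; apply: (comm_point_local char0 git) => X g lg T h uh.
have [|Sg [l loc]] := @localization_exists _ S g.
  by move=> e ge; have := is_unitX e uh; rewrite -lrX ge lr0; exact: is_unit0.
have [ul _ _] := loc; have [w0 [w0q fw0]] := lg Sg l ul.
suff cw0 : commuting (sval w0).
  have [E EE] := localization_factor (f := h) loc uh.
  exists (pmap U E w0); split; last exact: commuting_map.
  by rewrite mor_nat w0q -pmap_comp; congr (pmap Q _ q); exact: lrmorphism_ext.
apply: bracket_of_commuting => c; apply/matrixP => i j; rewrite [RHS]mxE.
(* The indices are swapped because the trace of $E_{ji}N$ is $N_{ij}$. *)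
have [y [yq yP]] := @deformation_exists S q X g lg Sg l ul c j i.
have z0 := zq _ y yq; rewrite /exact_form /= in z0.
pose u : {linear restriction l -> (Sg : comAlgType k)^o | l \; *:%R} :=
  @restriction_id k S Sg l.
pose F : {lrmorphism sqzero (restriction l) -> sqzero (Sg : comAlgType k)^o} := sqzero_map u.
pose inR := sqzero_in (Sg : comAlgType k)^o.
have bw : bracket X (pmap W inR (sval w0)) = 1.
  by rewrite bracket_map (bracket_frame1 fw0) lr1.
pose v := F (sqzero_eps (gpow g l 0)).
have vE : v = sqzero_eps (1 : (Sg : comAlgType k)^o).
  by congr pair; rewrite /= ?lr0 // /gpow expr0.
have v2 : v * v = 0 by rewrite vE sqzero_eps_mul.
pose w1 : U _ := exist _ _ (@perturb_generating _ _ _ _ (pmap W inR (sval w0)) v c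
  (direction X j i (pmap W inR (sval w0))) v2 (svalP (pmap U inR w0))).
have yF : pmap Q F y = pi _ w1.
  apply: yP; exists (pmap U inR w0), w1, 1, 0%N; split.
  - rewrite mor_nat w0q -pmap_comp; congr (pmap Q _ q); apply: lrmorphism_ext => x.
    apply: etrans (sqzero_inE _ _) (esym _); apply: etrans (congr1 F (sqzero_inE _ _)) _.
    by congr pair; exact: raddf0.
  - by rewrite mulr1 expr0.
  - by rewrite mul1r.
  - by [].
have f0 : (f _ (pmap Q F y)).2 = 0.
  have -> : f _ (pmap Q F y) = F (f _ y) by rewrite mor_nat.
  exact: etrans (congr1 u z0) (raddf0 u).
have key a b : (inR a + sqzero_eps (1 : (Sg : comAlgType k)^o) * inR b).2 = b.
  by rewrite !sqzero_inE /= scaler0 !add0r; exact: mulr1.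
have tr_delta (N : 'M[sqzero (Sg : comAlgType k)^o]_n) : \tr (delta_mx j i *m N) = N i j.
  rewrite /mxtrace (bigD1 j) //= mxE (bigD1 i) //= !mxE !eqxx mul1r.
  rewrite big1 ?addr0 => [|i' /negPf ne]; last by rewrite !mxE ne andbF mul0r.
  rewrite big1 ?addr0 // => j' /negPf ne.
  by rewrite mxE big1 // => i' _; rewrite !mxE ne mul0r.
have dirE : direction X j i (pmap W inR (sval w0)) = delta_mx j i.
  rewrite /direction frame_map fw0 map_mx1 adj1 mul1mx; exact: mulmx1.
have brE : bracket_of (pmap W inR (sval w0)) c = map_mx inR (bracket_of (sval w0) c).
  by rewrite /bracket_of !mat_map map_mxB !map_mxM.
have E : potential (sval w1) = inR (potential (sval w0)) +
    sqzero_eps (1 : (Sg : comAlgType k)^o) * inR (bracket_of (sval w0) c i j).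
  apply: etrans (potential_perturb _ _ _ _) _.
  by rewrite potential_map dirE brE tr_delta [in LHS]mxE vE.
rewrite -[LHS](key (potential (sval w0))) -E -fP -yF; exact: f0.
Qed.

End CriticalLocus.

Unset Implicit Arguments.

Theorem theorem2p6 (R : realType) (r n : nat) (r_ge1 : (1 <= r)%N)
    (* ncQuot is the non-commutative Quot scheme, the GIT quotient of U by GL_n,
       with quotient morphism pi; f is the function on it induced by Tr A[B,C] *)
    (ncQuot : functor R[i]) (pi : morphism (U R[i] n r) ncQuot)
    (ncQuotP : GIT_quotient pi)
    (f : morphism ncQuot (A1 R[i]))
    (fP : forall (S : comAlgType R[i]) (w : U R[i] n r S),
        f S (pi S w) = potential (sval w)) :
  exists iota : morphism (Quot R[i] n r) ncQuot,
    closed_immersion iota /\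
    forall (S : comAlgType R[i]) (x : ncQuot S),
      mor_image iota x <-> zero_scheme (exact_form f) x.
Proof.
have char0 m : m.+1%:R != 0 :> R[i] by rewrite pnatr_eq0.
exists (iota ncQuotP); split; first exact: iota_closed_immersion char0 ncQuotP.
move=> S x; rewrite (image_comm char0 ncQuotP); split.
  exact: (comm_zero char0 ncQuotP fP).
exact: (zero_comm char0 ncQuotP fP).
Qed.
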